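(* Let $\Omega\subset\mathbb R^d$ be open and bounded with $\mathscr L^d(\partial\Omega)=0$, let $\mathcal A$ be a constant rank homogeneous operator from $W$ to $X$, and let $A_1,\dots,A_n\in W_{\mathcal A}\cap S_W$ satisfy $0\in\operatorname{conv}\{A_1,\dots,A_n\}$. Then there exist $c_1,\dots,c_n\in[0,1]$ with $\sum_ic_i=1$ and $c_1A_1+\dots+c_nA_n=0$, and a sequence $\{w_j\}\subset C^\infty(\Omega;W)$ with $\mathcal Aw_j=0$ on $\Omega$, such that $w_j\,\mathscr L^d$ generates on $\Omega$ the Young measure $$(\delta_{A_1},\ \mathscr L^d\llcorner\Omega,\ p),\qquad p=c_1\delta_{A_1}+\dots+c_n\delta_{A_n}.$$ An analogous statement holds for $\mathcal B$-potentials: if $\mathcal B$ is a constant rank homogeneous operator from $V$ to $W$ and $A_1,\dots,A_n\in S_W\cap\operatorname{span}\mathrm I_{\mathcal B}$ satisfy $0\in\operatorname{conv}\{A_1,\dots,A_n\}$, then there exist $c_1,\dots,c_n\in[0,1]$ with $\sum_ic_i=1$ and $c_1A_1+\dots+c_nA_n=0$, and a sequence $\{u_j\}\subset C^\infty(\Omega;V)$, such that $\mathcal Bu_j\,\mathscr L^d$ generates on $\Omega$ the Young measure $(\delta_{A_1},\mathscr L^d\llcorner\Omega,p)$ with $p=c_1\delta_{A_1}+\dots+c_n\delta_{A_n}$.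
   Context: $V,W,X$ are finite-dimensional real inner product spaces, $S_W$ and $B_W$ the unit sphere and open unit ball of $W$; $\mathscr L^d$ is Lebesgue measure, and $\mathscr L^d\llcorner\Omega$ is its restriction to $\Omega$. Operators: $\mathcal A=\sum_{|\alpha|=k}A_\alpha\partial^\alpha$, $A_\alpha\in\mathrm{Lin}(W,X)$, with symbol $\mathbb A(\xi)=(2\pi\mathrm i)^k\sum_{|\alpha|=k}\xi^\alpha A_\alpha$ (the scalar factor is immaterial for kernels, images and ranks), and similarly $\mathcal B$ from $V$ to $W$ with symbol $\mathbb B(\xi)$. Constant rank: the rank of the symbol is a fixed positive integer for all $\xi\in\mathbb R^d\setminus\{0\}$. $\Lambda_{\mathcal A}=\bigcup_{\xi\ne0}\ker\mathbb A(\xi)$, $W_{\mathcal A}=\operatorname{span}\Lambda_{\mathcal A}$, $\mathrm I_{\mathcal B}=\bigcup_{\xi\in\mathbb R^d}\operatorname{Im}\mathbb B(\xi)$. $\mathbf E(\Omega;W)$ is the set of $f\in C(\Omega\times W)$ such that $(Sf)(x,\hat z)=(1-|\hat z|)f(x,\hat z/(1-|\hat z|))$ on $\Omega\times B_W$ extends continuously to $\overline{\Omega\times B_W}$; then $f^\infty(x,z)=\lim_{x'\to x,\,z'\to z,\,t\to\infty}f(x',tz')/t$ exists on $\overline\Omega\times W$. For $v_j\in L^1(\Omega;W)$, $A\in W$, $\lambda$ a finite positive measure on $\Omega$ and $p\in\mathrm{Prob}(S_W)$ (the probability measures on $S_W$), saying that $v_j\mathscr L^d$ generates $(\delta_A,\lambda,p)$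 on $\Omega$ means: for all $f\in\mathbf E(\Omega;W)$, $$\int_\Omega f(x,v_j(x))\,dx\to\int_\Omega f(x,A)\,dx+\int_\Omega\int_{S_W}f^\infty(x,z)\,dp(z)\,d\lambda(x).$$ *)

(* Defs.v *)
From HB Require Import structures.
From mathcomp Require Import all_boot all_order all_algebra.
From mathcomp Require Import all_classical all_reals all_analysis.
From mathcomp Require Import measurable_realfun.

Set Implicit Arguments.
Unset Strict Implicit.
Unset Printing Implicit Defensive.

Import Order.TTheory GRing.Theory Num.Theory numFieldNormedType.Exports.

Local Open Scope classical_set_scope.
Local Open Scope ring_scope.

(* Finite-dimensional real inner product spaces: the library's normed modules
   and finite-dimensional vector spaces are joined, and the norm is required to
   come from an inner product.  The matrix types 'rV[R]_d are NOT instances,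
   since the library gives them the sup norm. *)
HB.mixin Record NormedModule_isEuclidean (R : realType) V
    of NormedModule R V & Vector R V := {
  inner : V -> V -> R ;
  innerC : forall x y, inner x y = inner y x ;
  innerDl : forall x y z, inner (x + y) z = inner x z + inner y z ;
  innerZl : forall a x y, inner (a *: x) y = a * inner x y ;
  inner_norm : forall x, inner x x = `|x| ^+ 2 }.

#[short(type="euclideanType")]
HB.structure Definition Euclidean (R : realType) :=
  {V of NormedModule_isEuclidean R V & NormedModule R V & Vector R V}.

Definition unit_sphere (R : realType) (W : euclideanType R) : set W :=
  [set z | `|z| = 1].
Arguments unit_sphere {R} W.

Definition unit_ball (R : realType) (W : euclideanType R) : set W :=
  [set z | `|z| < 1].
Arguments unit_ball {R} W.

Definition lin_span (R : fieldType) (V : vectType R) (S : set V) : set V :=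
  [set v | exists2 s : seq V, (forall u, u \in s -> S u) & v \in span s].

Definition conv_hull (R : realType) (V : lmodType R) (S : set V) : set V :=
  [set v | exists n (t : 'I_n -> R) (x : 'I_n -> V),
    [/\ forall i, 0 <= t i, \sum_i t i = 1, forall i, S (x i)
      & v = \sum_i t i *: x i]].

Notation borel T := (g_sigma_algebraType (@open T)).

Lemma open_borel (T : ptopologicalType) (U : set T) :
  open U -> measurable (U : set (borel T)).
Proof. exact: sub_sigma_algebra. Qed.

(* Lebesgue measure on the Borel sets of R^n, as the image of the iterated
   product measure under the identification R * R^n = R^(n+1). *)
Section lebesgue_measure_rV.
Context (R : realType).

Definition consrV n (p : measurableTypeR R * borel 'rV[R]_n) :
    borel 'rV[R]_n.+1 :=
  row_mx (p.1 : R)%:M (p.2 : 'rV[R]_n).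

Fixpoint lebesgue_rV n : set (borel 'rV[R]_n) -> \bar R :=
  match n return set (borel 'rV[R]_n) -> \bar R with
  | 0%N => dirac ((0 : 'rV[R]_0) : borel 'rV[R]_0)
  | n'.+1 => pushforward (@lebesgue_measure R \x @lebesgue_rV n')%E (@consrV n')
  end.

Lemma measurable_rV d (T : measurableType d) (D : set T) n
    (f : T -> borel 'rV[R]_n) :
  (forall i, measurable_fun D (fun t => (f t : 'rV[R]_n) ord0 i)) ->
  measurable_fun D f.
Proof.
move=> mf mD; apply: (@measurability _ _ T (borel 'rV[R]_n) D f (@open 'rV[R]_n)) => //.
move=> _ [U oU <-]; rewrite -[_ `&` _]/(D `&` (f @^-1` U)).
pose q2r (q : 'rV[rat]_n) : 'rV[R]_n := map_mx ratr q.
pose B (qk : 'rV[rat]_n * nat) := ball (q2r qk.1) qk.2.+1%:R^-1 : set 'rV[R]_n.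
pose F qk : set T := if `[< B qk `<=` U >] then
  \bigcap_(i in [set: 'I_n])
    (D `&` [set t | ball (q2r qk.1 ord0 i) qk.2.+1%:R^-1
                         ((f t : 'rV[R]_n) ord0 i)])
  else set0.
have -> : D `&` f @^-1` U = D `&` \bigcup_qk F qk.
  apply/seteqP; split => t [Dt].
    move=> /= Uft; split=> //.
    have [e /= e0 eU] : exists2 e : R, 0 < e & ball (f t : 'rV[R]_n) e `<=` U.
      by have /nbhs_ballP[e /= e0 eU] := open_nbhs_nbhs (conj oU Uft); exists e.
    have [k ke] : exists k : nat, k.+1%:R^-1 < e / 2 :> R.
      have e20 : 0 < e / 2 by rewrite divr_gt0.
      by have [k _ /(_ k (leqnn k))] := near_infty_natSinv_lt (PosNum e20); exists k.
    have /choice[q qP] : forall i : 'I_n, exists q : rat,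
        ball (ratr q : R) k.+1%:R^-1 ((f t : 'rV[R]_n) ord0 i).
      move=> i; have k0 : 0 < k.+1%:R^-1 :> R by rewrite invr_gt0.
      have /rat_in_itvoo[q] : (f t : 'rV[R]_n) ord0 i - k.+1%:R^-1 <
          (f t : 'rV[R]_n) ord0 i + k.+1%:R^-1.
        by rewrite ltrBlDr -addrA ltrDl addr_gt0.
      by rewrite in_itv /= => qi; exists q; rewrite /ball /= ltr_distl.
    exists (\row_i q i, k) => //; rewrite /F.
    have qb : forall i, ball (q2r (\row_i q i) ord0 i) k.+1%:R^-1
        ((f t : 'rV[R]_n) ord0 i) by move=> i; rewrite !mxE; exact: qP.
    have qball : ball (q2r (\row_i q i)) k.+1%:R^-1 (f t : 'rV[R]_n).
      by split; [rewrite invr_gt0|move=> i j; rewrite (ord1 i); exact: qb].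
    case: asboolP => [_ i _|]; first by split=> //; exact: qb.
    case=> y /= qy; apply: eU; rewrite [e]splitr.
    have le2 : k.+1%:R^-1 <= e / 2 by exact: ltW.
    apply: (@ball_triangle _ _ (q2r (\row_i q i))); apply: (le_ball le2) => //.
    exact: ball_sym.
  move=> [[q k] _]; rewrite /F; case: asboolP => // BU tF; split => //.
  apply: BU; split; first by rewrite invr_gt0.
  by move=> i j; rewrite (ord1 i); have [] := tF j I.
apply: measurableI => //; apply: countable_bigcupT_measurable => [|[q k]].
  exact: countableP.
rewrite /F; case: asboolP => // _; apply: fin_bigcap_measurable => // i _.
by apply: (mf i) => //; apply: open_measurable; exact: ball_open.
Qed.

Lemma measurable_coord n i :
  measurable_fun setT (fun v : borel 'rV[R]_n => (v : 'rV[R]_n) ord0 i).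
Proof.
apply: (measurability _ (RGenOpens.measurableE R)).
move=> _ [_ [a [b ->] <-]]; rewrite setTI; apply: open_borel.
apply: open_comp; last exact: interval_open.
by move=> v _; exact: coord_continuous.
Qed.

Lemma measurable_consrV n : measurable_fun setT (@consrV n).
Proof.
apply: measurable_rV => i.
case: (@split_ordP 1 n i) => j ->.
- rewrite (_ : (fun t => _) = fst); first exact: measurable_fst.
  by apply/funext => t; rewrite /consrV (@row_mxEl _ 1 1 n) !mxE (ord1 j).
- rewrite (_ : (fun t => _) =
    (fun v : borel 'rV[R]_n => (v : 'rV[R]_n) ord0 j) \o snd).
    by apply: measurableT_comp; [exact: measurable_coord|exact: measurable_snd].
  by apply/funext => t; rewrite /consrV (@row_mxEr _ 1 1 n).
Qed.

Lemma pushforward_consrV_sigma_finite n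
    (mu : {sigma_finite_measure set (borel 'rV[R]_n) -> \bar R}) :
  sigma_finite setT (pushforward (@lebesgue_measure R \x mu)%E (@consrV n)).
Proof.
pose g (v : borel 'rV[R]_n.+1) : measurableTypeR R * borel 'rV[R]_n :=
  ((v : 'rV[R]_n.+1) ord0 ord0, rsubmx ((v : 'rV[R]_n.+1) : 'rV[R]_(1 + n))).
have lshift_ord0 : ord0 = @lshift 1 n ord0 :> 'I_n.+1 by exact/val_inj.
have gK p : g (consrV p) = p.
  case: p => x v; rewrite /g /consrV row_mxKr; congr pair.
  by rewrite lshift_ord0 (@row_mxEl _ 1 1 n) mxE.
have mg : measurable_fun setT g.
  apply: measurable_fun_pair; first exact: measurable_coord.
  apply: measurable_rV => i; rewrite (_ : (fun t => _) =
    (fun v : borel 'rV[R]_n.+1 => (v : 'rV[R]_n.+1) ord0 (rshift 1 i))).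
    exact: measurable_coord.
  by apply/funext => t; rewrite mxE.
have [F FT mF] : sigma_finite setT (@lebesgue_measure R \x mu)%E.
  have /sigma_finiteP[F [TF ndF Foo]] := sigma_finiteT (@lebesgue_measure R).
  have /sigma_finiteP[G [TG ndG Goo]] := sigma_finiteT mu.
  exists (fun i => F i `*` G i); last first.
    move=> k; have [? ?] := Foo k; have [? ?] := Goo k.
    split; first exact: measurableX.
    by rewrite product_measure1E// lte_mul_pinfty// ge0_fin_numE.
  rewrite -setXTT TF TG predeqE => -[x y]; split; last first.
    by move=> [i _ []/= ? ?]; split; exists i.
  move=> [/= [i _ Fix] [k _ Gky]]; exists (maxn i k) => //; split.
  - by move: x Fix; exact/subsetPset/ndF/leq_maxl.
  - by move: y Gky; exact/subsetPset/ndG/leq_maxr.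
exists (fun i => g @^-1` F i).
  by rewrite -preimage_bigcup -FT preimage_setT.
move=> i; have [mFi Fioo] := mF i; split.
  by rewrite -[X in measurable X]setTI; exact: mg.
rewrite /pushforward (_ : _ @^-1` _ = F i)//.
by apply/seteqP; split => p /=; rewrite gK.
Qed.

Section step.
Variables (n : nat) (mu : {sigma_finite_measure set (borel 'rV[R]_n) -> \bar R}).
Local Open Scope ereal_scope.

Definition lebesgue_rV_step : set (borel 'rV[R]_n.+1) -> \bar R :=
  pushforward (@lebesgue_measure R \x mu) (@consrV n).

Let step0 : lebesgue_rV_step set0 = 0.
Proof. by rewrite /lebesgue_rV_step /pushforward preimage_set0 measure0. Qed.

Let step_ge0 A : 0 <= lebesgue_rV_step A.
Proof. by rewrite /lebesgue_rV_step /pushforward; apply: integral_ge0. Qed.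

Let step_sigma_additive : semi_sigma_additive lebesgue_rV_step.
Proof.
move=> F mF tF mUF; rewrite /lebesgue_rV_step /pushforward preimage_bigcup.
apply: measure_semi_sigma_additive.
- by move=> i; rewrite -[X in measurable X]setTI; exact: measurable_consrV.
- apply/trivIsetP => /= i j _ _ ij; rewrite -preimage_setI.
  by move/trivIsetP : tF => /(_ _ _ _ _ ij) ->//; rewrite preimage_set0.
- rewrite -preimage_bigcup -[X in measurable X]setTI.
  exact: measurable_consrV.
Qed.

HB.instance Definition _ := isMeasure.Build _ _ _ lebesgue_rV_step
  step0 step_ge0 step_sigma_additive.

HB.instance Definition _ := Measure_isSigmaFinite.Build _ _ _ lebesgue_rV_step
  (pushforward_consrV_sigma_finite mu).

End step.

Lemma lebesgue_rV_ex n :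
  exists mu : {sigma_finite_measure set (borel 'rV[R]_n) -> \bar R},
    @lebesgue_rV n = mu.
Proof.
elim: n => [|n [mu Hmu]]; first by eexists.
by exists (lebesgue_rV_step mu); rewrite /= Hmu.
Qed.

Section instance.
Variable n : nat.
Local Open Scope ereal_scope.

Let leb0 : @lebesgue_rV n set0 = 0.
Proof. by have [mu ->] := lebesgue_rV_ex n; rewrite measure0. Qed.

Let leb_ge0 A : 0 <= @lebesgue_rV n A.
Proof. by have [mu ->] := lebesgue_rV_ex n; exact: measure_ge0. Qed.

Let leb_sigma_additive : semi_sigma_additive (@lebesgue_rV n).
Proof.
by have [mu ->] := lebesgue_rV_ex n; exact: measure_semi_sigma_additive.
Qed.

Let leb_sigma_finite : sigma_finite setT (@lebesgue_rV n).
Proof. by have [mu ->] := lebesgue_rV_ex n; exact: sigma_finiteT. Qed.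

HB.instance Definition _ := isMeasure.Build _ _ _ (@lebesgue_rV n)
  leb0 leb_ge0 leb_sigma_additive.

HB.instance Definition _ := Measure_isSigmaFinite.Build _ _ _ (@lebesgue_rV n)
  leb_sigma_finite.

End instance.

Lemma lebesgue_rV_box n (A : 'I_n -> set (measurableTypeR R)) :
  (forall i, measurable (A i)) ->
  lebesgue_rV [set v : borel 'rV[R]_n | forall i, A i ((v : 'rV[R]_n) ord0 i)]
  = (\prod_(i < n) lebesgue_measure (A i))%E.
Proof.
elim: n A => [|n IH] A mA.
  rewrite big_ord0 /= diracE; apply/eqP; rewrite eqe pnatr_eq1 eqb1.
  by apply/mem_set => -[].
rewrite big_ord_recl -IH//= -product_measure1E//; last first.
  rewrite (_ : mkset _ = \bigcap_(i in [set: 'I_n])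
    [set v : borel 'rV[R]_n | A (lift ord0 i) ((v : 'rV[R]_n) ord0 i)]).
    apply: fin_bigcap_measurable => // i _; rewrite -[X in measurable X]setTI.
    by apply: (@measurable_coord n i) => //; exact: mA.
  by apply/seteqP; split => [v Av i _|v Av i]; [exact: Av|exact: (Av i)].
rewrite /pushforward; congr product_measure1.
have e0 : ord0 = @lshift 1 n ord0 :> 'I_n.+1 by exact/val_inj.
have eS i : lift ord0 i = @rshift 1 n i :> 'I_n.+1 by exact/val_inj.
have c0 p : (consrV p : 'rV[R]_n.+1) ord0 ord0 = p.1.
  by rewrite e0 (@row_mxEl _ 1 1 n) mxE.
have cS p i : (consrV p : 'rV[R]_n.+1) ord0 (lift ord0 i) =
    (p.2 : 'rV[R]_n) ord0 i.
  by rewrite eS (@row_mxEr _ 1 1 n).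
apply/seteqP; split => p /=.
  by move=> Ap; split => [|i]; [rewrite -c0|rewrite -cS]; exact: Ap.
move=> [Ap1 Ap2] i; case: (unliftP ord0 i) => [j|] ->.
  by rewrite cS; exact: Ap2.
by rewrite c0.
Qed.

End lebesgue_measure_rV.

Section atomic_measure.
Local Open Scope ereal_scope.
Context d (T : measurableType d) (R : realType) (n : nat).
Variables (c : 'I_n -> {i01 R}) (a : 'I_n -> T).

Definition atomic (S : set T) : \bar R :=
  \sum_(i < n) ((c i)%:num)%:E * \d_(a i) S.

Let c_ge0 i : (0 <= (c i)%:num)%R. Proof. by []. Qed.

Let atomicE : atomic = msum (fun k => if insub k is Some i
  then mscale (NngNum (c_ge0 i)) \d_(a i) else mzero) n.
Proof.
apply/funext => S; rewrite /msum /atomic; apply: eq_bigr => i _.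
by rewrite valK.
Qed.

Let atomic0 : atomic set0 = 0. Proof. by rewrite atomicE measure0. Qed.

Let atomic_ge0 S : 0 <= atomic S. Proof. by rewrite atomicE; exact: measure_ge0. Qed.

Let atomic_sigma_additive : semi_sigma_additive atomic.
Proof. by rewrite atomicE; exact: measure_semi_sigma_additive. Qed.

HB.instance Definition _ := isMeasure.Build _ _ _ atomic
  atomic0 atomic_ge0 atomic_sigma_additive.

End atomic_measure.

(* A homogeneous operator of order k from V to W is given by its coefficients
   A_alpha, indexed by multi-indices with entries at most k; only those with
   |alpha| = k are used. *)
Section operators.
Context (R : realType) (d : nat).

Definition mindex k := {ffun 'I_d -> 'I_k.+1}.

Definition mdegree k (a : mindex k) : nat := (\sum_(i < d) a i)%N.

Fixpoint iter_partial (V : normedModType R) (s : seq 'I_d)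
    (f : 'rV[R]_d -> V) : 'rV[R]_d -> V :=
  if s is i :: s' then fun x => 'D_(delta_mx ord0 i) (iter_partial s' f) x
  else f.

Definition mpartial (V : normedModType R) k (a : mindex k)
    (f : 'rV[R]_d -> V) : 'rV[R]_d -> V :=
  iter_partial (flatten [seq nseq (a i) i | i <- enum 'I_d]) f.

(* Functions on Om are total functions whose values outside Om are ignored; Om
   is meant to be open. *)
Definition smooth_on (V : normedModType R) (Om : set 'rV[R]_d)
    (f : 'rV[R]_d -> V) : Prop :=
  forall (s : seq 'I_d) x, Om x ->
    {for x, continuous (iter_partial s f)} /\
    forall i, derivable (iter_partial s f) x (delta_mx ord0 i).

Definition diff_op (V W : euclideanType R) k (A : mindex k -> 'Hom(V, W))
    (f : 'rV[R]_d -> V) (x : 'rV[R]_d) : W :=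
  \sum_(a : mindex k | mdegree a == k) A a (mpartial a f x).

(* The symbol without the factor (2 pi i)^k. *)
Definition symbol (V W : vectType R) k (A : mindex k -> 'Hom(V, W))
    (xi : 'rV[R]_d) : 'Hom(V, W) :=
  \sum_(a : mindex k | mdegree a == k) (\prod_(i < d) xi ord0 i ^+ a i) *: A a.

Definition constant_rank (V W : vectType R) k (A : mindex k -> 'Hom(V, W)) :=
  exists2 r : nat, (0 < r)%N &
    forall xi : 'rV[R]_d, xi != 0 -> \dim (limg (symbol A xi)) = r.

Definition wave_cone (V W : vectType R) k (A : mindex k -> 'Hom(V, W)) : set V :=
  [set w | exists2 xi : 'rV[R]_d, xi != 0 & w \in lker (symbol A xi)].

Definition image_cone (V W : vectType R) k (B : mindex k -> 'Hom(V, W)) :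
    set W :=
  [set w | exists xi : 'rV[R]_d, w \in limg (symbol B xi)].

End operators.

Section young_measures.
Context (R : realType) (d : nat) (W : euclideanType R).
Implicit Types (Om : set 'rV[R]_d) (f : 'rV[R]_d -> W -> R).

Definition ball_transform f (x : 'rV[R]_d) (z : W) : R :=
  (1 - `|z|) * f x ((1 - `|z|)^-1 *: z).

Definition integrand Om f : Prop :=
  {within Om `*` setT, continuous (fun q : 'rV[R]_d * W => f q.1 q.2)} /\
  exists2 g : 'rV[R]_d * W -> R,
    {within closure (Om `*` unit_ball W), continuous g} &
    forall x z, Om x -> unit_ball W z -> g (x, z) = ball_transform f x z.

Definition recession Om f (x : 'rV[R]_d) (z : W) : R :=
  lim ((fun q : 'rV[R]_d * W * R => f q.1.1 (q.2 *: q.1.2) / q.2) @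
       filter_prod (filter_prod (within Om (nbhs x)) (nbhs z)) (pinfty_nbhs R)).

Definition L1_on Om (v : 'rV[R]_d -> W) : Prop :=
  measurable_fun (Om : set (borel 'rV[R]_d)) (v : borel 'rV[R]_d -> borel W) /\
  (\int[@lebesgue_rV R d]_(x in Om) (`|v x|)%:E < +oo)%E.

(* [v j] times Lebesgue measure generates (delta_a, lam, p) on Om, where lam is
   a finite measure on Om and p a probability measure on the unit sphere; both
   are given as Borel measures on the ambient space. *)
Definition generates Om (v : nat -> 'rV[R]_d -> W) (a : W)
    (lam : {measure set (borel 'rV[R]_d) -> \bar R})
    (p : {measure set (borel W) -> \bar R}) : Prop :=
  [/\ forall j, L1_on Om (v j),
      (lam Om < +oo)%E, p (unit_sphere W) = 1%E &
      forall f, integrand Om f ->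
        (fun j => \int[@lebesgue_rV R d]_(x in Om) (f x (v j x))%:E)%E @ \oo -->
        (\int[@lebesgue_rV R d]_(x in Om) (f x a)%:E +
         \int[lam]_(x in Om) \int[p]_(z in unit_sphere W)
           (recession Om f x z)%:E)%E].

End young_measures.

(* Main.v *)
Require Import Defs.
From HB Require Import structures.
From mathcomp Require Import all_boot all_order all_algebra.
From mathcomp Require Import all_classical all_reals all_analysis.
From mathcomp Require Import measurable_realfun zify ring lra.
Set Implicit Arguments.
Unset Strict Implicit.
Unset Printing Implicit Defensive.
Import Order.TTheory GRing.Theory Num.Theory numFieldNormedType.Exports.
Local Open Scope classical_set_scope.
Local Open Scope ring_scope.

(* Both parts are instances of one statement about a field [K] of subspaces of
   [W], namely [K xi = ker A(xi)] or [K xi = im B(xi)]: finite sums of waves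
   [cos (eta.x + phi) w] with [w] in [K eta] are A-free, resp. B-potentials.
   What is used of [K] is homogeneity and lower semicontinuity away from 0; for
   the kernels the latter is where constant rank enters.
   (1) Laminates. If no laminate (iterated splitting [y -> y + m, y - m] along
   the cone D = union of the [K xi]) started at 0 had a negative average of
   [phi y = min_i |y - |y| a_i| - e |y|], the infimum of these
   averages would be a finite 1-homogeneous Lipschitz function that is convex
   along D. As shown by Kirchheim and Kristensen such a function dominates a
   function that is linear on the span of D, which contradicts
   [0 in conv {a_i}] since [phi (a_i) < 0]. Scaling and mixing with the Dirac
   mass at 0 then gives laminates with mean 0, mass escaping to infinity along
   the rays of the [a_i] and first moment 1; the weights [c_i] are a cluster
   point of the moments carried by the rays.
   (2) Realization. A splitting is realized by a square wave, approximated by a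
   polynomial of [cos (N xi.x)] with odd frequencies only. Modulated by slower
   waves it stays close to admissible waves when N is large, and the average of
   a test function over it is computed by translating [Om] by multiples of
   [xi / N]. *)

(** * Laminates along a cone *)

(** The constraint is never repaired afterwards: every field is from the outset an exact finite sum
    of admissible waves, and errors occur only in how well it imitates the wanted oscillation. The
    obstacle is that a square wave along [xi] times a slow function is no such sum. Expanded, it has
    frequencies [eta + m N xi] with [m] an odd integer; as [m] is nonzero, their directions tend to
    [xi], and semicontinuity moves each amplitude slightly into the fibre of [K] that it needs. A
    zero harmonic would leave [eta] alone, whose direction has nothing to do with [xi].

    The fields must be chosen before the integrand. All estimates of fields are therefore uniform
    over one normalised class of test functions of linear growth, and the Lipschitz constant of the
    function approximating a given integrand is paid for only in the final limit.

    The laminates keep most of their mass at 0, while their far atoms carry a first moment 1. On top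
    of the constant [a ord0] the former gives the Dirac mass, and the latter, spread evenly over
    [Om], the concentration part. *)

Lemma subrDD (V : zmodType) (x y z : V) : (x + z) - (y + z) = x - y.
Proof. by rewrite opprD addrACA subrr addr0. Qed.

Section laminates.
Context (R : realType) (W : euclideanType R).
Implicit Types (D : set W) (F G : W -> R) (y z : W).

(** The tree stores displacements and no base point, so that one tree can be started at any [y] and
    its leaves move rigidly with [y]. The comparison of averages at different starting points rests
    on this. *)
Inductive splitting := Leaf | Split of W & splitting & splitting.

Fixpoint law t y : seq (R * W) :=
  if t is Split m t1 t2
  then [seq (2^-1 * q.1, q.2) | q <- law t1 (y + m) ++ law t2 (y - m)]
  else [:: (1, y)].

Fixpoint splits_along D t : Prop :=
  if t is Split m t1 t2 then [/\ D m, splits_along D t1 & splits_along D t2]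
  else True.

Fixpoint scale_splitting c t :=
  if t is Split m t1 t2
  then Split (c *: m) (scale_splitting c t1) (scale_splitting c t2) else Leaf.

Definition avg F t y : R := \sum_(q <- law t y) q.1 * F q.2.

Lemma avg_leaf F y : avg F Leaf y = F y.
Proof. by rewrite /avg big_seq1 mul1r. Qed.

Lemma avg_split F m t1 t2 y :
  avg F (Split m t1 t2) y = 2^-1 * (avg F t1 (y + m) + avg F t2 (y - m)).
Proof.
rewrite /avg big_map big_cat /= mulrDr !mulr_sumr.
by congr (_ + _); apply: eq_bigr => q _; rewrite mulrA.
Qed.

Lemma law_ge0 t y q : q \in law t y -> 0 <= q.1.
Proof.
elim: t y q => [|m t1 IH1 t2 IH2] y q; first by rewrite inE => /eqP ->.
move=> /mapP[r]; rewrite mem_cat => /orP[/IH1|/IH2] r0 -> /=;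
  by rewrite mulr_ge0// invr_ge0.
Qed.

Lemma avgD F G t y : avg (fun z => F z + G z) t y = avg F t y + avg G t y.
Proof. by rewrite /avg -big_split; apply: eq_bigr => q _; rewrite mulrDr. Qed.

Lemma avgZ c F t y : avg (fun z => c * F z) t y = c * avg F t y.
Proof. by rewrite /avg mulr_sumr; apply: eq_bigr => q _; rewrite mulrCA. Qed.

Lemma avg_cst c t y : avg (fun=> c) t y = c.
Proof.
elim: t y => [|m t1 IH1 t2 IH2] y; first by rewrite avg_leaf.
by rewrite avg_split IH1 IH2; lra.
Qed.

Lemma le_avg F G t y : (forall z, F z <= G z) -> avg F t y <= avg G t y.
Proof.
move=> FG; rewrite /avg big_seq [leRHS]big_seq; apply: ler_sum => q /law_ge0 q0.
by rewrite ler_wpM2l.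
Qed.

Lemma law_mean t y : \sum_(q <- law t y) q.1 *: q.2 = y.
Proof.
elim: t y => [|m t1 IH1 t2 IH2] y; first by rewrite big_seq1 scale1r.
rewrite big_map big_cat /=.
under eq_bigr do rewrite -scalerA.
under [X in _ + X]eq_bigr do rewrite -scalerA.
rewrite -!scaler_sumr IH1 IH2 -scalerDr addrACA subrr addr0 scalerDr -scalerDl.
by rewrite (_ : 2^-1 + 2^-1 = 1) ?scale1r//; lra.
Qed.

Lemma avg_lipschitz L F t y z :
  (forall u v, F u <= F v + L * `|u - v|) ->
  avg F t y <= avg F t z + L * `|y - z|.
Proof.
move=> FL; elim: t y z => [|m t1 IH1 t2 IH2] y z; first by rewrite !avg_leaf.
rewrite !avg_split.
have := IH1 (y + m) (z + m); rewrite subrDD.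
have := IH2 (y - m) (z - m); rewrite subrDD.
by lra.
Qed.

Lemma avg_scale c F t y :
  avg F (scale_splitting c t) (c *: y) = avg (fun z => F (c *: z)) t y.
Proof.
elim: t y => [|m t1 IH1 t2 IH2] y /=; first by rewrite !avg_leaf.
by rewrite !avg_split -scalerDr -scalerBr IH1 IH2.
Qed.

Lemma splits_along_scale D c t : (forall m, D m -> D (c *: m)) ->
  splits_along D t -> splits_along D (scale_splitting c t).
Proof.
by move=> Dc; elim: t => //= m t1 IH1 t2 IH2 [? ? ?]; split; auto.
Qed.

Lemma law_scale c t y : law (scale_splitting c t) (c *: y) =
  [seq (q.1, c *: q.2) | q <- law t y].
Proof.
elim: t y => [|m t1 IH1 t2 IH2] y //=.
rewrite -scalerDr -scalerBr IH1 IH2 -map_cat -!map_comp.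
exact: eq_map.
Qed.

Definition cone_convex D L (h : W -> R) := [/\
  forall y z, h y <= h z + L * `|y - z|,
  forall c y, 0 < c -> h (c *: y) = c * h y &
  forall m y, D m -> h y <= 2^-1 * (h (y + m) + h (y - m))].


Section cone_convex.
Variables (D : set W) (L : R).
Hypothesis DZ : forall c m, D m -> D (c *: m).

Lemma le_eps_geometric (a b C : R) :
  (forall k : nat, a <= b + (2^-1) ^+ k * C) -> a <= b.
Proof.
move=> H; apply/ler_addgt0Pl => e e0; rewrite addrC.
have := @cvg_geometric R C 2^-1; rewrite ger0_norm ?invr_ge0//.
move=> /(_ ltac:(lra)) /cvgrPdist_le /(_ e e0)[k _ /(_ k (leqnn k))] /=.
rewrite sub0r normrN mulrC => kC; apply: (le_trans (H k)); rewrite lerD2l.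
by apply: le_trans kC; rewrite ler_norm.
Qed.

Lemma cone_convex0 h : cone_convex D L h -> h 0 = 0.
Proof. by case=> _ /(_ 2 0 ltac:(lra)); rewrite scaler0; lra. Qed.

(** The point [y + m] lies at the fraction [2^-k] of the segment from [y] to [y + 2^k m]. By
    homogeneity the far end contributes [h (2^-k y + m)], which tends to [h m]. *)
Lemma cone_convexD h m y : cone_convex D L h -> D m -> h (y + m) <= h y + h m.
Proof.
move=> [hL hZ hD] Dm.
have H k : h (y + m) <= (1 - (2^-1) ^+ k) * h y + (2^-1) ^+ k * h (y + 2 ^+ k *: m).
  elim: k => [|k IH]; first by rewrite !expr0 scale1r; lra.
  have Dk : D (2 ^+ k *: m) by exact: DZ.
  have := hD (2 ^+ k *: m) (y + 2 ^+ k *: m) Dk.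
  rewrite addrK -addrA -scalerDl (_ : 2 ^+ k + 2 ^+ k = 2 ^+ k.+1); last first.
    by rewrite exprS; lra.
  have := exprn_ge0 k (_ : 0 <= 2^-1 :> R); rewrite (exprSr 2^-1).
  move: IH; set p := (2^-1) ^+ k; set u := h _; set v := h _; set w := h _.
  move=> IH /(_ ltac:(lra)) p0 vw.
  by have := ler_wpM2l p0 vw; lra.
apply: (@le_eps_geometric _ _ (L * `|y| - h y)) => k; apply: (le_trans (H k)).
have p0 : 0 < (2^-1) ^+ k :> R by rewrite exprn_gt0// invr_gt0.
rewrite -(hZ _ (y + _) p0) scalerDr scalerA -exprMn mulVf ?pnatr_eq0// expr1n scale1r.
have := hL ((2^-1) ^+ k *: y + m) m; rewrite addrK normrZ gtr0_norm//.
by lra.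
Qed.

Definition affine_along h m := exists c, forall y s, h (y + s *: m) = h y + s * c.

(** For [t > 0] the quantity [k y t] equals [t (h (l + y / t) - h l)], so that [h'] is the
    directional derivative of [h] at [l]. It is finite by the Lipschitz bound, and since
    subadditivity along [l] makes [k] nonincreasing in [t], the infimum is a limit. This limit is
    affine along [l] with slope [h l] and keeps every direction in which [h] was affine already. *)
Lemma cone_convex_affine h l : cone_convex D L h -> D l ->
  exists h', [/\ cone_convex D L h', forall y, h' y <= h y, affine_along h' l &
    forall m, affine_along h m -> affine_along h' m].
Proof.
move=> hcc Dl; have [hL hZ hD] := hcc.
pose k y t := h (y + t *: l) - t * h l.
have hl t : 0 <= t -> h (t *: l) = t * h l.
  rewrite le_eqVlt => /predU1P[<-|/hZ//]; rewrite scale0r mul0r.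
  exact: cone_convex0 hcc.
have k_lb y t : 0 <= t -> - (L * `|y|) <= k y t.
  move=> t0; rewrite /k -hl//; have := hL (t *: l) (y + t *: l).
  rewrite distrC addrK; lra.
have k_ni y t u : 0 <= t -> t <= u -> k y u <= k y t.
  move=> t0 tu; rewrite /k.
  have := cone_convexD (y + t *: l) hcc (DZ (u - t) Dl).
  have -> : y + t *: l + (u - t) *: l = y + u *: l.
    by rewrite -addrA -scalerDl addrCA subrr addr0.
  by rewrite hl ?subr_ge0//; lra.
pose E y := [set k y t | t in [set t | 0 <= t]].
have Elb y : has_lbound (E y).
  by exists (- (L * `|y|)) => _ [t /= t0 <-]; exact: k_lb.
have E0 y : E y !=set0 by exists (k y 0), 0 => //=.
pose h' y := inf (E y).
have h'k y t : 0 <= t -> h' y <= k y t.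
  by move=> t0; apply: ge_inf => //; exists t.
have le_h' y x : (forall t, 0 <= t -> x <= k y t) -> x <= h' y.
  by move=> H; apply: lb_le_inf => // _ [t /= t0 <-]; exact: H.
have kD y s t : k (y + s *: l) t - s * h l = k y (s + t).
  by rewrite /k -[y + _ + _]addrA -scalerDl; lra.
have h'l_ge0 y s : 0 <= s -> h' (y + s *: l) = h' y + s * h l.
  move=> s0; apply/eqP; rewrite eq_le; apply/andP; split.
    rewrite -lerBlDr; apply: (le_h') => t t0; rewrite lerBlDr.
    apply: (le_trans (h'k _ t t0)); rewrite -lerBlDr.
    by rewrite kD; apply: k_ni => //; rewrite lerDr.
  apply: (le_h') => t t0; rewrite -lerBrDr.
  by rewrite kD; apply: h'k; exact: addr_ge0.
exists h'; split.
- split.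
  + move=> y z; rewrite -lerBlDr; apply: (le_h') => t t0; rewrite lerBlDr.
    apply: (le_trans (h'k y t t0)); have := hL (y + t *: l) (z + t *: l).
    by rewrite subrDD /k; lra.
  + have half c y : 0 < c -> h' (c *: y) <= c * h' y.
      move=> c0; rewrite -ler_pdivrMl//; apply: (le_h') => t t0.
      rewrite ler_pdivrMl//; apply: (le_trans (h'k _ (c * t) _)).
        by rewrite mulr_ge0// ltW.
      by rewrite /k -scalerA -scalerDr hZ//; lra.
    move=> c y c0; apply/eqP; rewrite eq_le half//=.
    rewrite -ler_pdivlMl//; apply: le_trans (half c^-1 (c *: y) _).
      by rewrite scalerA mulVf ?scale1r// gt_eqF.
    by rewrite invr_gt0.
  + move=> m y Dm; rewrite ler_pdivlMl//.
    rewrite -lerBlDr; apply: (le_h') => t t0; rewrite lerBlDr addrC -lerBlDr.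
    apply: (le_h') => u u0; rewrite lerBlDr.
    (* As [k] is nonincreasing in its last argument, both values may be compared with those at the
       larger of [t] and [u], where one instance of the convexity of [h] suffices. *)
    have v0 : 0 <= Num.max t u by rewrite le_max t0.
    have := hD m (y + Num.max t u *: l) Dm.
    have := h'k y _ v0.
    have := @k_ni (y + m) t (Num.max t u) t0 ltac:(by rewrite le_max lexx).
    have := @k_ni (y - m) u (Num.max t u) u0 ltac:(by rewrite le_max lexx orbT).
    by rewrite /k [y + m + _]addrAC [y - m + _]addrAC; lra.
- by move=> y; have := h'k y 0 (lexx _); rewrite /k scale0r addr0 mul0r subr0.
- exists (h l) => y s; have [s0|s0] := leP 0 s; first exact: h'l_ge0.
  have := h'l_ge0 (y + s *: l) (- s).
  by rewrite scaleNr addrK => ->; lra.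
- move=> m [c hm]; exists c => y s; apply/eqP; rewrite eq_le.
  have aux z r : h' (z + r *: m) <= h' z + r * c.
    rewrite -lerBlDr; apply: (le_h') => t t0; rewrite lerBlDr.
    apply: (le_trans (h'k _ t t0)).
    by rewrite /k addrAC hm; lra.
  rewrite aux/=; have := aux (y + s *: m) (- s).
  by rewrite scaleNr addrK; lra.
Qed.


Lemma cone_convex_affines (s : seq W) h : cone_convex D L h ->
  (forall m, m \in s -> D m) ->
  exists h', [/\ cone_convex D L h', forall y, h' y <= h y &
    forall m, m \in s -> affine_along h' m].
Proof.
move=> hcc; elim: s => [|l s IH] sD; first by exists h.
have [|h1 [h1cc h1h h1s]] := IH; first by move=> m ms; apply: sD; rewrite inE ms orbT.
have [h2 [h2cc h2h h2l h2s]] := cone_convex_affine h1cc (sD l (mem_head _ _)).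
exists h2; split=> // [y|m]; first exact: le_trans (h2h y) (h1h y).
by rewrite inE => /predU1P[->//|/h1s/h2s].
Qed.

Lemma affine_along_span h (s : seq W) v :
  (forall m, m \in s -> affine_along h m) -> v \in span s -> affine_along h v.
Proof.
move=> hs; rewrite -[s]/(tval (in_tuple s)) => /coord_span ->.
apply: (big_ind (affine_along h)) => [|u w [c hc] [e he]|i _].
- by exists 0 => y r; rewrite scaler0 mulr0 !addr0.
- by exists (c + e) => y r; rewrite scalerDr addrA he hc; lra.
- have [c hc] := hs _ (mem_nth 0 (ltn_ord i)).
  by exists (coord (in_tuple s) i v * c) => y r; rewrite scalerA hc mulrA.
Qed.

(* A minorant of [h] that is affine along the span of [D] is linear there,
   hence vanishes at the barycentre 0 of the [a i]. *)
Lemma cone_convex_conv_hull h (n : nat) (a : 'I_n -> W) :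
  cone_convex D L h -> (forall i, lin_span D (a i)) ->
  conv_hull (range a) 0 -> exists i, 0 <= h (a i).
Proof.
move=> hcc aD [p [t [x [t0 t1 xa x0]]]]; apply: contrapT => noi.
have /choice[s sP] : forall i, exists s : seq W,
    (forall u, u \in s -> D u) /\ a i \in span s.
  by move=> i; have [s sD ai] := aD i; exists s.
have [|h' [h'cc h'h h's]] :=
    @cone_convex_affines (flatten [seq s i | i <- enum 'I_n]) h hcc.
  by move=> m /flatten_mapP[i _ mi]; have [sD _] := sP i; exact: sD.
have h'a i : affine_along h' (a i).
  apply: affine_along_span (sP i).2 => m ms; apply: h's.
  by apply/flatten_mapP; exists i; rewrite ?mem_enum.
have /choice[c cP] : forall j, exists c, forall y r,
    h' (y + r *: x j) = h' y + r * c.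
  by move=> j; have [i _ <-] := xa j; exact: h'a.
have c_lt0 j : c j < 0.
  have := cP j 0 1; rewrite add0r scale1r mul1r (cone_convex0 h'cc) add0r => <-.
  have [i _ <-] := xa j; apply: (le_lt_trans (h'h _)).
  by rewrite ltNge; apply/negP => hi; apply: noi; exists i.
have key : h' (\sum_j t j *: x j) = \sum_j t j * c j.
  elim: (index_enum _) => [|j r IH]; first by rewrite !big_nil (cone_convex0 h'cc).
  by rewrite !big_cons addrC cP IH addrC.
have tc0 j : 0 <= t j * - c j by rewrite mulr_ge0// oppr_ge0 ltW.
have /eqP : \sum_j t j * - c j = 0.
  under eq_bigr do rewrite mulrN.
  by rewrite sumrN -key -x0 (cone_convex0 h'cc) oppr0.
rewrite psumr_eq0// => /allP tc; have /eqP := t1; apply/negP.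
rewrite big1 1?eq_sym ?oner_eq0// => j _.
have := tc j (mem_index_enum j); rewrite mulf_eq0 oppr_eq0 (lt_eqF (c_lt0 j)) orbF.
by move/eqP.
Qed.

End cone_convex.

(** The envelope [g] is finite because a lower bound at 0 spreads to every [y] by the Lipschitz
    estimate for a fixed tree. It is convex along [D] because trees chosen at [y + m] and [y - m]
    can be grafted below one [Split m], and the trivial tree gives [g <= phi]. *)
Lemma avg_neg (D : set W) (L : R) (phi : W -> R) (n : nat) (a : 'I_n -> W) :
  D 0 -> (forall c m, D m -> D (c *: m)) ->
  (forall y z, phi y <= phi z + L * `|y - z|) ->
  (forall c y, 0 < c -> phi (c *: y) = c * phi y) ->
  (forall i, lin_span D (a i)) -> conv_hull (range a) 0 ->
  (forall i, phi (a i) < 0) ->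
  exists2 t, splits_along D t & avg phi t 0 < 0.
Proof.
move=> D0 DZ phiL phiZ aD a0 phia; apply: contrapT => not.
have avg0 t : splits_along D t -> 0 <= avg phi t 0.
  by move=> tD; rewrite leNgt; apply/negP => tlt; apply: not; exists t.
pose E y := [set avg phi t y | t in [set t | splits_along D t]].
have E_lb y t : splits_along D t -> - (L * `|y|) <= avg phi t y.
  move=> /avg0; have := avg_lipschitz t 0 y phiL; rewrite sub0r normrN; lra.
have Elb y : has_lbound (E y).
  by exists (- (L * `|y|)) => _ [t /= tD <-]; exact: E_lb.
have E0 y : E y !=set0 by exists (avg phi Leaf y), Leaf.
pose g y := inf (E y).
have g_le y t : splits_along D t -> g y <= avg phi t y.
  by move=> tD; apply: ge_inf => //; exists t.
have le_g y x : (forall t, splits_along D t -> x <= avg phi t y) -> x <= g y.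
  by move=> H; apply: lb_le_inf => // _ [t /= tD <-]; exact: H.
have gcc : cone_convex D L g.
  split.
  - move=> y z; rewrite -lerBlDr; apply: (le_g) => t tD; rewrite lerBlDr.
    exact: le_trans (g_le y t tD) (avg_lipschitz _ _ _ phiL).
  - have half c y : 0 < c -> g (c *: y) <= c * g y.
      move=> c0; rewrite -ler_pdivrMl//; apply: (le_g) => t tD.
      rewrite ler_pdivrMl// -avgZ.
      have -> : avg (fun z => c * phi z) t y = avg phi (scale_splitting c t) (c *: y).
        by rewrite avg_scale /avg; apply: eq_bigr => q _; rewrite phiZ.
      by apply: (g_le); apply: splits_along_scale => // m; exact: DZ.
    move=> c y c0; apply/eqP; rewrite eq_le half//=.
    rewrite -ler_pdivlMl//; apply: le_trans (half c^-1 (c *: y) _).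
      by rewrite scalerA mulVf ?scale1r// gt_eqF.
    by rewrite invr_gt0.
  - move=> m y Dm; rewrite ler_pdivlMl//.
    rewrite -lerBlDr; apply: (le_g) => t tD; rewrite lerBlDr addrC -lerBlDr.
    apply: (le_g) => u uD; rewrite lerBlDr.
    have := g_le y (Split m t u) (And3 Dm tD uD).
    by rewrite avg_split; lra.
have [i] := cone_convex_conv_hull DZ gcc aD a0.
have := g_le (a i) Leaf I; rewrite avg_leaf => gphi /(le_trans)/(_ gphi).
by rewrite leNgt phia.
Qed.


(** * Laminates concentrating along rays *)

Section concentration.
Variables (n : nat) (a : 'I_n.+1 -> W).

Definition nearest_ray y : 'I_n.+1 := [arg min_(i < ord0) `|y - `|y| *: a i|]%O.

(** For unit [a i], the distance to the point of norm [|y|] on the ray rather than to the ray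
    itself: a minimum of explicit 1-homogeneous functions, and exactly the error made in replacing
    [y] by [|y| a i]. *)
Definition ray_dist y := `|y - `|y| *: a (nearest_ray y)|.

Lemma ray_dist_le y i : ray_dist y <= `|y - `|y| *: a i|.
Proof. by rewrite /ray_dist /nearest_ray; case: arg_minP => // j _; exact. Qed.

Hypothesis a1 : forall i, `|a i| = 1.

Lemma ray_dist_lipschitz y z : ray_dist y <= ray_dist z + 2 * `|y - z|.
Proof.
apply: (le_trans (ray_dist_le y (nearest_ray z))).
have -> : y - `|y| *: a (nearest_ray z) = (z - `|z| *: a (nearest_ray z)) +
    ((y - z) + (`|z| - `|y|) *: a (nearest_ray z)).
  by rewrite scalerBl addrA [z - _ + _]addrC subrKA subrKA.
apply: (le_trans (ler_normD _ _)); rewrite lerD2l mulrDl mul1r.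
apply: (le_trans (ler_normD _ _)); rewrite lerD2l normrZ a1 mulr1.
by rewrite [leRHS]distrC ler_dist_dist.
Qed.

Lemma ray_distZ c y : 0 < c -> ray_dist (c *: y) = c * ray_dist y.
Proof.
have half e z : 0 < e -> ray_dist (e *: z) <= e * ray_dist z.
  move=> e0; apply: (le_trans (ray_dist_le _ (nearest_ray z))).
  by rewrite normrZ gtr0_norm// -scalerA -scalerBr normrZ gtr0_norm.
move=> c0; apply/eqP; rewrite eq_le half//=.
rewrite -ler_pdivlMl//; apply: le_trans (half c^-1 (c *: y) _).
  by rewrite scalerA mulVf ?scale1r// gt_eqF.
by rewrite invr_gt0.
Qed.

Variable D : set W.
Hypotheses (D0 : D 0) (DZ : forall c m, D m -> D (c *: m)).
Hypotheses (aD : forall i, lin_span D (a i)) (a0 : conv_hull (range a) 0).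

(** A splitting in direction 0 moves nothing: half of the mass follows [t], the other half is kept
    at the starting point. Started at 0, this halves the average of any [F] with [F 0 = 0] and
    creates no new nonzero atom. *)
Definition halve t := Split 0 t Leaf.

Lemma avg_halve F k t : F 0 = 0 ->
  avg F (iter k halve t) 0 = (2^-1) ^+ k * avg F t 0.
Proof.
move=> F0; elim: k => [|k IH]; first by rewrite mul1r.
by rewrite iterS avg_split avg_leaf addr0 subr0 IH F0 addr0 exprS mulrA.
Qed.

Lemma law_halve k t q : q \in law (iter k halve t) 0 -> q.2 != 0 ->
  exists2 r, r \in law t 0 & q.2 = r.2.
Proof.
elim: k q => [|k IH] q; first by exists q.
rewrite iterS /= addr0 subr0 => /mapP[r]; rewrite mem_cat inE.
by case/orP => [/IH rP -> //|/eqP-> -> /=]; rewrite eqxx.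
Qed.

Lemma law_gap (l : seq (R * W)) :
  exists2 e : R, 0 < e & forall q, q \in l -> q.2 != 0 -> e <= `|q.2|.
Proof.
elim: l => [|q l [e e0 el]]; first by exists 1.
have [q0|q0] := eqVneq q.2 0.
  by exists e => // r; rewrite inE => /predU1P[->|/el//]; rewrite q0 eqxx.
exists (Num.min e `|q.2|); first by rewrite lt_min e0 normr_gt0.
move=> r; rewrite inE => /predU1P[-> _|/el re /re]; first by rewrite ge_min lexx orbT.
by rewrite ge_min => ->.
Qed.

Lemma exists_concentrating_splitting (e T : R) : 0 < e -> 0 < T ->
  exists t, [/\ splits_along D t, avg (fun y => `|y|) t 0 = 1,
    avg ray_dist t 0 <= e &
    forall q, q \in law t 0 -> q.2 != 0 -> T <= `|q.2|].
Proof.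
move=> e0 T0.
have [|||||t tD] := @avg_neg D (2 + e) (fun y => ray_dist y + - e * `|y|) _ a D0 DZ.
- move=> y z; have := ray_dist_lipschitz y z.
  have : `|z| <= `|y| + `|y - z| by rewrite -{1}(subKr y z) ler_normB.
  by rewrite mulrDl => /(ler_wpM2l (ltW e0)); lra.
- by move=> c y c0; rewrite ray_distZ// normrZ gtr0_norm//; lra.
- exact: aD.
- exact: a0.
- move=> i; have := ray_dist_le (a i) i; rewrite a1 scale1r subrr normr0; lra.
rewrite avgD avgZ; set N := avg (fun y => `|y|) t 0; set P := avg ray_dist t 0.
move=> PN.
have P0 : 0 <= P by rewrite -(avg_cst 0 t 0); apply: le_avg => z; exact: normr_ge0.
have N0 : 0 < N by rewrite -(pmulr_rgt0 _ e0); lra.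
have [del del0 delP] := law_gap (law t 0).
(* The ratio [P / N < e] survives both halving and dilation. Here [k] halvings divide the first
   moment by [2^k], and the dilation by [c = 2^k / N] brings it back to 1; the nonzero atoms then
   have norm at least [c del >= T]. *)
have [k kP] : exists k : nat, T * N / del <= 2 ^+ k.
  exists (Num.bound (T * N / del)).
  have TN0 : 0 <= T * N / del by rewrite divr_ge0 ?mulr_ge0 ?ltW.
  have /ltW TNk := archi_boundP TN0; apply: (le_trans TNk).
  by rewrite -natrX ler_nat ltnW// ltn_expl.
pose c := 2 ^+ k / N.
have c0 : 0 < c by rewrite divr_gt0// exprn_gt0.
have scE F : (forall b y, 0 < b -> F (b *: y) = b * F y) ->
    avg F (scale_splitting c (iter k halve t)) 0 = avg F t 0 / N.
  move=> FZ; have F0 : F 0 = 0 by have := FZ 2 0 ltac:(lra); rewrite scaler0; lra.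
  rewrite -{1}(scaler0 _ c) avg_scale.
  have -> : avg (fun z => F (c *: z)) (iter k halve t) 0 =
      avg (fun z => c * F z) (iter k halve t) 0.
    by rewrite /avg; apply: eq_bigr => q _; rewrite FZ.
  rewrite avgZ avg_halve// /c.
  have k1 : 2 ^+ k * (2^-1) ^+ k = 1 :> R by rewrite -exprMn mulfV ?expr1n// pnatr_eq0.
  by rewrite mulrACA k1 mul1r mulrC.
exists (scale_splitting c (iter k halve t)); split.
- apply: splits_along_scale; first by move=> m; exact: DZ.
  by elim: (k) => // k' IH; rewrite iterS /=; split.
- rewrite scE ?divff ?gt_eqF// => b y b0; by rewrite normrZ gtr0_norm.
- rewrite scE; last exact: ray_distZ.
  by rewrite ler_pdivrMr// -/P; lra.
- move=> q; rewrite -{1}(scaler0 _ c) law_scale => /mapP[r rl -> /=] cr0.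
  have r0 : r.2 != 0 by apply: contraNneq cr0 => ->; rewrite scaler0.
  have [u ul ru] := law_halve rl r0.
  rewrite normrZ gtr0_norm// ru -ler_pdivrMl//.
  apply: le_trans (delP u ul _); last by rewrite -ru.
  rewrite /c invf_div mulrAC ler_pdivrMr ?exprn_gt0//.
  by move: kP; rewrite ler_pdivrMr// [del * _]mulrC [N * _]mulrC.
Qed.

End concentration.
End laminates.

(** * Waves *)

Section waves.
Context (R : realType) (d : nat).
Implicit Types (x y xi eta : 'rV[R]_d).

Definition dotv x y : R := \sum_i x ord0 i * y ord0 i.

Lemma dotvDl x y z : dotv (x + y) z = dotv x z + dotv y z.
Proof. by rewrite /dotv -big_split; apply: eq_bigr => i _; rewrite mxE mulrDl. Qed.

Lemma dotvDr x y z : dotv x (y + z) = dotv x y + dotv x z.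
Proof. by rewrite /dotv -big_split; apply: eq_bigr => i _; rewrite mxE mulrDr. Qed.

Lemma dotvZl c x y : dotv (c *: x) y = c * dotv x y.
Proof. by rewrite /dotv mulr_sumr; apply: eq_bigr => i _; rewrite mxE mulrA. Qed.

Lemma dotvZr c x y : dotv x (c *: y) = c * dotv x y.
Proof. by rewrite /dotv mulr_sumr; apply: eq_bigr => i _; rewrite mxE mulrCA. Qed.

Lemma dotv_delta x i : dotv x (delta_mx ord0 i) = x ord0 i.
Proof.
rewrite /dotv (bigD1 i)//= big1 ?addr0 => [|j ji].
  by rewrite mxE !eqxx mulr1.
by rewrite mxE (negbTE ji) andbF mulr0.
Qed.

Lemma dotvv_gt0 x : x != 0 -> 0 < dotv x x.
Proof.
move=> x0; rewrite lt_def sumr_ge0 => [|i _]; last by rewrite -expr2 sqr_ge0.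
rewrite andbT; apply: contra x0; rewrite psumr_eq0 => [/allP H|i _]; last first.
  by rewrite -expr2 sqr_ge0.
apply/eqP/rowP => i; rewrite mxE; apply/eqP.
by have := H i (mem_index_enum i); rewrite mulf_eq0 orbb.
Qed.

Lemma coord_le_norm x i : `|x ord0 i| <= `|x|.
Proof.
rewrite -[`|x|]/(mx_norm x) mx_normrE.
by rewrite (le_bigmax_cond _ (fun ij => `|x ij.1 ij.2|) (j := (ord0, i))).
Qed.

(** Row vectors carry the sup norm, so the dual norm, a sum of absolute values, takes the place of
    Cauchy-Schwarz. *)
Lemma dotv_le x y : `|dotv x y| <= (\sum_i `|x ord0 i|) * `|y|.
Proof.
rewrite mulr_suml; apply: (le_trans (ler_norm_sum _ _ _)).
by apply: ler_sum => i _; rewrite normrM ler_wpM2l// coord_le_norm.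
Qed.

Lemma cos_lipschitz (a b : R) : `|cos a - cos b| <= `|a - b|.
Proof.
wlog ab : a b / a <= b => [H|].
  have [|/ltW ba] := leP a b; first exact: H.
  by rewrite distrC [leRHS]distrC; exact: H.
move: ab; rewrite le_eqVlt => /predU1P[->|ab]; first by rewrite !subrr.
have [|c _] := @MVT R cos (fun t => - sin t) a b ab.
  by apply: continuous_subspaceT => t; exact: continuous_cos.
rewrite distrC => ->; rewrite normrM normrN [`|a - b|]distrC.
by rewrite ler_piMl// sin_max.
Qed.

(** The derivative [- sin] is written as a cosine whose phase is moved by [pi / 2]: derivatives of
    waves are again waves of the same kind, with real amplitudes. *)
Lemma is_derive_plane_wave (V : normedModType R) eta (phi : R) (v : V) x i :
  is_derive x (delta_mx ord0 i) (fun x => cos (dotv eta x + phi) *: v)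
    (cos (dotv eta x + (phi + pi / 2)) *: (eta ord0 i *: v)).
Proof.
set th := dotv eta x + phi; set c := eta ord0 i.
have cosd : (fun h : R => h^-1 *: (cos (h *: c + th) - cos th)) @ 0^' -->
    (- sin th * c).
  have dcos : differentiable (@cos R) th by apply/derivable1_diffP; exact: derivable_cos.
  have -> : - sin th * c = 'D_c (@cos R) th.
    by rewrite deriveE// diff1E// derive1E derive_val mulrC.
  exact: (@diff_derivable _ _ _ (@cos R) th c dcos).
have H : (fun h : R => h^-1 *:
    (((fun x => cos (dotv eta x + phi) *: v) \o shift x) (h *: delta_mx ord0 i) -
     cos th *: v)) @ 0^' --> (- sin th * c) *: v.
  rewrite (_ : (fun h => _) =
    (fun h : R => (h^-1 *: (cos (h *: c + th) - cos th)) *: v)); last first.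
    apply/funext => h /=; rewrite dotvDr dotvZr dotv_delta -addrA -/th -scalerBl.
    by rewrite scalerA.
  by apply: cvgZ => //; exact: cvg_cst.
split; first by apply/cvg_ex; exists ((- sin th * c) *: v).
by rewrite addrA cosDpihalf scalerA; exact/cvg_lim.
Qed.

Definition wave_sum (V : lmodType R) (L : seq ('rV[R]_d * R * V)) x : V :=
  \sum_(q <- L) cos (dotv q.1.1 x + q.1.2) *: q.2.

(** The action of a Fourier multiplier on a sum of waves; the common phase shift [c] plays the role
    of a power of the imaginary unit. *)
Definition map_waves (V U : Type) (c : R) (g : 'rV[R]_d -> V -> U)
    (L : seq ('rV[R]_d * R * V)) : seq ('rV[R]_d * R * U) :=
  [seq (q.1.1, q.1.2 + c, g q.1.1 q.2) | q <- L].

Lemma wave_sum_cons (V : lmodType R) q (L : seq ('rV[R]_d * R * V)) :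
  wave_sum (q :: L) =
  (fun x => cos (dotv q.1.1 x + q.1.2) *: q.2) + wave_sum L.
Proof. by apply/funext => x; rewrite /wave_sum big_cons. Qed.

Lemma wave_sum_cat (V : lmodType R) (L M : seq ('rV[R]_d * R * V)) x :
  wave_sum (L ++ M) x = wave_sum L x + wave_sum M x.
Proof. by rewrite /wave_sum big_cat. Qed.

Lemma is_derive_wave_sum (V : normedModType R) (L : seq ('rV[R]_d * R * V)) x i :
  is_derive x (delta_mx ord0 i) (wave_sum L)
    (wave_sum (map_waves (pi / 2) (fun eta v => eta ord0 i *: v) L) x).
Proof.
elim: L => [|q L IH].
  rewrite (_ : wave_sum _ = cst 0); last by apply/funext => y; rewrite /wave_sum big_nil.
  exact: is_derive_cst.
rewrite wave_sum_cons /= wave_sum_cons.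
apply: is_deriveD; exact: is_derive_plane_wave.
Qed.

Lemma wave_sum_lipschitz (V : normedModType R) (L : seq ('rV[R]_d * R * V)) :
  exists2 C, 0 <= C & forall x, `|wave_sum L x| <= C /\
    forall y, `|wave_sum L x - wave_sum L y| <= C * `|x - y|.
Proof.
elim: L => [|q L [C C0 LC]].
  by exists 0 => // x; split=> [|y]; rewrite /wave_sum !big_nil ?subrr normr0 ?mul0r.
pose S := \sum_i `|q.1.1 ord0 i|.
have S0 : 0 <= S by exact: sumr_ge0.
exists ((1 + S) * `|q.2| + C); first by rewrite addr_ge0// mulr_ge0// addr_ge0.
move=> x; rewrite wave_sum_cons; split => [|y].
  apply: (le_trans (ler_normD _ _)); apply: lerD; last exact: (LC x).1.
  rewrite normrZ; apply: ler_wpM2r => //.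
  by apply: (le_trans (cos_max _)); rewrite lerDl.
rewrite [_ - _](_ : _ = (cos (dotv q.1.1 x + q.1.2) - cos (dotv q.1.1 y + q.1.2)) *: q.2 +
   (wave_sum L x - wave_sum L y)); last first.
  by rewrite scalerBl addrACA opprD.
rewrite mulrDl; apply: (le_trans (ler_normD _ _)); apply: lerD; last exact: (LC x).2.
rewrite normrZ mulrAC; apply: ler_wpM2r => //; apply: (le_trans (cos_lipschitz _ _)).
rewrite opprD addrACA subrr addr0 (_ : _ - _ = dotv q.1.1 (x - y)); last first.
  by rewrite dotvDr -(scaleN1r y) dotvZr mulN1r.
by apply: (le_trans (dotv_le _ _)); rewrite mulrDl lerDr mul1r.
Qed.

Lemma lipschitz_continuous (U V : normedModType R) (f : U -> V) C :
  (forall u v : U, `|f u - f v| <= C * `|u - v|) -> continuous f.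
Proof.
move=> fC x; apply/cvgrPdist_le => e e0.
have C0 : 0 < `|C| + 1 by rewrite ltr_wpDl.
apply/nbhs_normP; exists (e / (`|C| + 1)); first by rewrite /= divr_gt0.
move=> y /= xy; apply: (le_trans (fC x y)).
apply: (@le_trans _ _ ((`|C| + 1) * `|x - y|)).
  by apply: ler_wpM2r => //; rewrite (le_trans (ler_norm _))// lerDl.
by rewrite -ler_pdivlMl// mulrC ltW.
Qed.

Lemma continuous_wave_sum (V : normedModType R) (L : seq ('rV[R]_d * R * V)) :
  continuous (wave_sum L).
Proof.
have [C _ LC] := wave_sum_lipschitz L.
by apply: (@lipschitz_continuous _ _ _ C) => x y; exact: (LC x).2.
Qed.

Lemma iter_partial_wave_sum (V : normedModType R) s (L : seq ('rV[R]_d * R * V)) :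
  iter_partial s (wave_sum L) = wave_sum
    (map_waves ((size s)%:R * (pi / 2)) (fun eta v => (\prod_(i <- s) eta ord0 i) *: v) L).
Proof.
elim: s => [|i s IH] /=.
  congr wave_sum; rewrite -[LHS]map_id; apply: eq_map => -[[eta phi] v] /=.
  by rewrite mul0r addr0 big_nil scale1r.
apply/funext => x; rewrite IH.
have := is_derive_wave_sum (map_waves ((size s)%:R * (pi / 2))
    (fun eta v => (\prod_(i <- s) eta ord0 i) *: v) L) x i.
move=> /@derive_val ->; rewrite /map_waves -map_comp; congr (wave_sum _ x).
apply: eq_map => -[[eta phi] v] /=.
rewrite scalerA big_cons -addrA; congr (_, _ + _, _).
by rewrite -[(size s).+1]addn1 natrD; ring.
Qed.

Lemma smooth_wave_sum (V : normedModType R) Om (L : seq ('rV[R]_d * R * V)) :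
  smooth_on Om (wave_sum L).
Proof.
move=> s x _; rewrite iter_partial_wave_sum; split => [|i].
  exact: continuous_wave_sum.
exact: (@ex_derive _ _ _ _ _ _ _ (is_derive_wave_sum _ _ _)).
Qed.

Lemma mpartial_wave_sum (V : normedModType R) k (a : mindex d k)
    (L : seq ('rV[R]_d * R * V)) :
  mpartial a (wave_sum L) = wave_sum (map_waves
    ((mdegree a)%:R * (pi / 2)) (fun eta v => (\prod_i eta ord0 i ^+ a i) *: v) L).
Proof.
rewrite /mpartial iter_partial_wave_sum.
have -> : size (flatten [seq nseq (a i) i | i <- enum 'I_d]) = mdegree a.
  rewrite size_flatten /shape -map_comp sumnE big_map big_enum /=.
  by apply: eq_bigr => i _; rewrite size_nseq.
congr wave_sum; apply: eq_map => q /=; congr (_, _ *: _).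
rewrite big_flatten big_map big_enum /=; apply: eq_bigr => i _.
elim: (a i : nat) => [|m IH]; first by rewrite big_nil.
by rewrite big_cons IH exprS.
Qed.

(** All multi-indices of the operator have degree [k], so all terms shift the phase by the same
    [k pi / 2], the real form of the factor [i^k]. What remains acts on the amplitudes through the
    symbol. *)
Lemma diff_op_wave_sum (V W : euclideanType R) k (A : mindex d k -> 'Hom(V, W))
    (L : seq ('rV[R]_d * R * V)) x :
  diff_op A (wave_sum L) x = wave_sum (map_waves (k%:R * (pi / 2)) (symbol A) L) x.
Proof.
transitivity (\sum_(a : mindex d k | mdegree a == k) \sum_(q <- L)
    cos (dotv q.1.1 x + (q.1.2 + k%:R * (pi / 2))) *:
      ((\prod_i q.1.1 ord0 i ^+ a i) *: A a q.2)).
  apply: eq_bigr => a /eqP ak; rewrite mpartial_wave_sum /wave_sum big_map ak.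
  rewrite linear_sum; apply: eq_bigr => q _ /=; rewrite linearZ /=.
  by congr (_ *: _); rewrite linearZ.
rewrite exchange_big /wave_sum big_map; apply: eq_bigr => q _.
rewrite -scaler_sumr /symbol sum_lfunE; congr (_ *: _).
by apply: eq_bigr => a _; rewrite scale_lfunE.
Qed.

End waves.

(** * Approximate square waves with odd harmonics *)

Section sign_approximation.
Context (R : realType).

(** The Newton-Schulz iteration for the sign function: an odd polynomial that fixes -1, 0 and 1,
    preserves [[-1, 1]] and drives its nonzero points to 1 or -1. *)
Definition sign_step (y : R) : R := (3 * y - y ^+ 3) / 2.

Definition sign_approx n y := iter n sign_step y.

Lemma sign_approxN n y : sign_approx n (- y) = - sign_approx n y.
Proof.
elim: n => // n IH; rewrite /sign_approx !iterS -!/(sign_approx n _) IH.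
by rewrite /sign_step !exprS expr0; field.
Qed.

Lemma sign_step_itv (y : R) : 0 <= y <= 1 -> y <= sign_step y <= 1.
Proof.
move=> /andP[y0 y1]; rewrite /sign_step.
have y3 : y ^+ 3 = y * y * y by rewrite !exprS expr0; ring.
rewrite y3; apply/andP; split; last first.
  have : 0 <= (1 - y) * (1 - y) * (2 + y).
    by rewrite mulr_ge0 ?addr_ge0// -expr2 sqr_ge0.
  by lra.
have : 0 <= y * (1 - y) * (1 + y)
  by apply: mulr_ge0; [rewrite mulr_ge0// subr_ge0|rewrite addr_ge0].
by lra.
Qed.

Lemma sign_approx_itv n (y : R) : 0 <= y <= 1 -> y <= sign_approx n y <= 1.
Proof.
move=> y01; have /andP[y0 y1] := y01.
elim: n => [|n /andP[yn n1]]; first by rewrite /= lexx.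
rewrite /sign_approx iterS -/(sign_approx n y).
have /andP[H ->] : sign_approx n y <= sign_step (sign_approx n y) <= 1.
  by apply: sign_step_itv; rewrite n1 (le_trans y0).
by rewrite (le_trans yn H).
Qed.

Lemma sign_approx_le1 n y : `|y| <= 1 -> `|sign_approx n y| <= 1.
Proof.
wlog y0 : y / 0 <= y => [H|].
  have [|/ltW y0] := leP 0 y; first exact: H.
  by rewrite -(normrN y) -(normrN (sign_approx _ _)) -sign_approxN; apply: H; rewrite oppr_ge0.
rewrite ger0_norm// => y1; have /andP[yn n1] := @sign_approx_itv n y ltac:(by rewrite y0).
by rewrite ger0_norm// (le_trans y0).
Qed.

Lemma sign_approx_cvg (c e : R) : 0 < c -> 0 < e ->
  exists n, forall y, c <= `|y| -> `|y| <= 1 -> 1 - e <= `|sign_approx n y|.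
Proof.
move=> c0 e0; have [c1|c1] := ltP 1 c.
  by exists 0%N => y cy /(le_trans cy); rewrite leNgt c1.
(* Now [c <= 1], so that [1 - c / 2] lies between [1 / 2] and 1 and its powers tend to 0. *)
have [n nP] : exists n, (1 - c / 2) ^+ n <= e.
  have := @cvg_expr R (1 - c / 2).
  rewrite ger0_norm; last by lra.
  move=> /(_ ltac:(lra)) /cvgrPdist_le /(_ e e0)[k _ /(_ k (leqnn k))] /= H.
  by exists k; move: H; rewrite sub0r normrN; apply: le_trans; rewrite ler_norm.
exists n => y; wlog y0 : y / 0 <= y => [H|].
  have [|/ltW y0] := leP 0 y; first exact: H.
  by rewrite -(normrN y) -(normrN (sign_approx _ _)) -sign_approxN; apply: H; rewrite oppr_ge0.
rewrite ger0_norm// => cy y1.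
have y01 : 0 <= y <= 1 by rewrite y0.
suff H : 1 - sign_approx n y <= (1 - c / 2) ^+ n.
  have /andP[yn _] := sign_approx_itv n y01.
  by rewrite ger0_norm ?(le_trans y0)//; lra.
elim: (n) => [|k IH]; first by rewrite expr0 /=; lra.
have /andP[yk k1] := sign_approx_itv k y01.
rewrite /sign_approx iterS -/(sign_approx k y) exprS /sign_step.
move: yk k1 IH; set z := sign_approx k y => yz z1 IH.
(* One step multiplies the error by [(1 - z) (2 + z) / 2 = 1 - (z + z^2) / 2], which is at most
   [1 - c / 2] because [z >= y >= c]. *)
have -> : 1 - (3 * z - z ^+ 3) / 2 = (1 - z) * ((1 - z) * (2 + z) / 2).
  by rewrite !exprS expr0; lra.
rewrite mulrC; apply: ler_pM => //; rewrite ?subr_ge0//.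
- by rewrite divr_ge0 ?mulr_ge0 ?subr_ge0 ?addr_ge0// (le_trans y0).
- have : 0 <= z * z by rewrite -expr2 sqr_ge0.
  by lra.
Qed.

(* The point of oddness is that the frequency zero does not occur. *)
Inductive odd_cos : (R -> R) -> Prop :=
| odd_cos_term c (k : int) : odd_cos (fun t => c * cos ((2 * k + 1)%:~R * t))
| odd_cosD f g : odd_cos f -> odd_cos g -> odd_cos (fun t => f t + g t).

Lemma eq_odd_cos f g : f =1 g -> odd_cos f -> odd_cos g.
Proof. by move=> /funext ->. Qed.

Lemma odd_cosZ c f : odd_cos f -> odd_cos (fun t => c * f t).
Proof.
elim=> [b k|g h _ IHg _ IHh].
  by apply: eq_odd_cos (odd_cos_term (c * b) k) => t; rewrite mulrA.
by apply: eq_odd_cos (odd_cosD IHg IHh) => t; rewrite mulrDr.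
Qed.

(** A product of two odd harmonics has even frequencies, possibly 0, whereas three of them combine
    to the odd frequencies [x + y + z], [x + y - z], [x - y + z] and [x - y - z]. The cube in
    [sign_step] is a product of this kind. *)
Lemma odd_cosM f g h : odd_cos f -> odd_cos g -> odd_cos h ->
  odd_cos (fun t => f t * g t * h t).
Proof.
move=> Of Og Oh; elim: Of => [a i|f1 f2 _ IH1 _ IH2]; last first.
  by apply: eq_odd_cos (odd_cosD IH1 IH2) => t; ring.
elim: Og => [b j|f1 f2 _ IH1 _ IH2]; last first.
  by apply: eq_odd_cos (odd_cosD IH1 IH2) => t; ring.
elim: Oh => [c k|f1 f2 _ IH1 _ IH2]; last first.
  by apply: eq_odd_cos (odd_cosD IH1 IH2) => t; ring.
apply: eq_odd_cos (odd_cosZ (a * b * c / 4) (odd_cosD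
  (odd_cosD (odd_cos_term 1 (i + j + k + 1)) (odd_cos_term 1 (i + j - k)))
  (odd_cosD (odd_cos_term 1 (i - j + k)) (odd_cos_term 1 (i - j - k - 1))))) => t.
set x := (2 * i + 1)%:~R * t; set y := (2 * j + 1)%:~R * t.
set z := (2 * k + 1)%:~R * t.
have -> : (2 * (i + j + k + 1) + 1)%:~R * t = x + y + z.
  by rewrite /x /y /z -!mulrDl -!intrD; congr (_%:~R * _); ring.
have -> : (2 * (i + j - k) + 1)%:~R * t = x + y - z.
  by rewrite /x /y /z -mulrDl -mulrBl -intrD -intrB; congr (_%:~R * _); ring.
have -> : (2 * (i - j + k) + 1)%:~R * t = x - y + z.
  by rewrite /x /y /z -mulrBl -mulrDl -intrB -intrD; congr (_%:~R * _); ring.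
have -> : (2 * (i - j - k - 1) + 1)%:~R * t = x - y - z.
  by rewrite /x /y /z -!mulrBl -!intrB; congr (_%:~R * _); ring.
by rewrite !(cosB, sinB, cosD, sinD, cosN, sinN); field.
Qed.

Lemma odd_cos_sign_approx n : odd_cos (fun t => sign_approx n (cos t)).
Proof.
elim: n => [|n IH].
  by apply: eq_odd_cos (odd_cos_term 1 0) => t; rewrite mulr0 add0r !mul1r.
apply: eq_odd_cos (odd_cosD (odd_cosZ (3 / 2) IH)
  (odd_cosZ (- 2^-1) (odd_cosM IH IH IH))) => t.
rewrite /sign_approx iterS -/(sign_approx n (cos t)) /sign_step.
by rewrite !exprS expr0; lra.
Qed.

End sign_approximation.

(** * Slowly modulated waves close to the cone *)

Section modulation.
Context (R : realType) (d : nat).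
Implicit Types (x y xi eta : 'rV[R]_d) (v w : 'rV[R]_d -> R).

Inductive trig_poly : ('rV[R]_d -> R) -> Prop :=
| trig_poly_term c eta phi : trig_poly (fun x => c * cos (dotv eta x + phi))
| trig_polyD v w : trig_poly v -> trig_poly w -> trig_poly (fun x => v x + w x).

Lemma eq_trig_poly v w : v =1 w -> trig_poly v -> trig_poly w.
Proof. by move=> /funext ->. Qed.

Lemma trig_poly_cst c : trig_poly (fun=> c).
Proof.
apply: eq_trig_poly (trig_poly_term c 0 0) => x.
rewrite /dotv big1 ?addr0 ?cos0 ?mulr1// => i _.
by rewrite mxE mul0r.
Qed.

Lemma trig_polyM v w : trig_poly v -> trig_poly w -> trig_poly (fun x => v x * w x).
Proof.
move=> tv tw; elim: tv => [a eta phi|v1 v2 _ IH1 _ IH2]; last first.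
  by apply: eq_trig_poly (trig_polyD IH1 IH2) => x; rewrite mulrDl.
elim: tw => [b zeta psi|v1 v2 _ IH1 _ IH2]; last first.
  by apply: eq_trig_poly (trig_polyD IH1 IH2) => x; rewrite mulrDr.
apply: eq_trig_poly (trig_polyD (trig_poly_term (a * b / 2) (eta + zeta) (phi + psi))
  (trig_poly_term (a * b / 2) (eta + (-1) *: zeta) (phi - psi))) => x.
rewrite !dotvDl dotvZl.
set s := dotv eta x; set t := dotv zeta x.
have -> : s + t + (phi + psi) = (s + phi) + (t + psi) by rewrite addrACA.
have -> : s + -1 * t + (phi - psi) = (s + phi) - (t + psi) by ring.
by rewrite cosD cosB; field.
Qed.

Lemma trig_poly_odd_cos f xi : odd_cos f -> trig_poly (fun x => f (dotv xi x)).
Proof.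
elim=> [c k|g h _ IHg _ IHh]; last exact: trig_polyD.
apply: eq_trig_poly (trig_poly_term c ((2 * k + 1)%:~R *: xi) 0) => x.
by rewrite dotvZl addr0.
Qed.

Lemma trig_poly_lipschitz v : trig_poly v -> exists2 C, 0 <= C &
  forall x, `|v x| <= C /\ forall y, `|v x - v y| <= C * `|x - y|.
Proof.
elim=> [c eta phi|v1 v2 _ [C1 C10 H1] _ [C2 C20 H2]].
  have [C C0 CP] := wave_sum_lipschitz [:: (eta, phi, c : R^o)].
  exists C => // x; have [xC H] := CP x; split => [|y].
    by move: xC; rewrite /wave_sum big_seq1 mulrC.
  by have := H y; rewrite /wave_sum !big_seq1 /= ![c * _]mulrC.
exists (C1 + C2); first exact: addr_ge0.
move=> x; split => [|y].
  by apply: (le_trans (ler_normD _ _)); rewrite lerD ?(H1 x).1 ?(H2 x).1.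
rewrite opprD addrACA mulrDl; apply: (le_trans (ler_normD _ _)).
by rewrite lerD ?(H1 x).2 ?(H2 x).2.
Qed.

Variables (V : euclideanType R) (K : 'rV[R]_d -> {vspace V}).
Hypothesis KZ : forall c xi (mu : V), c != 0 -> mu \in K xi -> mu \in K (c *: xi).
Hypothesis K_lsc : forall xi (mu : V) e, xi != 0 -> mu \in K xi -> 0 < e ->
  exists2 del, 0 < del & forall eta, `|eta - xi| < del ->
    exists2 mu', mu' \in K eta & `|mu' - mu| <= e.

(** The frequency 0 is excluded because the hypotheses control [K] only away from 0. *)
Definition cone_field (Y : 'rV[R]_d -> V) := exists2 L : seq ('rV[R]_d * R * V),
  forall q, q \in L -> q.1.1 != 0 /\ q.2 \in K q.1.1 & Y = wave_sum L.

Lemma cone_fieldD Y Z : cone_field Y -> cone_field Z ->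
  cone_field (fun x => Y x + Z x).
Proof.
move=> [L LP ->] [M MP ->]; exists (L ++ M).
  by move=> q; rewrite mem_cat => /orP[/LP|/MP].
by apply/funext => x; rewrite wave_sum_cat.
Qed.

Lemma cone_field0 : cone_field (fun=> 0).
Proof. by exists [::] => //; apply/funext => x; rewrite /wave_sum big_nil. Qed.

Lemma cone_field_term eta phi (mu : V) : eta != 0 -> mu \in K eta ->
  cone_field (fun x => cos (dotv eta x + phi) *: mu).
Proof.
move=> eta0 mueta; exists [:: (eta, phi, mu)].
  by move=> q; rewrite inE => /eqP ->.
by apply/funext => x; rewrite /wave_sum big_seq1.
Qed.

(** Up to the factor [m N] the frequency is [xi + zeta / (m N)], which tends to [xi]; semicontinuity
    supplies an amplitude there, and homogeneity of [K] carries it to the actual frequency. The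
    phase does not enter, hence [N0] is uniform in [phi]. *)
Lemma cone_field_near xi (mu : V) e zeta (m : R) : xi != 0 -> mu \in K xi ->
  0 < e -> m != 0 -> exists N0 : nat, forall N, (N0 <= N)%N -> forall phi,
  exists2 Y, cone_field Y & forall x,
    `|Y x - cos (dotv (zeta + (m * N%:R) *: xi) x + phi) *: mu| <= e.
Proof.
move=> xi0 muxi e0 m0; have [del del0 delP] := K_lsc xi0 muxi e0.
(* The bound [|xi|] keeps the perturbed direction [eta'] nonzero. *)
pose del' := Num.min del `|xi|.
have del'0 : 0 < del' by rewrite lt_min del0 normr_gt0.
have [N0 N0P] : exists N0 : nat, `|zeta| / (`|m| * del') < N0%:R.
  exists (Num.bound (`|zeta| / (`|m| * del'))); apply: archi_boundP.
  by rewrite divr_ge0// mulr_ge0// ltW.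
exists N0.+1 => N N0N phi; set eta := zeta + _.
have N_gt0 : 0 < N%:R :> R by rewrite ltr0n (leq_trans _ N0N).
have mN0 : m * N%:R != 0 by rewrite mulf_neq0// gt_eqF.
pose eta' := xi + (m * N%:R)^-1 *: zeta.
have etaE : eta = (m * N%:R) *: eta'.
  by rewrite scalerDr scalerA mulfV// scale1r addrC.
have eta'xi : `|eta' - xi| < del'.
  rewrite addrAC subrr add0r normrZ normfV normrM (gtr0_norm N_gt0).
  have md0 : 0 < `|m| * del' by rewrite mulr_gt0// normr_gt0.
  rewrite ltr_pdivrMl ?mulr_gt0 ?normr_gt0// mulrAC.
  move: N0P; rewrite ltr_pdivrMr// => /lt_le_trans; apply.
  by rewrite mulrC ler_wpM2l ?(ltW md0)// ler_nat ltnW.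
have eta'0 : eta' != 0.
  apply/eqP => z; move: eta'xi; rewrite z sub0r normrN /del' lt_min ltxx andbF.
  by [].
have del'_le : del' <= del by rewrite ge_min lexx.
have [mu' mu'K mu'mu] := delP eta' (lt_le_trans eta'xi del'_le).
exists (fun x => cos (dotv eta x + phi) *: mu').
  apply: cone_field_term; rewrite etaE; first by rewrite scaler_eq0 negb_or mN0.
  exact: KZ.
move=> x; rewrite -scalerBr normrZ -[leRHS]mul1r ler_pM//.
exact: cos_max.
Qed.

(* A slow trigonometric polynomial times a fast odd wave [N xi] only involves
   frequencies whose direction is close to that of [xi]. *)
Lemma cone_field_modulation v f xi (mu : V) e : trig_poly v -> odd_cos f ->
  xi != 0 -> mu \in K xi -> 0 < e ->
  exists N0 : nat, forall N, (N0 <= N)%N ->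
  exists2 Y, cone_field Y & forall x,
    `|Y x - (v x * f (dotv (N%:R *: xi) x)) *: mu| <= e.
Proof.
move=> tv Of xi0 muxi; elim: tv e => [c eta phi|v1 v2 _ IH1 _ IH2] e e0; last first.
  have e20 : 0 < e / 2 by rewrite divr_gt0.
  have [N1 N1P] := IH1 _ e20; have [N2 N2P] := IH2 _ e20.
  exists (maxn N1 N2) => N; rewrite geq_max => /andP[/N1P[Y1 Y1K Y1P] /N2P[Y2 Y2K Y2P]].
  exists (fun x => Y1 x + Y2 x); first exact: cone_fieldD.
  move=> x; rewrite mulrDl scalerDl opprD addrACA [leRHS]splitr.
  by apply: (le_trans (ler_normD _ _)); rewrite lerD.
elim: Of e e0 => [b k|f1 f2 _ IH1 _ IH2] e e0; last first.
  have e20 : 0 < e / 2 by rewrite divr_gt0.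
  have [N1 N1P] := IH1 _ e20; have [N2 N2P] := IH2 _ e20.
  exists (maxn N1 N2) => N; rewrite geq_max => /andP[/N1P[Y1 Y1K Y1P] /N2P[Y2 Y2K Y2P]].
  exists (fun x => Y1 x + Y2 x); first exact: cone_fieldD.
  move=> x; rewrite mulrDr scalerDl opprD addrACA [leRHS]splitr.
  by apply: (le_trans (ler_normD _ _)); rewrite lerD.
pose m : R := (2 * k + 1)%:~R.
have m0 : m != 0 by rewrite intr_eq0; lia.
have e20 : 0 < e / 2 by rewrite divr_gt0.
(* By the product formula the modulated wave is the sum of two waves of this amplitude, with
   frequencies [eta + m N xi] and [eta - m N xi]. *)
have muK : (c * b / 2) *: mu \in K xi by rewrite memvZ.
have [N1 N1P] := cone_field_near eta xi0 muK e20 m0.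
have [N2 N2P] := cone_field_near eta xi0 muK e20 (m := - m) ltac:(by rewrite oppr_eq0).
exists (maxn N1 N2) => N; rewrite geq_max => /andP[/N1P/(_ phi)[Y1 Y1K Y1P]].
move=> /N2P/(_ phi)[Y2 Y2K Y2P].
exists (fun x => Y1 x + Y2 x); first exact: cone_fieldD.
move=> x; have := lerD (Y1P x) (Y2P x); rewrite -splitr; apply: le_trans.
apply: le_trans (ler_normD _ _); rewrite addrACA -opprD -scalerDl scalerA.
rewrite (_ : (_ + _) * _ = c * cos (dotv eta x + phi) *
  (b * cos ((2 * k + 1)%:~R * dotv (N%:R *: xi) x)))//.
rewrite !dotvDl !dotvZl -/m.
set s := dotv eta x; set t := dotv xi x.
have -> : s + m * N%:R * t + phi = (s + phi) + m * (N%:R * t) by ring.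
have -> : s + - m * N%:R * t + phi = (s + phi) - m * (N%:R * t) by ring.
by rewrite cosD cosB; field.
Qed.

End modulation.

(** * Translations of Lebesgue measure *)

Section translation.
Context (R : realType).

Lemma continuous_measurable_fun (T : ptopologicalType) (U : ptopologicalType)
    (f : T -> U) : continuous f ->
  measurable_fun setT (f : borel T -> borel U).
Proof.
move=> fc; apply: (@measurability _ _ (borel T) (borel U) setT f (@open U)) => //.
by move=> _ [A oA <-]; rewrite setTI; apply: open_borel; exact: open_comp.
Qed.

Lemma continuous_measurable_real (T : ptopologicalType) (f : T -> R) :
  continuous f -> measurable_fun setT (f : borel T -> measurableTypeR R).
Proof.
move=> fc; apply: (measurability _ (RGenOpens.measurableE R)).
move=> _ [_ [a [b ->] <-]]; rewrite setTI; apply: open_borel.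
by apply: open_comp; [move=> v _; exact: fc|exact: interval_open].
Qed.

Lemma lebesgue_measure_shift (a : R) (A : set (measurableTypeR R)) :
  measurable A ->
  lebesgue_measure ((fun t : measurableTypeR R => (t : R) + a : measurableTypeR R) @^-1` A) =
  lebesgue_measure A.
Proof.
move=> mA; pose T := (fun t : measurableTypeR R => (t : R) + a : measurableTypeR R).
have mT : measurable_fun setT T by apply: measurable_funD.
rewrite -[LHS]/(pushforward lebesgue_measure T A).
apply/esym/lebesgue_measure_unique => //= _ [[b c]] _ <-.
rewrite /pushforward (_ : T @^-1` _ = [set` `]b - a, c - a]]); last first.
  by apply/seteqP; split => t /=; rewrite !in_itv /= /T ltrBlDr lerBrDr.
rewrite !lebesgue_measure_itv/= !lte_fin ltrD2r; case: ifP => // _.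
by rewrite -!EFinD; congr EFin; ring.
Qed.

(** Induction on the dimension: under [consrV] a translation is a product of two translations, and
    the translated product measure agrees with the original one on rectangles, which determine
    it. *)
Lemma lebesgue_rV_shift n (v : 'rV[R]_n) (A : set (borel 'rV[R]_n)) :
  measurable A ->
  lebesgue_rV ((fun x : borel 'rV[R]_n => (x : 'rV[R]_n) + v : borel 'rV[R]_n) @^-1` A) =
  lebesgue_rV A.
Proof.
elim: n v A => [|n IH] v A mA.
  congr lebesgue_rV; apply/seteqP; split => x /=;
    by rewrite (_ : (x : 'rV[R]_0) + v = x)//; apply/rowP => -[].
have e0 : ord0 = @lshift 1 n ord0 :> 'I_n.+1 by exact/val_inj.
pose a : R := v ord0 ord0; pose w : 'rV[R]_n := @rsubmx _ 1 1 n v.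
pose T (p : measurableTypeR R * borel 'rV[R]_n) : measurableTypeR R * borel 'rV[R]_n :=
  ((p.1 : R) + a, (p.2 : 'rV[R]_n) + w).
have mS (m : nat) (u : 'rV[R]_m) : measurable_fun setT
    (fun x : borel 'rV[R]_m => (x : 'rV[R]_m) + u : borel 'rV[R]_m).
  have uc : continuous (fun x : 'rV[R]_m => x + u).
    apply: (@lipschitz_continuous _ _ _ _ 1) => x y.
    by rewrite opprD addrACA subrr addr0 mul1r.
  exact: continuous_measurable_fun uc.
have mT : measurable_fun setT T.
  apply: measurable_fun_pair.
    by apply: measurable_funD; [exact: measurable_fst|exact: measurable_cst].
  by apply: (measurableT_comp (mS n w)); exact: measurable_snd.
have mA' : measurable (@consrV R n @^-1` A).
  by rewrite -[X in measurable X]setTI; exact: measurable_consrV.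
rewrite /= /pushforward -comp_preimage.
rewrite (_ : _ @^-1` A = T @^-1` (@consrV R n @^-1` A)); last first.
  rewrite -comp_preimage; congr (_ @^-1` A); apply/funext => -[x y] /=.
  transitivity (row_mx (x : R)%:M (y : 'rV[R]_n) +
    row_mx (@lsubmx _ 1 1 n v) (@rsubmx _ 1 1 n v)); first by rewrite hsubmxK.
  rewrite add_row_mx; apply: (congr2 (@row_mx R 1 1 n)) => //=.
  by apply/matrixP => i j; rewrite !ord1 !mxE /a e0 /= !mulr1n.
rewrite -[LHS]/(pushforward (lebesgue_measure \x @lebesgue_rV R n)%E T _).
apply/esym; apply: (@product_measure_unique _ _ _ _ R lebesgue_measure
  (@lebesgue_rV R n) (pushforward (lebesgue_measure \x @lebesgue_rV R n)%E T)) => //.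
move=> B C mB mC.
rewrite -[LHS]/((lebesgue_measure \x @lebesgue_rV R n)%E (T @^-1` (B `*` C))).
rewrite (_ : T @^-1` _ =
  ((fun t : measurableTypeR R => (t : R) + a : measurableTypeR R) @^-1` B) `*`
  ((fun x : borel 'rV[R]_n => (x : 'rV[R]_n) + w : borel 'rV[R]_n) @^-1` C))//.
rewrite product_measure1E//.
- by congr (_ * _)%E; [exact: lebesgue_measure_shift|exact: IH].
- rewrite -[X in measurable X]setTI.
  have mTa : measurable_fun setT
    (fun t : measurableTypeR R => (t : R) + a : measurableTypeR R) by apply: measurable_funD.
  exact: mTa.
- by rewrite -[X in measurable X]setTI; exact: mS.
Qed.

Variables (d : nat) (Om : set 'rV[R]_d).
Hypotheses (Om_open : open Om) (Om_bounded : bounded_set Om).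
Local Notation mu := (@lebesgue_rV R d).
Local Notation mOm := (open_borel Om_open).

Lemma lebesgue_rV_bounded : (mu Om < +oo)%E.
Proof.
have [M [Mreal MP]] := Om_bounded.
pose b := `|M| + 1.
pose I (i : 'I_d) : set (measurableTypeR R) := `[- b, b]%classic.
have OmB : Om `<=` [set v : borel 'rV[R]_d | forall i,
    I i ((v : 'rV[R]_d) ord0 i)].
  move=> x Omx i; rewrite /I /= in_itv /= -ler_norml.
  apply: (le_trans (coord_le_norm x i)); apply: MP Omx.
  by rewrite /b (le_lt_trans (ler_norm _))// ltrDl.
have mB : measurable [set v : borel 'rV[R]_d | forall i,
    I i ((v : 'rV[R]_d) ord0 i)].
  rewrite (_ : mkset _ = \bigcap_(i in [set: 'I_d])
    [set v : borel 'rV[R]_d | I i ((v : 'rV[R]_d) ord0 i)]).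
    apply: fin_bigcap_measurable => // i _; rewrite -[X in measurable X]setTI.
    by apply: (@measurable_coord R d i) => //; exact: measurable_itv.
  by apply/seteqP; split => [v Av i _|v Av i]; [exact: Av|exact: (Av i)].
apply: (@le_lt_trans _ _ (mu [set v : borel 'rV[R]_d | forall i,
    I i ((v : 'rV[R]_d) ord0 i)])).
  by apply: le_measure; rewrite ?inE//; exact: mOm.
rewrite (@lebesgue_rV_box R d I); last by move=> i; exact: measurable_itv.
have IE i : lebesgue_measure (I i) = (b - - b)%:E.
  by rewrite /I lebesgue_measure_itv/= lte_fin gtrN ?EFinB// ltr_wpDl.
by under eq_bigr do rewrite IE; rewrite prodEFin ltry.
Qed.

Lemma bounded_integrable (A : set (borel 'rV[R]_d)) (h : 'rV[R]_d -> R) B :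
  measurable A -> (mu A < +oo)%E ->
  measurable_fun setT (h : borel 'rV[R]_d -> measurableTypeR R) ->
  (forall x, A x -> `|h x| <= B) -> mu.-integrable A (EFin \o h).
Proof.
move=> mA Aoo mh hB; apply: measurable_bounded_integrable => //.
  exact: measurable_funS mh.
by exists B; split; [exact: num_real|move=> M BM x Ax; exact: le_trans (hB x Ax) (ltW BM)].
Qed.

Lemma Rintegral_bound (A : set (borel 'rV[R]_d)) (h : 'rV[R]_d -> R) B :
  measurable A -> (mu A < +oo)%E ->
  measurable_fun setT (h : borel 'rV[R]_d -> measurableTypeR R) ->
  (forall x, A x -> `|h x| <= B) ->
  `|\int[mu]_(x in A) h x| <= B * fine (mu A).
Proof.
move=> mA Aoo mh hB; have ih := bounded_integrable mA Aoo mh hB.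
apply: (le_trans (le_normr_Rintegral mA ih)); rewrite -Rintegral_cst//.
apply: le_Rintegral => //.
- apply: (bounded_integrable (B := B) mA Aoo) => [|x /hB]; last by rewrite normr_id.
  exact: measurableT_comp.
- apply: (bounded_integrable (B := `|B|) mA Aoo) => //.
Qed.

(** The sets [C n] of points whose ball of radius [1 / (n + 1)] stays in [Om] exhaust [Om], and such
    points belong to [Om + t] as soon as [t] is shorter than this radius. Continuity from above,
    applied to the sets left over, selects [n]. *)
Lemma shift_small e : 0 < e -> exists2 del, 0 < del & forall t : 'rV[R]_d,
  `|t| < del -> fine (mu (Om `\` [set x | Om (x - t)])) <= e.
Proof.
move=> e0.
pose C n : set (borel 'rV[R]_d) := [set x | forall y, ball x n.+1%:R^-1 y -> Om y].
have mC n : measurable (C n).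
  rewrite -[C n]setCK; apply: measurableC; apply: open_borel.
  rewrite (_ : ~` _ = \bigcup_(y in ~` Om) ball (y : 'rV[R]_d) n.+1%:R^-1).
    by apply: bigcup_open => y _; exact: ball_open.
  apply/seteqP; split => [x /= /existsNP[y /not_implyP[xy yOm]]|x [y yOm xy] Cx].
    by exists y => //; exact: ball_sym.
  by apply: yOm; apply: Cx; exact: ball_sym.
pose F n : set (borel 'rV[R]_d) := Om `\` C n.
have F_cvg : mu \o F @ \oo --> 0%E.
  rewrite -(measure0 mu) (_ : set0 = \bigcap_n F n); last first.
    apply/esym; rewrite -subset0 => x Fx.
    have [Omx _] := Fx 0%N I.
    have /nbhs_ballP[r /= r0 rOm] := open_nbhs_nbhs (conj Om_open Omx).
    have [k _ /(_ k (leqnn k)) kr] := near_infty_natSinv_lt (PosNum r0).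
    have [_] := Fx k I; apply => y xy; apply: rOm.
    by apply: le_ball xy; exact: ltW.
  apply: nonincreasing_cvg_mu => //.
  - apply: le_lt_trans lebesgue_rV_bounded; apply: le_measure; rewrite ?inE//.
    + by apply: measurableD => //; exact: mOm.
    + exact: mOm.
    + exact: subDsetl.
  - by move=> i; apply: measurableD => //; exact: mOm.
  - by apply: bigcap_measurable => // i _; apply: measurableD => //; exact: mOm.
  - move=> m n mn; apply/subsetPset; apply: setDS => x Cx y xy; apply: Cx.
    by apply: le_ball xy; rewrite lef_pV2 ?posrE// ler_nat.
have /fine_cvgP[_ /cvgrPdist_lt/(_ e e0)[n _ /(_ n (leqnn n)) /= ne]] := F_cvg.
move: ne; rewrite sub0r normrN => /(le_lt_trans (ler_norm _)) ne.
exists n.+1%:R^-1; first by rewrite invr_gt0.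
move=> t tn; apply: le_trans (ltW ne).
have fin (A : set (borel 'rV[R]_d)) : measurable A -> A `<=` Om -> mu A \is a fin_num.
  move=> mA AOm; rewrite ge0_fin_numE// (le_lt_trans _ lebesgue_rV_bounded)//.
  by apply: le_measure; rewrite ?inE//; exact: mOm.
have mT : measurable (Om `\` [set x | Om (x - t)] : set (borel 'rV[R]_d)).
  apply: measurableD; first exact: mOm.
  apply: open_borel; apply: open_comp => // x _.
  apply: (@lipschitz_continuous _ _ _ _ 1) => u v.
  by rewrite opprD addrACA subrr addr0 mul1r.
have mF : measurable (F n) by apply: measurableD => //; exact: mOm.
apply: fine_le; rewrite ?fin//; try exact: subDsetl.
apply: le_measure; rewrite ?inE//; apply: setDS => x Cx /=.
by apply: Cx; rewrite -ball_normE /= opprB addrC subrK.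
Qed.

(** Translating the integral compares [Om] with [Om + t]: the common part cancels and the two
    differences have equal measure. The radius [del] is chosen before [h] and thus serves integrands
    that oscillate faster and faster. *)
Lemma Rintegral_shift e : 0 < e -> exists2 del, 0 < del &
  forall t : 'rV[R]_d, `|t| < del -> forall (h : 'rV[R]_d -> R) B,
  measurable_fun setT (h : borel 'rV[R]_d -> measurableTypeR R) ->
  (forall x, `|h x| <= B) ->
  `|\int[mu]_(x in Om) h x - \int[mu]_(x in Om) h (x + t)| <= B * e.
Proof.
move=> e0; have e20 : 0 < e / 2 by rewrite divr_gt0.
have [del del0 delP] := shift_small e20; exists del => // t tdel h B mh hB.
pose T (x : borel 'rV[R]_d) : borel 'rV[R]_d := (x : 'rV[R]_d) + t.
have cT (s : 'rV[R]_d) : continuous (fun x : 'rV[R]_d => x + s).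
  apply: (@lipschitz_continuous _ _ _ _ 1) => u v.
  by rewrite opprD addrACA subrr addr0 mul1r.
have mT : measurable_fun setT T by exact: continuous_measurable_fun (cT t).
pose Om' : set (borel 'rV[R]_d) := [set x | Om (x - t)].
have mOm' : measurable Om'.
  by apply: open_borel; apply: open_comp => // x _; exact: cT.
have TOm' : T @^-1` Om' = Om.
  by apply/seteqP; split => x; rewrite /Om' /T /= addrK.
have muOm' : mu Om' = mu Om by rewrite -[RHS](lebesgue_rV_shift (- t) mOm).
have Om'oo : (mu Om' < +oo)%E by rewrite muOm' lebesgue_rV_bounded.
have ih A : measurable A -> (mu A < +oo)%E -> mu.-integrable A (EFin \o h).
  by move=> mA Aoo; apply: (bounded_integrable (B := B)).
have -> : \int[mu]_(x in Om) h (x + t) = \int[mu]_(x in Om') h x.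
  congr fine; rewrite [RHS](eq_measure_integral (pushforward mu T)); last first.
    by move=> A mA _; apply/esym; exact: lebesgue_rV_shift.
  rewrite integral_pushforward// ?TOm'//.
  - exact/measurable_EFinP.
  - apply: (bounded_integrable (B := B)) => //; first exact: mOm.
      exact: lebesgue_rV_bounded.
    exact: measurableT_comp mh mT.
have fin (A : set (borel 'rV[R]_d)) : measurable A -> A `<=` Om -> mu A \is a fin_num.
  move=> mA AOm; rewrite ge0_fin_numE// (le_lt_trans _ lebesgue_rV_bounded)//.
  by apply: le_measure; rewrite ?inE//; exact: mOm.
pose D : set (borel 'rV[R]_d) := Om `\` Om'.
pose D' : set (borel 'rV[R]_d) := Om' `\` Om.
pose I : set (borel 'rV[R]_d) := Om `&` Om'.
have mD : measurable D by apply: measurableD => //; exact: mOm.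
have mD' : measurable D' by apply: measurableD => //; exact: mOm.
have mI : measurable I by apply: measurableI => //; exact: mOm.
have muDD' : mu D' = mu D.
  rewrite measureD// ?measureD//; try exact: mOm; last exact: lebesgue_rV_bounded.
  by rewrite setIC; congr (_ - _)%E; exact: muOm'.
have Doo : (mu D < +oo)%E by rewrite ltey_eq fin// ; exact: subDsetl.
have split1 (A E : set (borel 'rV[R]_d)) : measurable A -> measurable E ->
    (mu A < +oo)%E ->
    \int[mu]_(x in A) h x = \int[mu]_(x in A `&` E) h x + \int[mu]_(x in A `\` E) h x.
  move=> mA mE Aoo; rewrite -Rintegral_setU ?setUIDK//.
  - exact: measurableI.
  - exact: measurableD.
  - exact: ih.
  - by apply/disj_setPS => x [[_ Ex] [_ /(_ Ex)]].
rewrite (split1 Om Om') ?lebesgue_rV_bounded//; last exact: mOm.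
rewrite (split1 Om' Om)//; last exact: mOm.
rewrite [Om' `&` Om]setIC opprD addrACA subrr add0r.
have De : B * fine (mu D) <= B * (e / 2).
  by rewrite ler_wpM2l ?delP// (le_trans _ (hB 0)).
apply: (le_trans (ler_normB _ _)); rewrite [e]splitr mulrDr; apply: lerD.
  by apply: le_trans De; apply: Rintegral_bound => // x _; exact: hB.
apply: le_trans De; rewrite -muDD'.
by apply: Rintegral_bound => //; rewrite muDD'.
Qed.

End translation.

(** * Realization of laminates *)

Lemma sin_gap (R : realType) (P : nat) : exists2 c : R, 0 < c &
  forall k, (0 < k < P)%N -> c <= sin (pi * k%:R / P%:R).
Proof.
(* The default 1 is the value of the empty minimum; no sine exceeds it. *)
exists (\big[Num.min/1]_(k < P | (0 < k)%N) sin (pi * k%:R / P%:R)).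
  elim/big_ind : _ => // [x y x0 y0|k k0]; first by rewrite lt_min x0.
  have P0 : 0 < P%:R :> R by rewrite ltr0n (leq_ltn_trans _ (ltn_ord k)).
  apply: sin_gt0_pi; rewrite divr_gt0//=; last by rewrite mulr_gt0 ?pi_gt0 ?ltr0n.
  by rewrite ltr_pdivrMr// ltr_pM2l ?pi_gt0// ltr_nat.
move=> k /andP[k0 kP].
exact: (bigmin_le_cond _ (fun k : 'I_P => sin (pi * k%:R / P%:R)) (j := Ordinal kP)).
Qed.

(** Two of these cosines cannot both be small: [sin (b - a) = sin b cos a - cos b sin a], and for
    distinct shifts [b - a] is, up to sign, a multiple of [pi / P] strictly between 0 and [pi]. *)
Lemma cos_shifts (R : realType) (P : nat) : exists2 c : R, 0 < c &
  forall th (i j : 'I_P), i != j ->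
  c <= `|cos (th + pi * i%:R / P%:R)| \/ c <= `|cos (th + pi * j%:R / P%:R)|.
Proof.
have [c c0 cP] := sin_gap R P; exists (c / 2); first by rewrite divr_gt0.
move=> th i j; wlog ij : i j / (i < j)%N => [H|_].
  rewrite neq_lt => /orP[|] ij; first by apply: H => //; rewrite neq_lt ij.
  by apply/or_comm; apply: H => //; rewrite neq_lt ij.
set a := th + _; set b := th + _.
have : c <= `|sin (b - a)|.
  rewrite (_ : b - a = pi * (j - i)%:R / P%:R).
    apply: le_trans (ler_norm _); apply: cP.
    by rewrite subn_gt0 ij (leq_ltn_trans (leq_subr _ _)).
  by rewrite natrB ?(ltnW ij)// /a /b opprD addrACA subrr add0r -mulrBl -mulrBr.
rewrite sinB => /le_trans/(_ (ler_normB _ _)); rewrite !normrM => H.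
have H1 : `|sin b| * `|cos a| <= `|cos a| by rewrite ler_piMl// sin_max.
have H2 : `|cos b| * `|sin a| <= `|cos b| by rewrite ler_piMr// sin_max.
by case: (leP (c / 2) `|cos a|) => Ha; [left|right; lra].
Qed.

Lemma sum_one_large (R : realType) (P : nat) (b : 'I_P -> R) e :
  0 <= e -> (forall i, b i <= 1) ->
  (forall i j, i != j -> b i <= e \/ b j <= e) -> \sum_i b i <= 1 + P%:R * e.
Proof.
move=> e0 b1 be; have [[i bi]|noi] := pselect (exists i, e < b i); last first.
  apply: (@le_trans _ _ (\sum_(i < P) e)).
    by apply: ler_sum => i _; rewrite leNgt; apply/negP => bi; apply: noi; exists i.
  by rewrite sumr_const card_ord -[leLHS]mulr_natl lerDr.
rewrite (bigD1 i)//=; apply: lerD; first exact: b1.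
apply: (@le_trans _ _ (\sum_(j < P) e)); last first.
  by rewrite sumr_const card_ord -[leLHS]mulr_natl.
rewrite [leRHS](bigD1 i)//= -[leLHS]add0r lerD//; apply: ler_sum => j ji.
by have [|//] := be i j ltac:(by rewrite eq_sym); rewrite leNgt bi.
Qed.

Lemma half_norm_le (R : realType) (p q r : R) : `|p| <= r -> `|q| <= r ->
  `|2^-1 * (p + q)| <= r.
Proof.
move=> pr qr; rewrite normrM ger0_norm ?invr_ge0//.
by have := ler_normD p q; lra.
Qed.

Section bounded_lipschitz.
Context (R : realType).
Implicit Types U V : normedModType R.

Definition bounded_lipschitz U V B (f : U -> V) :=
  (forall x, `|f x| <= B) /\ (forall x y, `|f x - f y| <= B * `|x - y|).

Lemma bounded_lipschitz_ge0 U V B (f : U -> V) : bounded_lipschitz B f -> 0 <= B.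
Proof. by move=> [/(_ 0) H _]; exact: le_trans H. Qed.

Lemma bounded_lipschitzD U V B C (f g : U -> V) : bounded_lipschitz B f ->
  bounded_lipschitz C g -> bounded_lipschitz (B + C) (fun x => f x + g x).
Proof.
move=> [fB fL] [gC gL]; split => [x|x y].
  by apply: (le_trans (ler_normD _ _)); exact: lerD.
rewrite opprD addrACA mulrDl; apply: (le_trans (ler_normD _ _)); exact: lerD.
Qed.

Lemma bounded_lipschitzZ U V B (f : U -> R) (w : V) : bounded_lipschitz B f ->
  bounded_lipschitz (B * `|w|) (fun x => f x *: w).
Proof.
move=> [fB fL]; split => [x|x y]; first by rewrite normrZ ler_wpM2r.
by rewrite -scalerBl normrZ mulrAC ler_wpM2r.
Qed.

Lemma le_bounded_lipschitz U V B C (f : U -> V) : B <= C ->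
  bounded_lipschitz B f -> bounded_lipschitz C f.
Proof.
move=> BC [fB fL]; split => [x|x y]; first exact: le_trans (fB x) BC.
by apply: le_trans (fL x y) _; rewrite ler_wpM2r.
Qed.

End bounded_lipschitz.

Section one_wave.
Context (R : realType) (d : nat) (Om : set 'rV[R]_d).
Hypotheses (Om_open : open Om) (Om_bounded : bounded_set Om).
Local Notation mu := (@lebesgue_rV R d).
Local Notation mOm := (open_borel Om_open).
Local Notation vol := (fine (mu Om)).
Local Notation I h := (\int[mu]_(x in Om) (h : 'rV[R]_d -> R) x).

Lemma bl_measurable B (h : 'rV[R]_d -> R) : bounded_lipschitz B h ->
  measurable_fun setT (h : borel 'rV[R]_d -> measurableTypeR R).
Proof.
by move=> [_ hB]; apply: continuous_measurable_real; exact: lipschitz_continuous hB.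
Qed.

Lemma bl_integrable B (h : 'rV[R]_d -> R) : bounded_lipschitz B h ->
  mu.-integrable Om (EFin \o h).
Proof.
move=> hB; apply: (bounded_integrable (B := B)).
- exact: mOm.
- exact: lebesgue_rV_bounded.
- exact: bl_measurable hB.
- by move=> x _; exact: hB.1.
Qed.

Lemma vol_ge0 : 0 <= vol. Proof. exact: fine_ge0. Qed.

Lemma Rintegral_close B C (h k : 'rV[R]_d -> R) e : bounded_lipschitz B h ->
  bounded_lipschitz C k -> (forall x, Om x -> `|h x - k x| <= e) ->
  `|I h - I k| <= e * vol.
Proof.
move=> hB kC hk.
rewrite -RintegralB; [|exact: mOm|exact: bl_integrable hB|exact: bl_integrable kC].
apply: Rintegral_bound => //; first exact: mOm.
  exact: lebesgue_rV_bounded.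
by apply: measurable_funB; [exact: bl_measurable hB|exact: bl_measurable kC].
Qed.

Definition BL (h : 'rV[R]_d -> R) := exists B, bounded_lipschitz B h.

Lemma BL_integrable h : BL h -> mu.-integrable Om (EFin \o h).
Proof. by case=> B /bl_integrable. Qed.

Lemma BLD h k : BL h -> BL k -> BL (fun x => h x + k x).
Proof. by move=> [B hB] [C kC]; exists (B + C); exact: bounded_lipschitzD. Qed.

Lemma BLZ c h : BL h -> BL (fun x => c * h x).
Proof.
move=> [B hB]; exists (B * `|c|).
have [H1 H2] := bounded_lipschitzZ (c : R^o) hB.
by split => [x|x y]; rewrite ![c * _]mulrC; [exact: H1|exact: H2].
Qed.

Lemma BL0 : BL (fun=> 0).
Proof. by exists 0; split=> *; rewrite ?subrr normr0 ?mul0r. Qed.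

Lemma BL_sum (T : Type) (r : seq T) (f : T -> 'rV[R]_d -> R) :
  (forall i, BL (f i)) -> BL (fun x => \sum_(i <- r) f i x).
Proof.
move=> fB; elim: r => [|i r IH].
  rewrite (_ : (fun x => _) = fun=> 0); first exact: BL0.
  by apply/funext => x; rewrite big_nil.
rewrite (_ : (fun x => _) = fun x => f i x + \sum_(j <- r) f j x); first exact: BLD.
by apply/funext => x; rewrite big_cons.
Qed.

Lemma RintegralZ_BL c h : BL h -> I (fun x => c * h x) = c * I h.
Proof. by move=> hB; apply: RintegralZl; [exact: mOm|exact: BL_integrable]. Qed.

Lemma RintegralD_BL h k : BL h -> BL k -> I (fun x => h x + k x) = I h + I k.
Proof. by move=> hB kB; apply: RintegralD; [exact: mOm|exact: BL_integrable..]. Qed.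

Lemma Rintegral_sum_BL (T : Type) (r : seq T) (f : T -> 'rV[R]_d -> R) :
  (forall i, BL (f i)) ->
  I (fun x => \sum_(i <- r) f i x) = \sum_(i <- r) I (f i).
Proof.
move=> fB; elim: r => [|i r IH].
  rewrite big_nil (_ : (fun x => _) = fun=> 0); last by apply/funext => x; rewrite big_nil.
  by rewrite Rintegral_cst ?mul0r//; exact: mOm.
rewrite big_cons -IH -RintegralD_BL//; last exact: BL_sum.
by congr Rintegral; apply/funext => x; rewrite big_cons.
Qed.

(** Moving [x] by [(a / (N X)) xi] with [X = dotv xi xi] shifts the phase by [a] and changes the
    slow variable very little. So the integral hardly depends on the phase and may be averaged over
    the shifts [pi i / P] and [pi i / P + pi]. Each such pair evaluates [G x] at some [y] and at
    [- y], and for all but at most one [i] the modulus of [y] is close to 1. The choices of [P], [n]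
    and [N0] involve [G] only through [B]. *)
Lemma one_wave B e (xi : 'rV[R]_d) : 0 < e -> xi != 0 -> exists n N0, forall N,
  (N0 <= N)%N -> forall G : 'rV[R]_d -> R -> R,
  (forall x s, `|s| <= 1 -> `|G x s| <= B) ->
  (forall x y s r, `|s| <= 1 -> `|r| <= 1 ->
    `|G x s - G y r| <= B * (`|x - y| + `|s - r|)) ->
  `|I (fun x => G x (sign_approx n (cos (dotv (N%:R *: xi) x)))) -
    I (fun x => 2^-1 * (G x 1 + G x (-1)))| <= e.
Proof.
move=> e0 xi0; wlog B0 : B / 0 <= B => [H|].
  have [n [N0 HN]] := H `|B| (normr_ge0 B); exists n, N0 => N NN0 G GB GL.
  apply: HN => // [x s s1|x y s r s1 r1].
    by apply: le_trans (GB x s s1) _; rewrite ler_norm.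
  by apply: le_trans (GL x y s r s1 r1) _; rewrite ler_wpM2r ?addr_ge0// ler_norm.
have v0 := vol_ge0; set vl := vol in v0 *.
have K0 : 0 < 4 * (B * (1 + vl) + 1) by rewrite mulr_gt0// ltr_wpDl// mulr_ge0// addr_ge0.
(* The total error will be [B (1 + vl) e1 + B (1 / P + e1) vl], with [1 / P <= e1]. *)
pose e1 := e / (4 * (B * (1 + vl) + 1)).
have e10 : 0 < e1 by rewrite divr_gt0.
have e1E : e1 * (4 * (B * (1 + vl) + 1)) = e by rewrite divfK// gt_eqF.
have [P P0 PP] : exists2 P : nat, (0 < P)%N & P%:R^-1 <= e1.
  have [k _ /(_ k (leqnn k)) /ltW] := near_infty_natSinv_lt (PosNum e10).
  by exists k.+1.
have P0R : 0 < P%:R :> R by rewrite ltr0n.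
have [c c0 cP] := cos_shifts R P.
have [n nP] := sign_approx_cvg c0 e10.
have [del del0 delP] := Rintegral_shift Om_open Om_bounded e10.
pose X := dotv xi xi; have X0 : 0 < X by exact: dotvv_gt0.
(* The quotient [len / N] is the length of the translation along [xi] that realizes a full period.
   Below [rr] it is harmless both for the domain and for the first argument of [G]. *)
pose len := 2 * pi * `|xi| / X.
pose rr := Num.min del e1; have rr0 : 0 < rr by rewrite lt_min del0.
have [N0 N0P] : exists N0 : nat, len / rr < N0%:R.
  exists (Num.bound (len / rr)); apply: archi_boundP.
  by rewrite !mulr_ge0 ?invr_ge0 ?pi_ge0// ltW.
exists n, N0.+1 => N NN0 G GB GL.
have N_gt0 : 0 < N%:R :> R by rewrite ltr0n (leq_trans _ NN0).
have lenN : len / N%:R < rr.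
  rewrite ltr_pdivrMr// mulrC -ltr_pdivrMr//; apply: lt_le_trans N0P _.
  by rewrite ler_nat ltnW.
pose sg (th : R) := sign_approx n (cos th).
have sg1 th : `|sg th| <= 1 by apply: sign_approx_le1; exact: cos_max.
have sgpi th : sg (th + pi) = - sg th by rewrite /sg cosDpi sign_approxN.
pose th x := dotv (N%:R *: xi) x.
have sth_bl a : exists C, bounded_lipschitz C (fun x => sg (th x + a)).
  pose t : 'rV[R]_d := (a / (N%:R * X)) *: xi.
  have ta x : th (x + t) = th x + a.
    rewrite /th dotvDr dotvZl [dotv _ t]dotvZl dotvZr -/X.
    by congr (_ + _); field; rewrite !gt_eqF.
  have [C C0 CP] := trig_poly_lipschitz
    (trig_poly_odd_cos (N%:R *: xi) (odd_cos_sign_approx R n)).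
  exists C; split => [x|x y]; rewrite -?ta; first exact: (CP _).1.
  by apply: le_trans ((CP _).2 _) _; rewrite -/(th _) opprD addrACA subrr addr0.
have G_bl (s : 'rV[R]_d -> R) C : (forall x, `|s x| <= 1) -> bounded_lipschitz C s ->
    bounded_lipschitz (B * (1 + C)) (fun x => G x (s x)).
  move=> s1 sC; have C0 := bounded_lipschitz_ge0 sC; split => [x|x y].
    by apply: le_trans (GB _ _ (s1 x)) _; rewrite mulrDr mulr1 lerDl mulr_ge0.
  apply: le_trans (GL _ _ _ _ (s1 x) (s1 y)) _; rewrite -mulrA ler_wpM2l//.
  by rewrite mulrDl mul1r lerD2l sC.2.
pose h a x := G x (sg (th x + a)).
have h_bl a : exists C, bounded_lipschitz C (h a).
  by have [C CP] := sth_bl a; exists (B * (1 + C)); apply: G_bl => // x; exact: sg1.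
have shift a : 0 <= a -> a <= 2 * pi -> `|I (h 0) - I (h a)| <= B * (1 + vl) * e1.
  move=> a0 a2pi.
  pose t : 'rV[R]_d := (a / (N%:R * X)) *: xi.
  have ta x : th (x + t) = th x + a.
    rewrite /th dotvDr dotvZl [dotv _ t]dotvZl dotvZr -/X.
    by congr (_ + _); field; rewrite !gt_eqF.
  have tr : `|t| < rr.
    have NX0 : 0 < N%:R * X by rewrite mulr_gt0.
    apply: le_lt_trans lenN.
    rewrite (_ : len / N%:R = 2 * pi / (N%:R * X) * `|xi|); last first.
      by rewrite /len; field; rewrite !gt_eqF.
    rewrite normrZ ger0_norm ?divr_ge0 ?(ltW NX0)// ler_wpM2r//.
    by rewrite ler_wpM2r// invr_ge0 ltW.
  move: tr; rewrite lt_min => /andP[tdel te1].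
  have [C0 hC0] := h_bl 0; have [Ca hCa] := h_bl a.
  have hS x : h 0 (x + t) = G (x + t) (sg (th x + a)) by rewrite /h addr0 ta.
  have hB x : `|h 0 x| <= B by apply: GB.
  have := delP t tdel (h 0) B (bl_measurable hC0) hB.
  have hst : bounded_lipschitz C0 (fun x => h 0 (x + t)).
    split => [x|x y]; first exact: hC0.1.
    by apply: le_trans (hC0.2 _ _) _; rewrite opprD addrACA subrr addr0.
  have : `|I (fun x => h 0 (x + t)) - I (h a)| <= B * e1 * vl.
    apply: (Rintegral_close hst hCa) => x _; rewrite hS.
    apply: le_trans (GL _ _ _ _ (sg1 _) (sg1 _)) _.
    rewrite subrr normr0 addr0 addrAC subrr add0r.
    by rewrite ler_wpM2l// ltW.
  move=> H1 H2; apply: (le_trans (ler_distD (I (fun x => h 0 (x + t))) _ _)).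
  by apply: le_trans (lerD H2 H1) _; rewrite le_eqVlt; apply/orP; left; apply/eqP; ring.
pose al (i : 'I_P) : R := pi * i%:R / P%:R.
have al_itv i : 0 <= al i <= pi.
  rewrite divr_ge0 ?mulr_ge0 ?pi_ge0//= ler_pdivrMr// ler_wpM2l ?pi_ge0//.
  by rewrite ler_nat ltnW.
pose m x := P%:R^-1 * \sum_i 2^-1 * (h (al i) x + h (al i + pi) x).
pose g x := 2^-1 * (G x 1 + G x (-1)).
have mg x : `|m x - g x| <= B * (P%:R^-1 + e1).
  have -> : m x - g x = P%:R^-1 * \sum_i (2^-1 * (h (al i) x + h (al i + pi) x) - g x).
    rewrite sumrB sumr_const card_ord -[g x *+ P]mulr_natl mulrBr mulKf//.
    by rewrite gt_eqF.
  rewrite normrM gtr0_norm ?invr_gt0//.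
  (* Whatever the sign of [y], the pair [y, - y] is compared with the pair [1, -1] in the matching
     order, each at distance [1 - |y|]. *)
  have pt i : `|2^-1 * (h (al i) x + h (al i + pi) x) - g x| <=
      B * (1 - `|sg (th x + al i)|).
    rewrite /h addrA sgpi /g; set y := sg _.
    have y1 : `|y| <= 1 by exact: sg1.
    have GB' s r : `|s| <= 1 -> `|r| <= 1 -> `|G x s - G x r| <= B * `|s - r|.
      by move=> s1 r1; have := GL x x s r s1 r1; rewrite subrr normr0 add0r.
    have [y0|y0] := leP 0 y.
      rewrite (_ : _ - _ = 2^-1 * ((G x y - G x 1) + (G x (- y) - G x (-1)))); last by ring.
      have := GB' y 1 y1 ltac:(by rewrite normr1).
      have := GB' (- y) (-1) ltac:(by rewrite normrN) ltac:(by rewrite normrN normr1).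
      have -> : `|y - 1| = 1 - `|y|.
        by rewrite (ger0_norm y0) distrC ger0_norm// subr_ge0 -(ger0_norm y0).
      have -> : `|- y - -1| = 1 - `|y|.
        by rewrite (ger0_norm y0) opprK addrC ger0_norm// subr_ge0 -(ger0_norm y0).
      move=> H1 H2; rewrite normrM ger0_norm ?invr_ge0//.
      by have := ler_normD (G x y - G x 1) (G x (- y) - G x (-1)); lra.
    rewrite (_ : _ - _ = 2^-1 * ((G x y - G x (-1)) + (G x (- y) - G x 1))); last by ring.
    have := GB' y (-1) y1 ltac:(by rewrite normrN normr1).
    have := GB' (- y) 1 ltac:(by rewrite normrN) ltac:(by rewrite normr1).
    have yn : `|y| = - y by rewrite ltr0_norm.
    have -> : `|y - -1| = 1 - `|y|.
      by rewrite yn opprK ger0_norm; [ring|move: y1; rewrite yn; lra].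
    have -> : `|- y - 1| = 1 - `|y|.
      by rewrite yn ler0_norm; [ring|move: y1; rewrite yn; lra].
    move=> H1 H2; rewrite normrM ger0_norm ?invr_ge0//.
    by have := ler_normD (G x y - G x (-1)) (G x (- y) - G x 1); lra.
  rewrite ler_pdivrMl//; apply: le_trans (ler_norm_sum _ _ _) _.
  apply: (le_trans (ler_sum _ (fun i _ => pt i))); rewrite -mulr_sumr mulrCA ler_wpM2l//.
  (* An exceptional [i] costs at most 1, every other one at most [e1]. *)
  rewrite mulrDr mulfV ?gt_eqF//; apply: sum_one_large => [|i|i j ij].
  - exact: ltW.
  - by rewrite gerBl.
  - have bad k : c <= `|cos (th x + al k)| -> 1 - `|sg (th x + al k)| <= e1.
      by move=> ck; rewrite lerBlDr -lerBlDl; exact: nP ck (cos_max _).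
    by have [] := cP (th x) i j ij; rewrite -/(al _) => /bad; [left|right].
have h2_bl i : BL (fun x => 2^-1 * (h (al i) x + h (al i + pi) x)).
  by apply: BLZ; apply: BLD; exact: h_bl.
have IR : \sum_(i < P) I (h 0) = P%:R * I (h 0).
  by rewrite sumr_const card_ord mulr_natl.
have Im : `|I (h 0) - I m| <= B * (1 + vl) * e1.
  rewrite RintegralZ_BL ?Rintegral_sum_BL//; last exact: BL_sum.
  rewrite -[I (h 0)](mulKf (_ : P%:R != 0)) ?gt_eqF// -IR -mulrBr -sumrB.
  rewrite normrM gtr0_norm ?invr_gt0// ler_pdivrMl//.
  apply: (le_trans (ler_norm_sum _ _ _)).
  apply: (@le_trans _ _ (\sum_(i < P) (B * (1 + vl) * e1))); last first.
    by rewrite sumr_const card_ord -[leLHS]mulr_natl.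
  apply: ler_sum => i _; rewrite RintegralZ_BL ?RintegralD_BL//; last exact: BLD.
  have /andP[a0 api] := al_itv i.
  have pi0 := pi_ge0 R.
  have H1 : `|I (h 0) - I (h (al i))| <= B * (1 + vl) * e1 by apply: shift => //; lra.
  have H2 : `|I (h 0) - I (h (al i + pi))| <= B * (1 + vl) * e1 by apply: shift; lra.
  rewrite [X in `|X|](_ : _ = 2^-1 *
    ((I (h 0) - I (h (al i))) + (I (h 0) - I (h (al i + pi))))); last by field.
  exact: half_norm_le.
have m_bl : BL m by apply: BLZ; exact: BL_sum.
have g_bl : BL g.
  have cst_bl s : `|s| <= 1 -> BL (fun x => G x s).
    move=> s1; exists (B * (1 + `|s|)); apply: (G_bl (fun=> s)) => //.
    by split => [//|x y]; rewrite subrr normr0 mulr_ge0.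
  by apply: BLZ; apply: BLD; apply: cst_bl; rewrite ?normrN normr1.
have [[Cm mC] [Cg gC]] := (m_bl, g_bl).
have Img : `|I m - I g| <= B * (P%:R^-1 + e1) * vl.
  by apply: (Rintegral_close mC gC) => x _; exact: mg.
have -> : I (fun x => G x (sign_approx n (cos (dotv (N%:R *: xi) x)))) = I (h 0).
  by congr Rintegral; apply/funext => x; rewrite /h addr0.
apply: (le_trans (ler_distD (I m) _ _)); apply: (le_trans (lerD Im Img)).
rewrite -e1E; have Be : 0 <= B * vl * (e1 - P%:R^-1) by rewrite !mulr_ge0// subr_ge0.
have Be1 : 0 <= B * e1 by rewrite mulr_ge0// ltW.
have Bve1 : 0 <= B * vl * e1 by rewrite mulr_ge0 ?(ltW e10)// mulr_ge0.
move: Be Be1 Bve1 (ltW e10); move: (P%:R^-1) => p; clearbody vl e1; clear.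
by lra.
Qed.
End one_wave.

Section avg_extra.
Context (R : realType) (W : euclideanType R).
Implicit Types (F G : W -> R) (y z : W).

Lemma law_weight (t : splitting W) y : \sum_(q <- law t y) q.1 = 1.
Proof.
have := avg_cst (1 : R) t y; rewrite /avg => <-.
by apply: eq_bigr => q _; rewrite mulr1.
Qed.

Lemma avg_close F G (t : splitting W) y e :
  (forall q, q \in law t y -> `|F q.2 - G q.2| <= e) ->
  `|avg F t y - avg G t y| <= e.
Proof.
move=> FG; rewrite /avg -sumrB; apply: (le_trans (ler_norm_sum _ _ _)).
rewrite -[e]mul1r -(law_weight t y) mulr_suml big_seq [leRHS]big_seq.
apply: ler_sum => q ql; have q0 := law_ge0 ql.
by rewrite -mulrBr normrM ger0_norm// ler_wpM2l// FG.
Qed.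

Lemma avg_shift F (t : splitting W) y z : avg F t (y + z) = avg (fun x => F (x + z)) t y.
Proof.
elim: t y => [|m t1 IH1 t2 IH2] y; first by rewrite !avg_leaf.
by rewrite !avg_split addrAC IH1 [y + z - m]addrAC IH2.
Qed.

Lemma eq_avg F G (t : splitting W) y : F =1 G -> avg F t y = avg G t y.
Proof. by move=> /funext ->. Qed.

Lemma law_bounded (t : splitting W) y : exists2 M, 0 <= M &
  forall q, q \in law t y -> `|q.2| <= M.
Proof.
elim: (law t y) => [|q l [M M0 MP]]; first by exists 0.
exists (`|q.2| + M); first exact: addr_ge0.
move=> r; rewrite inE => /predU1P[->|/MP rM]; first by rewrite lerDl.
by apply: (le_trans rM); rewrite lerDr.
Qed.

End avg_extra.

(** * From a single square wave to a whole splitting *)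

Section realization.
Context (R : realType) (d : nat) (Om : set 'rV[R]_d).
Hypotheses (Om_open : open Om) (Om_bounded : bounded_set Om).
Local Notation mu := (@lebesgue_rV R d).
Local Notation mOm := (open_borel Om_open).
Local Notation vol := (fine (mu Om)).
Local Notation I h := (\int[mu]_(x in Om) (h : 'rV[R]_d -> R) x).
Variables (W : euclideanType R) (K : 'rV[R]_d -> {vspace W}).
Hypothesis KZ : forall c xi (w : W), c != 0 -> w \in K xi -> w \in K (c *: xi).
Hypothesis K_lsc : forall xi (w : W) e, xi != 0 -> w \in K xi -> 0 < e ->
  exists2 del, 0 < del & forall eta, `|eta - xi| < del ->
    exists2 w', w' \in K eta & `|w' - w| <= e.

Definition cone : set W := [set w | exists2 xi, xi != 0 & w \in K xi].

(** The constants are normalised to 1, and the Lipschitz constant in [x] grows with [|z|] as it does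
    for [(1 + |z|) G (x, z / (1 + |z|))]. A field is constructed for this whole class at once. *)
Definition test_fun (F : 'rV[R]_d -> W -> R) :=
  (forall x z, `|F x z| <= 1 + `|z|) /\
  (forall x y z w, `|F x z - F y w| <= (1 + `|z|) * `|x - y| + `|z - w|).

Lemma test_fun_BL F B (u : 'rV[R]_d -> W) : test_fun F -> bounded_lipschitz B u ->
  bounded_lipschitz (1 + B + B) (fun x => F x (u x)).
Proof.
move=> [FB FL] uB; have B0 := bounded_lipschitz_ge0 uB.
have [u1 u2] := uB; split => [x|x y].
  by apply: (le_trans (FB _ _)); rewrite -addrA lerD2l (le_trans (u1 x))// lerDl.
apply: (le_trans (FL _ _ _ _)); rewrite [leRHS]mulrDl; apply: lerD; last exact: u2.
by rewrite ler_wpM2r// lerD2l u1.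
Qed.

Lemma cone_field_BL Y : cone_field K Y -> exists2 B, 0 <= B & bounded_lipschitz B Y.
Proof.
move=> [L _ ->]; have [C C0 CP] := wave_sum_lipschitz L.
by exists C => //; split => [x|x y]; [exact: (CP x).1|exact: (CP x).2].
Qed.

Lemma trig_poly_BL v : trig_poly v -> exists2 B, 0 <= B &
  bounded_lipschitz B (v : 'rV[R]_d -> R).
Proof.
move=> /trig_poly_lipschitz[C C0 CP].
by exists C => //; split => [x|x y]; [exact: (CP x).1|exact: (CP x).2].
Qed.

(** Strengthened for the induction: the laminate is modulated by a slow [v] and added to an
    arbitrary slow [u] of which only the bound [B] is known in advance. At a split, [s] is an
    approximate square wave, [Y0] imitates [v s m], and [v1 = v (1 + s) / 2], [v2 = v (1 - s) / 2]
    single out where [t1] and [t2] are to run. [Y1] has to work on top of [u + Y0 + v2 y] for every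
    leaf [y] of [t2], and [Y2] on top of [u + Y0 + Y1], which dictates the bounds passed to the
    induction hypotheses. There are four errors of [e / 4]: from [Y2], [Y1], [Y0] and [one_wave]. *)
Lemma realize_splitting t : splits_along cone t -> forall v B e,
  trig_poly v -> 0 < e -> exists2 Y, cone_field K Y &
  forall u, bounded_lipschitz B u -> forall F, test_fun F ->
  `|I (fun x => F x (u x + Y x)) -
    avg (fun y => I (fun x => F x (u x + v x *: y))) t 0| <= e.
Proof.
elim: t => [|m t1 IH1 t2 IH2] /= => [_|[[xi xi0 mK] t1D t2D]] v B e tv e0.
  exists (fun=> 0); first exact: cone_field0.
  move=> u uB F Ft; rewrite avg_leaf.
  under [X in _ - Rintegral _ _ X]eq_fun do rewrite scaler0.
  by rewrite subrr normr0 ltW.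
have [M1 M10 M1P] := law_bounded t1 0.
have [M2 M20 M2P] := law_bounded t2 0.
pose M := `|m| + M1 + M2.
have [Cv Cv0 vC] := trig_poly_BL tv.
have v0 := vol_ge0 Om; set vl := vol in v0 *.
have e40 : 0 < e / 4 by rewrite divr_gt0.
wlog B0 : B / 0 <= B => [H|].
  have [Y YK YP] := H `|B| (normr_ge0 B); exists Y => // u uB; apply: YP.
  by apply: le_bounded_lipschitz uB; exact: ler_norm.
have M0 : 0 <= M by rewrite !addr_ge0.
(* The last term bounds the Lipschitz constant of [G y1 y2] in [r], the sum of the others that in
   [x]. *)
pose Bg := 1 + (B + Cv * M) + (B + Cv * M) + Cv * M.
have CvM0 : 0 <= Cv * M by rewrite mulr_ge0.
have [n [N0 NP]] := one_wave Om_open Om_bounded Bg e40 xi0.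
pose e1 := e / (4 * (vl + 1)).
have e10 : 0 < e1 by rewrite divr_gt0// mulr_gt0// ltr_wpDl.
have [N1 N1P] := cone_field_modulation KZ K_lsc tv (odd_cos_sign_approx R n) xi0 mK e10.
pose N := maxn N0 N1; have := NP N (leq_maxl _ _).
pose s x := sign_approx n (cos (dotv (N%:R *: xi) x)); rewrite -/s => one.
have [Y0 Y0K Y0P] := N1P N (leq_maxr _ _).
have ts : trig_poly s by exact: trig_poly_odd_cos (odd_cos_sign_approx R n).
pose v1 x := v x * (2^-1 + 2^-1 * s x); pose v2 x := v x * (2^-1 + (- 2^-1) * s x).
have tsc c : trig_poly (fun x => 2^-1 + c * s x).
  apply: trig_polyD; first exact: trig_poly_cst.
  by apply: (trig_polyM _ ts); exact: trig_poly_cst.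
have tv1 : trig_poly v1 by exact: trig_polyM.
have tv2 : trig_poly v2 by exact: trig_polyM.
have [B0' B0'0 Y0B] := cone_field_BL Y0K.
have [C1 C10 v1C] := trig_poly_BL tv1.
have [C2 C20 v2C] := trig_poly_BL tv2.
have [Y1 Y1K Y1P] := IH1 t1D v1 (B + B0' + C2 * M2) _ tv1 e40.
have [B1 B10 Y1B] := cone_field_BL Y1K.
have [Y2 Y2K Y2P] := IH2 t2D v2 (B + B0' + B1) _ tv2 e40.
exists (fun x => Y0 x + Y1 x + Y2 x); first by do 2 apply: cone_fieldD => //.
move=> u uB F Ft.
pose Phi y := I (fun x => F x (u x + v x *: y)).
pose u1 y x := u x + Y0 x + v2 x *: y.
pose u2 x := u x + Y0 x + Y1 x.
have u1B q : q \in law t2 0 -> bounded_lipschitz (B + B0' + C2 * M2) (u1 q.2).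
  move=> ql; apply: bounded_lipschitzD; first exact: bounded_lipschitzD.
  apply: le_bounded_lipschitz (bounded_lipschitzZ q.2 v2C).
  by rewrite ler_wpM2l// M2P.
have u2B : bounded_lipschitz (B + B0' + B1) u2.
  by apply: bounded_lipschitzD => //; exact: bounded_lipschitzD.
(* Affine in [r], with value [y1 + m] at [r = 1] and [y2 - m] at [r = -1]. *)
pose comb r (y1 y2 : W) : W := r *: (m + 2^-1 *: (y1 - y2)) + 2^-1 *: (y1 + y2).
have hh : 2^-1 + 2^-1 = 1 :> R by lra.
have combE r y1 y2 : comb r y1 y2 =
    r *: m + ((2^-1 + 2^-1 * r) *: y1 + (2^-1 + (- 2^-1) * r) *: y2).
  rewrite /comb scalerDr -addrA; congr (_ + _).
  rewrite !scalerDl addrACA -scalerDr [LHS]addrC; congr (_ + _).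
  by rewrite mulNr scaleNr -scalerBr scalerA mulrC.
pose G y1 y2 x r := F x (u x + v x *: comb r y1 y2).
have step0 q1 q2 : q1 \in law t1 0 -> q2 \in law t2 0 ->
    `|I (fun x => F x (u1 q2.2 x + v1 x *: q1.2)) -
      2^-1 * (Phi (q1.2 + m) + Phi (q2.2 - m))| <= e / 4 + e / 4.
  move=> q1l q2l; set y1 := q1.2; set y2 := q2.2.
  have y1M := M1P _ q1l; have y2M := M2P _ q2l.
  have wM : `|m + 2^-1 *: (y1 - y2)| <= `|m| + (2^-1 * `|y1| + 2^-1 * `|y2|).
    apply: (le_trans (ler_normD _ _)); rewrite lerD2l normrZ ger0_norm ?invr_ge0//.
    by rewrite -mulrDr ler_wpM2l ?invr_ge0// ler_normB.
  have combB r : `|r| <= 1 -> `|comb r y1 y2| <= M.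
    move=> r1; apply: (le_trans (ler_normD _ _)).
    have H1 : `|r *: (m + 2^-1 *: (y1 - y2))| <= `|m| + (2^-1 * `|y1| + 2^-1 * `|y2|).
      by rewrite normrZ -[leRHS]mul1r ler_pM.
    have H2 : `|2^-1 *: (y1 + y2)| <= 2^-1 * `|y1| + 2^-1 * `|y2|.
      rewrite normrZ ger0_norm ?invr_ge0// -mulrDr ler_wpM2l ?invr_ge0//.
      exact: ler_normD.
    by apply: (le_trans (lerD H1 H2)); rewrite /M; lra.
  have combL r r' : `|comb r y1 y2 - comb r' y1 y2| <= M * `|r - r'|.
    rewrite /comb opprD addrACA subrr addr0 -scalerBl normrZ mulrC ler_wpM2r//.
    apply: (le_trans wM); rewrite /M.
    by have := normr_ge0 y1; have := normr_ge0 y2; lra.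
  have vcB x r : `|r| <= 1 -> `|v x *: comb r y1 y2| <= Cv * M.
    by move=> r1; rewrite normrZ ler_pM ?vC.1 ?combB.
  have GB x r : `|r| <= 1 -> `|G y1 y2 x r| <= Bg.
    move=> r1; apply: (le_trans (Ft.1 _ _)); rewrite /Bg -!addrA lerD2l.
    apply: (le_trans (ler_normD _ _)); have := uB.1 x; have := vcB x r r1.
    by move: (`|u x|) (`|_ *: _|) => *; lra.
  have GL x y r r' : `|r| <= 1 -> `|r'| <= 1 ->
      `|G y1 y2 x r - G y1 y2 y r'| <= Bg * (`|x - y| + `|r - r'|).
    move=> r1 r'1; apply: (le_trans (Ft.2 _ _ _ _)).
    have uL := uB.2 x y; have ux := uB.1 x; have vx := vcB x r r1.
    have vL : `|v x *: comb r y1 y2 - v y *: comb r' y1 y2| <=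
        Cv * M * `|x - y| + Cv * M * `|r - r'|.
      have -> : v x *: comb r y1 y2 - v y *: comb r' y1 y2 =
          (v x - v y) *: comb r y1 y2 + v y *: (comb r y1 y2 - comb r' y1 y2).
        by rewrite scalerBl scalerBr addrA subrK.
      apply: (le_trans (ler_normD _ _)); rewrite !normrZ; apply: lerD.
        by rewrite mulrAC ler_pM ?combB// vC.2.
      by rewrite -mulrA ler_pM ?vC.1.
    rewrite opprD addrACA.
    have n1 := ler_normD (u x - u y) (v x *: comb r y1 y2 - v y *: comb r' y1 y2).
    have n2 := ler_normD (u x) (v x *: comb r y1 y2).
    have xy0 := normr_ge0 (x - y); have rr0 := normr_ge0 (r - r').
    have n3 : (1 + `|u x + v x *: comb r y1 y2|) * `|x - y| <=
        (1 + (B + Cv * M)) * `|x - y|.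
      by rewrite ler_wpM2r// lerD2l (le_trans n2)// lerD.
    apply: (le_trans (lerD n3 (le_trans n1 (lerD uL vL)))).
    have Brr : 0 <= B * `|r - r'| by rewrite mulr_ge0.
    have Crr : 0 <= Cv * M * `|r - r'| by rewrite mulr_ge0.
    have Cxy : 0 <= Cv * M * `|x - y| by rewrite mulr_ge0.
    rewrite /Bg; move: (`|x - y|) (`|r - r'|) (Cv * M) xy0 rr0 Brr Crr Cxy; clear.
    by move=> *; nra.
  have oneG := one (G y1 y2) GB GL.
  have E2 : I (fun x => 2^-1 * (G y1 y2 x 1 + G y1 y2 x (-1))) =
      2^-1 * (Phi (y1 + m) + Phi (y2 - m)).
    have GBL r : `|r| <= 1 -> BL (G y1 y2 ^~ r).
      move=> r1; exists Bg; split=> [x|x y]; first exact: GB.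
      by apply: le_trans (GL x y r r r1 r1) _; rewrite subrr normr0 addr0.
    rewrite RintegralZ_BL ?RintegralD_BL//; first last.
    - by apply: BLD; apply: GBL; rewrite ?normrN normr1.
    - by apply: GBL; rewrite normrN normr1.
    - by apply: GBL; rewrite normr1.
    congr (_ * (_ + _)); congr Rintegral; apply/funext => x; rewrite /G combE.
      by rewrite mulr1 mulNr mulr1 subrr scale0r addr0 hh !scale1r [m + _]addrC.
    by rewrite mulrN1 subrr scale0r add0r mulrNN mulr1 hh scale1r scaleN1r [- m + _]addrC.
  rewrite -E2; apply: (le_trans (ler_distD (I (fun x => G y1 y2 x (s x))) _ _)).
  apply: lerD => //.
  have [Cs Cs0 sC] := trig_poly_BL ts.
  have s1 x : `|s x| <= 1 by apply: sign_approx_le1; exact: cos_max.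
  have H1 : bounded_lipschitz (B + B0' + C2 * M2 + C1 * `|y1|)
      (fun x => u1 y2 x + v1 x *: y1).
    by apply: bounded_lipschitzD; [exact: u1B|exact: bounded_lipschitzZ].
  have H2 : bounded_lipschitz (Bg * (1 + Cs)) (fun x => G y1 y2 x (s x)).
    have Bg0 : 0 <= Bg by apply: le_trans (GB 0 0 _); rewrite ?normr0.
    split => [x|x y].
      by apply: (le_trans (GB _ _ (s1 x))); rewrite mulrDr mulr1 lerDl mulr_ge0.
    apply: (le_trans (GL _ _ _ _ (s1 x) (s1 y))); rewrite -mulrA ler_wpM2l//.
    by rewrite mulrDl mul1r lerD2l sC.2.
  apply: (@le_trans _ _ (e1 * vl)); last first.
    rewrite /e1 invfM mulrA -mulrA ler_piMr// ?(ltW e40)// mulrC ler_pdivrMr ?mul1r.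
      by rewrite lerDl.
    by rewrite ltr_wpDl.
  apply: (Rintegral_close Om_open Om_bounded (test_fun_BL Ft H1) H2) => x _.
  rewrite /G; apply: (le_trans (Ft.2 _ _ _ _)); rewrite subrr normr0 mulr0 add0r.
  rewrite /u1 combE (_ : _ - _ = Y0 x - (v x * s x) *: m) ?Y0P//.
  rewrite scalerDr scalerA -[u x + _ + _ + _]addrA -[u x + _ + _]addrA.
  rewrite opprD addrACA subrr add0r scalerDr 2!scalerA -/(v1 x) -/(v2 x).
  by rewrite opprD addrACA [v1 x *: _ + _]addrC subrr addr0.
have u1E (y : W) x : u2 x + v2 x *: y = u1 y x + Y1 x by rewrite /u1 /u2 addrAC.
have step1 q2 : q2 \in law t2 0 ->
    `|I (fun x => F x (u2 x + v2 x *: q2.2)) -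
      2^-1 * (avg Phi t1 (0 + m) + Phi (q2.2 - m))| <= e / 4 + (e / 4 + e / 4).
  move=> q2l; under eq_Rintegral do rewrite u1E.
  apply: le_trans (ler_distD (avg (fun y =>
    I (fun x => F x (u1 q2.2 x + v1 x *: y))) t1 0) _ _) _.
  apply: lerD; first by apply: Y1P => //; exact: u1B.
  rewrite avg_shift -[Phi (q2.2 - m)](avg_cst _ t1 0) -avgD -avgZ.
  by apply: avg_close => q1 q1l; exact: step0.
rewrite avg_split -/Phi.
rewrite (_ : (fun x => _) = fun x => F x (u2 x + Y2 x)); last first.
  by apply/funext => x; rewrite /u2 !addrA.
apply: le_trans (ler_distD (avg (fun y =>
  I (fun x => F x (u2 x + v2 x *: y))) t2 0) _ _) _.
have -> : e = e / 4 + (e / 4 + (e / 4 + e / 4)) by field.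
apply: lerD; first exact: Y2P.
rewrite (avg_shift Phi t2) -[avg Phi t1 _](avg_cst _ t2 0) -avgD -avgZ.
by apply: avg_close => q2 q2l; exact: step1.
Qed.
End realization.

(** * Semicontinuity of kernels and images *)

Section finite_dimension.
Context (R : realType) (W : euclideanType R).
Let n := \dim {: W}.
Let b i := (vbasis {: W})`_i.

Let lin (x : 'rV[R]_n) : W := \sum_(i < n) x ord0 i *: b i.

Let lin_coord w : lin (\row_i coord (vbasis {: W}) i w) = w.
Proof.
rewrite [RHS](coord_vbasis (memvf w)); apply: eq_bigr => i _.
by rewrite mxE.
Qed.

Let lin_eq0 x : lin x = 0 -> x = 0.
Proof.
move=> x0; apply/rowP => i; rewrite mxE.
have /basis_free free := vbasisP {: W}.
by rewrite -(coord_sum_free (x ord0) i free) -/(lin x) x0 linear0.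
Qed.

Let linD x y : lin (x - y) = lin x - lin y.
Proof.
by rewrite /lin -sumrB; apply: eq_bigr => i _; rewrite !mxE scalerBl.
Qed.

Let linZ c x : lin (c *: x) = c *: lin x.
Proof. by rewrite /lin scaler_sumr; apply: eq_bigr => i _; rewrite !mxE scalerA. Qed.

Let lin_bound x : `|lin x| <= (\sum_(i < n) `|b i|) * `|x|.
Proof.
apply: (le_trans (ler_norm_sum _ _ _)); rewrite mulr_suml; apply: ler_sum => i _.
by rewrite normrZ mulrC ler_wpM2l// coord_le_norm.
Qed.

Let lin_continuous : continuous lin.
Proof.
apply: (@lipschitz_continuous _ _ _ _ (\sum_(i < n) `|b i|)) => x y.
by rewrite -linD.
Qed.

Let lin_norm_continuous : continuous (fun x => `|lin x|).
Proof.
apply: (@lipschitz_continuous _ _ _ _ (\sum_(i < n) `|b i|)) => x y.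
by apply: (le_trans (ler_dist_dist _ _)); rewrite -linD.
Qed.

(** Equivalence of norms: by injectivity of [lin], the minimum of [|lin x|] over the unit sphere of
    coordinates is positive. In dimension 0 this sphere is empty and any constant will do. *)
Let lin_lower : exists2 m, 0 < m & forall x, m * `|x| <= `|lin x|.
Proof.
pose S := [set x : 'rV[R]_n | `|x| = 1].
have normc : continuous (fun x : 'rV[R]_n => `|x|) by move=> x; exact: norm_continuous.
have [[x0 Sx0]|S0] := pselect (S !=set0); last first.
  exists 1 => // x; have [->|x0] := eqVneq x 0; first by rewrite normr0 mulr0.
  exfalso; apply: S0; exists (`|x|^-1 *: x).
  by rewrite /S /= normrZ normfV normr_id mulVf// normr_eq0.
have cS : compact S.
  apply: bounded_closed_compact.
    by exists 1; split => // M M1 x; rewrite /S /= => ->; exact: ltW.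
  apply: (@closed_comp _ _ (fun x : 'rV[R]_n => `|x|) [set 1]) => [x _|].
    exact: normc.
  exact: closed_eq.
have [|c Sc cP] := @compact_EVT_min _ _ (fun x => `|lin x|) S (ex_intro _ x0 Sx0) cS.
  exact: continuous_subspaceT.
move: Sc; rewrite inE => Sc.
exists `|lin c|.
  rewrite normr_gt0; apply/eqP => /lin_eq0 c0; move: Sc.
  by rewrite /S /= c0 normr0 => /esym/eqP; rewrite oner_eq0.
move=> x; have [->|x0'] := eqVneq x 0; first by rewrite normr0 mulr0.
have xn : 0 < `|x| by rewrite normr_gt0.
have := cP (`|x|^-1 *: x); rewrite inE linZ normrZ normfV normr_id -ler_pdivlMr// mulrC.
by apply; rewrite /S /= normrZ normfV normr_id mulVf// gt_eqF.
Qed.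

Lemma lfun_bounded (X : euclideanType R) (f : 'Hom(W, X)) :
  exists2 C, 0 <= C & forall w, `|f w| <= C * `|w|.
Proof.
have [m m0 mP] := lin_lower.
exists ((\sum_(i < n) `|f (b i)|) / m); first by rewrite divr_ge0 ?sumr_ge0// ltW.
move=> w; rewrite -{1}(lin_coord w); set x := \row_i _.
rewrite /lin linear_sum /=; apply: (le_trans (ler_norm_sum _ _ _)).
rewrite mulr_suml mulr_suml; apply: ler_sum => i _.
rewrite linearZ /= normrZ mulrC -mulrA ler_wpM2l//.
apply: (le_trans (coord_le_norm x i)); rewrite mulrC ler_pdivlMr// mulrC.
by apply: (le_trans (mP x)); rewrite lin_coord.
Qed.

Lemma compact_closed_ball (r : R) : compact [set w : W | `|w| <= r].
Proof.
have [m m0 mP] := lin_lower.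
pose S := [set x : 'rV[R]_n | `|lin x| <= r].
have -> : [set w : W | `|w| <= r] = lin @` S.
  apply/seteqP; split => [w /= wr|_ [x xS <-]//].
  by exists (\row_i coord (vbasis {: W}) i w); rewrite /S /= lin_coord.
apply: continuous_compact; first exact: continuous_subspaceT.
apply: bounded_closed_compact.
  exists (r / m); split; first exact: num_real.
  move=> M rM x /= xr; apply: le_trans (ltW rM).
  by rewrite ler_pdivlMr// mulrC (le_trans (mP x)).
apply: (@closed_comp _ _ (fun x : 'rV[R]_n => `|lin x|) [set t | t <= r]) => [x _|].
  exact: lin_norm_continuous.
exact: closed_le.
Qed.

End finite_dimension.

Section symbols.
Context (R : realType) (d : nat).
Implicit Types (xi eta : 'rV[R]_d).

Definition monomial k (a : mindex d k) xi : R := \prod_(i < d) xi ord0 i ^+ a i.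

Lemma continuous_monomial k (a : mindex d k) : continuous (monomial a).
Proof.
rewrite /monomial; elim: (index_enum 'I_d) => [|i r IH].
  rewrite (_ : (fun x => _) = cst 1); first exact: cst_continuous.
  by apply/funext => x; rewrite big_nil.
rewrite (_ : (fun x => _) =
    fun x : 'rV[R]_d => x ord0 i ^+ a i * \prod_(j <- r) x ord0 j ^+ a j).
  move=> x.
  have H : {for x, continuous
      ((fun t : R => t ^+ a i) \o (fun y : 'rV[R]_d => y ord0 i))}.
    by apply: continuous_comp; [exact: coord_continuous|exact: exprn_continuous].
  exact: (continuousM H (IH x)).
by apply/funext => x; rewrite big_cons.
Qed.

Lemma monomials_near k xi e : 0 < e -> exists2 del, 0 < del &
  forall eta, `|eta - xi| < del ->
  \sum_(a : mindex d k) `|monomial a eta - monomial a xi| <= e.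
Proof.
move=> e0; pose S eta := \sum_(a : mindex d k) `|monomial a eta - monomial a xi|.
have : continuous S.
  rewrite /S; elim: (index_enum _) => [|a r IH].
    rewrite (_ : (fun x => _) = cst 0); first exact: cst_continuous.
    by apply/funext => x; rewrite big_nil.
  rewrite (_ : (fun x => _) = fun eta => `|monomial a eta - monomial a xi| +
      \sum_(j <- r) `|monomial j eta - monomial j xi|).
    move=> x.
    have H : {for x, continuous (Num.norm \o (fun eta => monomial a eta - monomial a xi))}.
      apply: continuous_comp; last exact: norm_continuous.
      by apply: continuousB; [exact: continuous_monomial|exact: cst_continuous].
    exact: (continuousD H (IH x)).
  by apply/funext => x; rewrite big_cons.
move=> /(_ xi)/cvgrPdist_le/(_ e e0)/nbhs_normP[del /= del0 delP].
exists del => // eta etaxi; have := delP eta; rewrite /= distrC => /(_ etaxi).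
rewrite {1}/S big1 ?sub0r ?normrN => [|a _]; last by rewrite subrr normr0.
by apply: le_trans; exact: ler_norm.
Qed.

Lemma symbolZ (V W : vectType R) k (A : mindex d k -> 'Hom(V, W)) c xi :
  symbol A (c *: xi) = c ^+ k *: symbol A xi.
Proof.
rewrite /symbol scaler_sumr; apply: eq_bigr => a /eqP ak.
rewrite scalerA; congr (_ *: _).
have -> : c ^+ k = \prod_(i < d) c ^+ a i.
  by rewrite prodrXr; congr (_ ^+ _); exact: esym ak.
rewrite -big_split /=.
by apply: eq_bigr => i _; rewrite mxE exprMn.
Qed.

Lemma symbol_near (V W : euclideanType R) k (A : mindex d k -> 'Hom(V, W))
    (C : mindex d k -> R) xi eta v :
  (forall a, `|A a v| <= C a) ->
  `|(symbol A eta - symbol A xi) v| <=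
    (\sum_(a : mindex d k) `|monomial a eta - monomial a xi|) * \sum_a C a.
Proof.
move=> AC; rewrite add_lfunE opp_lfunE /symbol !sum_lfunE -sumrB.
apply: (le_trans (ler_norm_sum _ _ _)).
rewrite mulr_suml [leRHS](bigID (fun a => mdegree a == k)) /=.
rewrite -[leLHS]addr0; apply: lerD; last first.
  by apply: sumr_ge0 => a _; rewrite mulr_ge0// sumr_ge0// => c _; exact: le_trans (AC c).
apply: ler_sum => a _; rewrite !scale_lfunE -scalerBl normrZ ler_wpM2l//.
apply: (le_trans (AC a)); rewrite (bigD1 a)//= lerDl sumr_ge0// => c _.
exact: le_trans (AC c).
Qed.

(** The preimage [v] is kept and only the symbol moves. *)
Lemma image_lsc (V W : euclideanType R) k (B : mindex d k -> 'Hom(V, W)) xi w e :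
  w \in limg (symbol B xi) -> 0 < e -> exists2 del, 0 < del &
  forall eta, `|eta - xi| < del ->
    exists2 w', w' \in limg (symbol B eta) & `|w' - w| <= e.
Proof.
move=> /memv_imgP[v _ ->] e0.
pose C := \sum_a `|B a v|; have C0 : 0 <= C by exact: sumr_ge0.
have C10 : 0 < C + 1 by rewrite ltr_wpDl.
have [del del0 delP] := monomials_near k xi (divr_gt0 e0 C10).
exists del => // eta /delP near; exists (symbol B eta v); first by rewrite memv_img ?memvf.
have := @symbol_near _ _ _ B (fun a => `|B a v|) xi eta v (fun a => lexx _).
rewrite add_lfunE opp_lfunE => /le_trans; apply.
apply: le_trans (ler_wpM2r C0 near) _.
by rewrite mulrAC ler_pdivrMr// ler_wpM2l ?(ltW e0)// lerDl.
Qed.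

(** The map [T] inverts [S0] on its image, so [S0 T S0 = S0]. For [eta] near [xi] the map
    [U = 1 + T (S - S0)] is a small perturbation of the identity, and [w' = U^-1 w] satisfies
    [S0 T S w' = S0 w = 0]. Constant rank upgrades this to [S w' = 0]. *)
Lemma kernel_lsc (W X : euclideanType R) k (A : mindex d k -> 'Hom(W, X)) xi w e :
  constant_rank A -> xi != 0 -> w \in lker (symbol A xi) -> 0 < e ->
  exists2 del, 0 < del & forall eta, `|eta - xi| < del ->
    exists2 w', w' \in lker (symbol A eta) & `|w' - w| <= e.
Proof.
move=> [r _ rP] xi0; rewrite memv_ker => /eqP Sw e0.
set S0 := symbol A xi in Sw *; pose T := (S0^-1)%VF.
have STS u : S0 (T (S0 u)) = S0 u by apply: limg_lfunVK; rewrite memv_img ?memvf.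
have /choice[C CP] : forall a, exists C : R, 0 <= C /\ forall u, `|T (A a u)| <= C * `|u|.
  move=> a; have [C C0 CP] := lfun_bounded (T \o A a)%VF; exists C; split => // u.
  by have := CP u; rewrite comp_lfunE.
pose Cs := \sum_a C a.
have Cs0 : 0 <= Cs by apply: sumr_ge0 => a _; exact: (CP a).1.
(* The bound [1 / 2] makes [U] injective and gives [|w'| <= 2 |w|]; the other bound then yields
   [|w' - w| <= e]. *)
pose kap := Num.min 2^-1 (e / (2 * (`|w| + 1))).
have w10 : 0 < `|w| + 1 by rewrite ltr_wpDl.
have kap0 : 0 < kap by rewrite lt_min invr_gt0 ltr0n divr_gt0// mulr_gt0.
have Cs10 : 0 < Cs + 1 by rewrite ltr_wpDl.
have [del del0 delP] := monomials_near k xi (divr_gt0 kap0 Cs10).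
(* The bound [|xi|] keeps [eta] away from 0, so that the rank of [S] is known. *)
exists (Num.min del `|xi|); first by rewrite lt_min del0 normr_gt0.
move=> eta; rewrite lt_min => /andP[/delP near etaxi].
have eta0 : eta != 0 by apply: contraTneq etaxi => ->; rewrite sub0r normrN ltxx.
set S := symbol A eta.
have TS u : `|T ((S - S0) u)| <= kap * `|u|.
  pose TA a := (T \o A a)%VF.
  have -> : T ((S - S0) u) = (symbol TA eta - symbol TA xi) u.
    rewrite !(add_lfunE, opp_lfunE) linearB /= /S /S0 /symbol !sum_lfunE !linear_sum /=.
    by congr (_ + _); apply: eq_bigr => a _; rewrite !scale_lfunE linearZ /= comp_lfunE.
  have H a : `|TA a u| <= C a * `|u| by rewrite comp_lfunE (CP a).2.
  apply: (le_trans (symbol_near xi eta H)); rewrite -mulr_suml -/Cs mulrA ler_wpM2r//.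
  apply: le_trans (ler_wpM2r Cs0 near) _.
  by rewrite mulrAC ler_pdivrMr// ler_wpM2l ?(ltW kap0)// lerDl.
pose U : 'End(W) := (\1 + (T \o (S - S0)))%VF.
have UE u : U u = u + T ((S - S0) u) by rewrite [LHS]add_lfunE comp_lfunE [X in X + _]lfunE.
have kap2 : kap <= 2^-1 by rewrite ge_min lexx.
have U_inj : lker U == 0%VS.
  rewrite -subv0; apply/subvP => u; rewrite memv_ker UE addr_eq0 => /eqP uT.
  have := TS u; rewrite -[`|T _|]normrN -uT => H; rewrite memv0 -normr_le0.
  have : kap * `|u| <= 2^-1 * `|u| by rewrite ler_wpM2r.
  by lra.
(* [U] maps the kernel of [S0 T S], which contains that of [S], injectively into
   the kernel of [S0]; by constant rank all three have the same dimension. *)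
have kerE : lker S = lker (S0 \o (T \o S))%VF.
  apply/eqP; rewrite eqEdim; apply/andP; split.
    by apply/subvP => u; rewrite !memv_ker !comp_lfunE => /eqP ->; rewrite !linear0.
  have dimS : \dim (lker S) = \dim (lker S0).
    have := limg_ker_dim S fullv; have := limg_ker_dim S0 fullv.
    by rewrite !capfv rP// rP//; lia.
  rewrite dimS -(limg_dim_eq (f := U)); last by rewrite (eqP U_inj) capv0.
  apply/dimvS/subvP => v /memv_imgP[u]; rewrite memv_ker !comp_lfunE => /eqP Su ->.
  by rewrite memv_ker UE linearD /= add_lfunE opp_lfunE linearB /= linearB /= Su STS sub0r subrr.
exists ((U^-1)%VF w).
  rewrite kerE memv_ker !comp_lfunE.
  have := lker0_lfunVK U_inj w; set w' := (U^-1)%VF w; rewrite UE => Uw'.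
  have := congr1 S0 Uw'; rewrite Sw linearD /= add_lfunE opp_lfunE linearB /= linearB /= STS.
  by rewrite addrC subrK => ->.
have := lker0_lfunVK U_inj w; set w' := (U^-1)%VF w; rewrite UE => Uw'.
have E : w - w' = T ((S - S0) w') by rewrite -Uw' addrAC subrr add0r.
have w'2 : `|w'| <= 2 * `|w|.
  have : `|w'| <= `|w| + `|w - w'|.
    by rewrite -[X in `|X| <= _](subKr w) ler_normB.
  have : kap * `|w'| <= 2^-1 * `|w'| by rewrite ler_wpM2r.
  by have := TS w'; rewrite -E; lra.
rewrite distrC E; apply: (le_trans (TS w')); apply: (le_trans (ler_wpM2l (ltW kap0) w'2)).
have : kap <= e / (2 * (`|w| + 1)) by rewrite ge_min lexx orbT.
rewrite ler_pdivlMr ?mulr_gt0//; apply: le_trans.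
by rewrite ler_wpM2l ?(ltW kap0)// ler_wpM2l// lerDl.
Qed.

End symbols.

(** * Integrands *)

Section lipschitz_approximation.
Context (R : realType) (V : normedModType R) (A : set V) (g : V -> R).
Hypotheses (cA : compact A) (gA : {within A, continuous g}).

Lemma within_compact_bounded : exists M, forall q, A q -> `|g q| <= M.
Proof.
have [M [_ MP]] := compact_bounded (continuous_compact gA cA).
by exists (M + 1) => q Aq; apply: (MP (M + 1)); [rewrite ltrDl|exists q].
Qed.

Lemma within_compact_uniform e : 0 < e -> exists2 del, 0 < del &
  forall p q, A p -> A q -> `|p - q| < del -> `|g p - g q| <= e.
Proof.
move=> e0; have e20 : 0 < e / 2 by rewrite divr_gt0.
pose P (n : nat) p := forall q, A q -> `|p - q| < n.+1%:R^-1 -> `|g p - g q| <= e.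
have /compact_near_coveringP/near_covering_withinP cov := cA.
have [|n _ /(_ n (leqnn n)) nP] := cov nat \oo P _.
  move=> p Ap.
  have /subspace_continuousP/(_ p Ap)/cvgrPdist_le/(_ _ e20) := gA.
  rewrite near_withinE => /nbhs_normP[del /= del0 delP].
  have del20 : 0 < del / 2 by rewrite divr_gt0.
  have [k _ kP] := near_infty_natSinv_lt (PosNum del20).
  exists (ball p (del / 2), [set n | (k <= n)%N]).
    by split; [exact: nbhsx_ballx|exists k].
  move=> [q n] /= [pq kn] Aq r Ar qr.
  move: pq; rewrite -ball_normE /= => pq.
  have nd := kP n kn; rewrite /= in nd.
  have H1 : `|g p - g q| <= e / 2.
    by apply: delP => //=; apply: lt_trans pq _; rewrite ltr_pdivrMr// ltr_pMr// ltr1n.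
  have H2 : `|g p - g r| <= e / 2.
    apply: delP => //=; apply: (le_lt_trans (ler_distD q _ _)).
    by rewrite [del]splitr ltrD// (lt_trans qr).
  rewrite [e]splitr; apply: (le_trans (ler_distD (g p) _ _)).
  by rewrite lerD// distrC.
by exists n.+1%:R^-1; [rewrite invr_gt0|move=> p q Ap; exact: nP].
Qed.

(* McShane's extension, truncated so that it stays bounded. *)
Lemma within_compact_lipschitz e : 0 < e -> exists B G,
  bounded_lipschitz B G /\ forall q, A q -> `|g q - G q| <= e.
Proof.
move=> e0; have [M' M'P] := within_compact_bounded; pose M := `|M'|.
have MP q : A q -> `|g q| <= M by move=> /M'P/le_trans; apply; exact: ler_norm.
have [del del0 delP] := within_compact_uniform e0.
(* With this slope the truncated cone has reached its ceiling [2 M] at distance [del], where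
   [g p + 2 M >= M >= g q]; at smaller distances uniform continuity applies. *)
pose C := 2 * M / del; have M0 : 0 <= M by exact: normr_ge0.
have C0 : 0 <= C by rewrite divr_ge0 ?mulr_ge0// ltW.
pose k (p q : V) := Num.min (C * `|p - q|) (2 * M).
have k0 p q : 0 <= k p q by rewrite le_min; apply/andP; split; rewrite mulr_ge0.
have kM p q : k p q <= 2 * M by rewrite ge_min lexx orbT.
have kL (p p' q : V) : k p q <= k p' q + C * `|p - p'|.
  rewrite addr_minl le_min !ge_min; apply/andP; split.
    by apply/orP; left; rewrite -mulrDr ler_wpM2l// [leRHS]addrC ler_distD.
  by apply/orP; right; rewrite lerDl mulr_ge0.
have [[a Aa]|noA] := pselect (A !=set0); last first.
  exists 0, (fun=> 0); split; first by split=> *; rewrite ?subrr normr0 ?mul0r.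
  by move=> q Aq; exfalso; apply: noA; exists q.
pose E p := [set g q + k p q | q in A].
have E0 p : E p !=set0 by exists (g a + k p a), a.
have Elb p : has_lbound (E p).
  exists (- M) => _ [q Aq <-]; have := MP q Aq; rewrite ler_norml => /andP[H _].
  by have := k0 p q; lra.
pose G p := inf (E p).
have G_le p q : A q -> G p <= g q + k p q by move=> Aq; apply: ge_inf => //; exists q.
have le_G p y : (forall q, A q -> y <= g q + k p q) -> y <= G p.
  by move=> H; apply: lb_le_inf => // _ [q Aq <-]; exact: H.
have GL p p' : G p <= G p' + C * `|p - p'|.
  rewrite -lerBlDr; apply: (le_G) => q Aq; rewrite lerBlDr.
  by have := G_le p q Aq; have := kL p p' q; lra.
exists (3 * M + C), G; split; [split => [p|p p']|].
- rewrite ler_norml; apply/andP; split.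
    apply: (le_G) => q Aq; have := MP q Aq; rewrite ler_norml => /andP[H _].
    by have := k0 p q; lra.
  have := MP a Aa; rewrite ler_norml => /andP[_ H].
  by have := G_le p a Aa; have := kM p a; lra.
- apply: (@le_trans _ _ (C * `|p - p'|)).
    have := GL p p'; have := GL p' p; rewrite distrC => H1 H2.
    by rewrite ler_norml; apply/andP; split; lra.
  by rewrite ler_wpM2r// lerDr mulr_ge0.
- move=> q Aq.
  have H1 : G q <= g q.
    by have := G_le q q Aq; rewrite /k subrr normr0 mulr0 min_l ?addr0// mulr_ge0.
  have H2 : g q - e <= G q.
    apply: (le_G) => p Ap; have [qp|qp] := ltP `|q - p| del.
      have := delP q p Aq Ap qp; rewrite ler_norml => /andP[_ H].
      by have := k0 q p; lra.
    have -> : k q p = 2 * M.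
      by rewrite /k min_r// /C mulrAC ler_pdivlMr// ler_wpM2l// mulr_ge0.
    have := MP p Ap; have := MP q Aq; rewrite !ler_norml => /andP[? ?] /andP[? ?].
    by lra.
  by rewrite ger0_norm; lra.
Qed.

Lemma within_compact_measurable (U : normedModType R) (E : set (borel U)) (phi : U -> V) :
  measurable E -> continuous phi -> (forall x, E x -> A (phi x)) ->
  measurable_fun E (g \o phi : borel U -> measurableTypeR R).
Proof.
move=> mE phic EA.
have gphi : {within (E : set U), continuous (g \o phi)}.
  apply/subspace_continuousP => x Ex; apply/cvgrPdist_le => e e0.
  have [del del0 delP] := within_compact_uniform e0.
  have /cvgrPdist_lt/(_ del del0) := phic x.
  rewrite near_withinE; apply: filterS => y xy Ey.
  by apply: delP => //; exact: EA.
apply: (measurability _ (RGenOpens.measurableE R)) => //.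
move=> _ [_ [a [b ->] <-]]; set S := `]a, b[%classic.
have So : open S by exact: interval_open.
have /continuousP/(_ S So)/open_subspaceP[Q Qo QE] := gphi.
by rewrite setIC -QE; apply: measurableI => //; exact: open_borel.
Qed.

End lipschitz_approximation.

Section integrands.
Context (R : realType) (d : nat) (W : euclideanType R).
Implicit Types (x y : 'rV[R]_d) (z w : W).

Lemma pair_norm_le x z : `|(x, z) : 'rV[R]_d * W| <= `|x| + `|z|.
Proof. by rewrite prod_normE /= ge_max lerDl lerDr !normr_ge0. Qed.

(** The inverse of the map from [z] to [z / (1 - |z|)]: it identifies [W] with the open unit ball,
    whose boundary sphere represents the directions at infinity. *)
Definition shrink z : W := (1 + `|z|)^-1 *: z.

Let nz z : 0 < 1 + `|z|. Proof. by rewrite ltr_wpDr. Qed.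

Lemma shrink_lt1 z : `|shrink z| < 1.
Proof.
rewrite normrZ gtr0_norm ?invr_gt0 ?nz// ltr_pdivrMl ?nz// mulr1.
by rewrite ltrDr.
Qed.

(** Near [z] the map [shrink] contracts like [1 / (1 + |z|)]. This compensates the weight in
    [grow G], which is therefore Lipschitz in [z] on all of [W]. *)
Lemma shrink_lipschitz z w : (1 + `|z|) * `|shrink z - shrink w| <= 2 * `|z - w|.
Proof.
rewrite -[X in X * _](gtr0_norm (nz z)) -normrZ scalerBr scalerA mulfV ?gt_eqF ?nz//.
rewrite scale1r /shrink scalerA.
have -> : z - ((1 + `|z|) / (1 + `|w|)) *: w =
    (z - w) + ((`|w| - `|z|) / (1 + `|w|)) *: w.
  have -> : (1 + `|z|) / (1 + `|w|) = 1 - (`|w| - `|z|) / (1 + `|w|).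
    by field; rewrite gt_eqF ?nz.
  by rewrite [in LHS]scalerBl scale1r opprB addrA addrAC.
rewrite mulr_natl mulr2n; apply: (le_trans (ler_normD _ _)); rewrite lerD2l normrZ.
rewrite normrM normfV (gtr0_norm (nz w)) -mulrA.
apply: le_trans (_ : `|(`|w| - `|z|)| * 1 <= _); last first.
  by rewrite mulr1 [leRHS]distrC ler_dist_dist.
by rewrite ler_wpM2l// ler_pdivrMl ?nz// mulr1 lerDr.
Qed.

Variables (Om : set 'rV[R]_d).
Hypotheses (Om_open : open Om) (Om_bounded : bounded_set Om).
Let cl := closure (Om `*` unit_ball W).

Lemma compact_closure_ball : compact cl.
Proof.
have [M [_ MP]] := Om_bounded.
pose S := [set x : 'rV[R]_d | `|x| <= M + 1].
have cS : compact S.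
  apply: bounded_closed_compact.
    exists (M + 1); split; first exact: num_real.
    by move=> r Mr x /= /le_trans; apply; exact: ltW.
  apply: (@closed_comp _ _ (fun x : 'rV[R]_d => `|x|) [set t | t <= M + 1]) => [x _|].
    exact: norm_continuous.
  exact: closed_le.
have cB := @compact_closed_ball R W 1.
have cSB := compact_setX cS cB.
apply: (subclosed_compact _ cSB); first exact: closed_closure.
have hSB : closed (S `*` [set w : W | `|w| <= 1]).
  by apply: compact_closed => //; exact: norm_hausdorff.
rewrite /cl [X in _ `<=` X]((closure_id _).1 hSB); apply: closure_subset.
move=> [x z] [/= Omx zB]; split => /=; last exact: ltW.
by apply: (MP (M + 1)); rewrite ?ltrDl.
Qed.

(** Points with [|z| = 1], where the recession function lives, are limits of [(1 - t) z]. *)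
Lemma mem_closure_ball x z : Om x -> `|z| <= 1 -> cl (x, z).
Proof.
move=> Omx z1 U /nbhs_ballP[e /= e0 eU].
pose t := Num.min (e / 2) (2^-1); have t0 : 0 < t.
  by rewrite lt_min divr_gt0//= invr_gt0.
have te : t < e.
  by rewrite gt_min ltr_pdivrMr// ltr_pMr// ltr1n.
have t1 : t <= 2^-1 by rewrite ge_min lexx orbT.
exists (x, (1 - t) *: z); split; last first.
  apply: eU; split => /=; first exact: ballxx.
  rewrite -ball_normE /= -[X in X - _]scale1r -scalerBl subKr normrZ gtr0_norm//.
  by apply: le_lt_trans te; rewrite ler_piMr// ltW.
split => //=; rewrite /unit_ball /= normrZ gtr0_norm; last by lra.
apply: (@le_lt_trans _ _ ((1 - t) * 1)); last by rewrite mulr1; lra.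
by rewrite ler_wpM2l//; lra.
Qed.

Variables (f : 'rV[R]_d -> W -> R) (g : 'rV[R]_d * W -> R).
Hypothesis gc : {within cl, continuous g}.
Hypothesis gf : forall x z, Om x -> unit_ball W z -> g (x, z) = ball_transform f x z.

Lemma integrandE x z : Om x -> f x z = (1 + `|z|) * g (x, shrink z).
Proof.
move=> Omx; rewrite gf//; last exact: shrink_lt1.
have n1 : 1 - `|shrink z| = (1 + `|z|)^-1.
  rewrite normrZ gtr0_norm ?invr_gt0 ?nz//; field; rewrite gt_eqF ?nz//.
rewrite /ball_transform n1 invrK mulrA mulfV ?gt_eqF ?nz// mul1r.
by rewrite /shrink scalerA mulfV ?scale1r ?gt_eqF ?nz.
Qed.

Definition grow (G : 'rV[R]_d * W -> R) x z := (1 + `|z|) * G (x, shrink z).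

(** Replacing [g] by a Lipschitz [G] changes [f] by at most [e (1 + |z|)], which is harmless as long
    as the first moments of the fields stay bounded. *)
Lemma integrand_approx e : 0 < e -> exists B G, [/\ bounded_lipschitz B G,
  forall x z, Om x -> `|f x z - grow G x z| <= e * (1 + `|z|) &
  forall x z, Om x -> `|z| <= 1 -> `|g (x, z) - G (x, z)| <= e].
Proof.
move=> e0; have [B [G [GB GP]]] := within_compact_lipschitz compact_closure_ball gc e0.
exists B, G; split => // x z Omx.
  rewrite integrandE// -mulrBr normrM gtr0_norm ?nz// mulrC ler_wpM2r ?(ltW (nz z))//.
  by apply: GP; apply: mem_closure_ball => //; exact/ltW/shrink_lt1.
by move=> z1; apply: GP; exact: mem_closure_ball.
Qed.

Lemma bounded_lipschitz_pair B (G : 'rV[R]_d * W -> R) x y z w :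
  bounded_lipschitz B G -> `|G (x, z) - G (y, w)| <= B * `|x - y| + B * `|z - w|.
Proof.
move=> GB; apply: (le_trans (GB.2 _ _)); rewrite -mulrDr ler_wpM2l//.
  exact: bounded_lipschitz_ge0 GB.
exact: pair_norm_le.
Qed.

(** In [z], the weight [1 + |z|] contributes [B] to the Lipschitz constant and [shrink] contributes
    [2 B]; the added 1 keeps the divisor positive. *)
Lemma grow_test B (G : 'rV[R]_d * W -> R) : bounded_lipschitz B G ->
  test_fun (fun x z => (3 * B + 1)^-1 * grow G x z).
Proof.
move=> GB; have B0 := bounded_lipschitz_ge0 GB.
have L0 : 0 < 3 * B + 1 by rewrite ltr_wpDl// mulr_ge0.
split => [x z|x y z w].
  rewrite normrM gtr0_norm ?invr_gt0// ler_pdivrMl// normrM gtr0_norm ?nz//.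
  rewrite mulrC ler_wpM2r ?(ltW (nz z))//.
  by have := GB.1 (x, shrink z); lra.
rewrite -mulrBr normrM gtr0_norm ?invr_gt0// ler_pdivrMl//.
have -> : grow G x z - grow G y w = (1 + `|z|) * (G (x, shrink z) - G (y, shrink w)) +
    (`|z| - `|w|) * G (y, shrink w) by rewrite /grow; ring.
have H1 : `|(1 + `|z|) * (G (x, shrink z) - G (y, shrink w))| <=
    B * ((1 + `|z|) * `|x - y|) + B * (2 * `|z - w|).
  rewrite normrM gtr0_norm ?nz//.
  apply: le_trans (ler_wpM2l (ltW (nz z)) (bounded_lipschitz_pair x y _ _ GB)) _.
  rewrite mulrDr; apply: lerD; first by rewrite mulrCA.
  by rewrite mulrCA ler_wpM2l// shrink_lipschitz.
have H2 : `|(`|z| - `|w|) * G (y, shrink w)| <= `|z - w| * B.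
  by rewrite normrM ler_pM ?ler_dist_dist ?GB.1.
apply: (le_trans (ler_normD _ _)); apply: (le_trans (lerD H1 H2)).
have p1 : 0 <= (1 + `|z|) * `|x - y| by rewrite mulr_ge0// ltW.
have p2 : 0 <= B * ((1 + `|z|) * `|x - y|) by rewrite mulr_ge0.
have p3 : 0 <= `|z - w| by [].
have p4 : 0 <= B * `|z - w| by rewrite mulr_ge0.
by move: p1 p2 p3 p4; move: (_ * `|x - y|) (`|z - w|) => *; lra.
Qed.

Lemma recessionE x z : Om x -> `|z| = 1 -> recession Om f x z = g (x, z).
Proof.
move=> Omx z1; rewrite /recession within_interior; last exact: open_nbhs_nbhs.
apply/cvg_lim; first exact: norm_hausdorff.
apply/cvgrPdist_le => e e0.
have e80 : 0 < e / 8 by rewrite divr_gt0.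
have [B [G [GB fG gG]]] := integrand_approx e80.
have B0 := bounded_lipschitz_ge0 GB.
(* From [del <= 1] follows [s <= 3]. The continuity errors below add up to [8 B del <= e / 2], and
   passing between [g] and [G] costs [3 (e / 8) + e / 8]. *)
pose del := Num.min 1 (e / (16 * (B + 1))).
have B10 : 0 < 16 * (B + 1) by rewrite mulr_gt0// ltr_wpDl.
have del0 : 0 < del by rewrite lt_min ltr01 divr_gt0.
have delB : 8 * (B * del) <= e / 2.
  have : del <= e / (16 * (B + 1)) by rewrite ge_min lexx orbT.
  rewrite ler_pdivlMr// => H; have := ltW del0; lra.
exists ((Om `&` ball x del) `*` ball z del, [set t | del^-1 < t]).
  split => /=; last by exists del^-1; split => //; exact: num_real.
  exists (Om `&` ball x del, ball z del) => //; split => /=.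
    by apply: filterI; [exact: open_nbhs_nbhs|exact: nbhsx_ballx].
  exact: nbhsx_ballx.
move=> [[x' z'] t] [[[/= Omx' xx'] zz'] tdel].
move: xx' zz'; rewrite -!ball_normE /= => xx' zz'.
have t0 : 0 < t by apply: lt_trans tdel; rewrite invr_gt0.
have tV : t^-1 < del by rewrite invf_plt.
have tV0 : 0 < t^-1 by rewrite invr_gt0.
have del1 : del <= 1 by rewrite ge_min lexx.
(* With this [s], close to 1, one has [1 + |t z'| = t s], hence
   [grow G x' (t z') / t = s G (x', z' / s)]. *)
pose s := t^-1 + `|z'|; have s0 : 0 < s by rewrite ltr_wpDr.
have s1 : `|s - 1| <= t^-1 + `|z - z'|.
  rewrite /s -addrA; apply: (le_trans (ler_normD _ _)).
  by rewrite (ger0_norm (ltW tV0)) lerD2l -z1 distrC ler_dist_dist.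
have s3 : s <= 3.
  by move: s1; rewrite ler_norml => /andP[_]; lra.
have tz : 1 + `|t *: z'| = t * s.
  by rewrite normrZ gtr0_norm// /s mulrDr mulfV ?gt_eqF.
have fE : grow G x' (t *: z') / t = s * G (x', s^-1 *: z').
  rewrite /grow /shrink tz scalerA.
  have -> : (t * s)^-1 * t = s^-1 by field; rewrite !gt_eqF.
  by field; rewrite gt_eqF.
have H1 : `|f x' (t *: z') / t - s * G (x', s^-1 *: z')| <= 3 * (e / 8).
  rewrite -fE -mulrBl normrM [`|t^-1|]gtr0_norm// ler_pdivrMr//.
  apply: (le_trans (fG _ _ Omx')); rewrite tz.
  have := ler_wpM2l (ltW (mulr_gt0 e80 t0)) s3; lra.
have H2 : `|G (x, z) - s * G (x', s^-1 *: z')| <=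
    B * (3 * `|x - x'|) + B * (2 * `|z - z'| + t^-1) + B * (t^-1 + `|z - z'|).
  have -> : G (x, z) - s * G (x', s^-1 *: z') =
    s * (G (x, z) - G (x', s^-1 *: z')) + (1 - s) * G (x, z) by ring.
  apply: (le_trans (ler_normD _ _)); apply: lerD; last first.
    by rewrite normrM mulrC ler_pM ?GB.1// distrC.
  rewrite normrM gtr0_norm//.
  apply: le_trans (ler_wpM2l (ltW s0) (bounded_lipschitz_pair x x' _ _ GB)) _.
  rewrite mulrDr ![s * (B * _)]mulrCA; apply: lerD; rewrite ler_wpM2l//.
    by rewrite ler_wpM2r.
  rewrite -[X in X * _](gtr0_norm s0) -normrZ scalerBr scalerA mulfV ?gt_eqF// scale1r.
  have -> : s *: z - z' = (z - z') + (s - 1) *: z.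
    by rewrite scalerBl scale1r [RHS]addrC subrKA.
  apply: (le_trans (ler_normD _ _)); rewrite normrZ z1 mulr1.
  by apply: (le_trans (lerD (lexx _) s1)); lra.
have H3 := gG x z Omx ltac:(by rewrite z1).
apply: (le_trans (ler_distD (G (x, z)) _ _)).
have H4 := ler_distD (s * G (x', s^-1 *: z')) (G (x, z)) (f x' (t *: z') / t).
have bx : B * `|x - x'| <= B * del by rewrite ler_wpM2l// ltW.
have bz : B * `|z - z'| <= B * del by rewrite ler_wpM2l// ltW.
have bt : B * t^-1 <= B * del by rewrite ler_wpM2l// ltW.
rewrite distrC in H1.
by lra.
Qed.

(** For a far atom [z] close to [|z| a], the value at [a1 + z] is essentially [|z| g (x, a)]. The
    bounded discrepancies, among them the value at [a1], are collected in [7 B = 3 B + 2 B + 2 B],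
    which is negligible against [|z|] because the nonzero atoms are large. *)
Lemma leaf_estimate B e (G : 'rV[R]_d * W -> R) x (a1 a z : W) :
  bounded_lipschitz B G -> `|g (x, a) - G (x, a)| <= e -> `|a1| = 1 -> `|a| = 1 ->
  `|grow G x (a1 + z) - grow G x a1 - `|z| * g (x, a)| <=
    7 * B + B * `|z - `|z| *: a| + e * `|z|.
Proof.
move=> GB gG a11 a_1; have B0 := bounded_lipschitz_ge0 GB.
pose N := 1 + `|a1 + z|; have N0 : 0 < N by exact: nz.
have NzN : `|N - `|z| | <= 2.
  rewrite ler_norml /N; have := ler_normD a1 z; have := ler_normB (a1 + z) a1.
  by rewrite addrAC subrr add0r a11 => *; apply/andP; split; lra.
have -> : grow G x (a1 + z) - grow G x a1 - `|z| * g (x, a) =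
    N * (G (x, shrink (a1 + z)) - G (x, a)) + (N - `|z|) * G (x, a) +
    - grow G x a1 + - (`|z| * (g (x, a) - G (x, a))) by rewrite /grow -/N; ring.
have H1 : `|N * (G (x, shrink (a1 + z)) - G (x, a))| <= B * (3 + `|z - `|z| *: a|).
  rewrite normrM gtr0_norm//.
  apply: le_trans (ler_wpM2l (ltW N0) (bounded_lipschitz_pair x x _ _ GB)) _.
  rewrite subrr normr0 mulr0 add0r mulrCA ler_wpM2l//.
  rewrite -[X in X * _](gtr0_norm N0) -normrZ scalerBr scalerA mulfV ?gt_eqF// scale1r.
  have -> : a1 + z - N *: a = a1 + (z - `|z| *: a) - (N - `|z|) *: a.
    by rewrite scalerBl opprB !addrA subrK.
  apply: (le_trans (ler_normB _ _)); rewrite normrZ a_1 mulr1.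
  by have := ler_normD a1 (z - `|z| *: a); rewrite a11; lra.
have H2 : `|(N - `|z|) * G (x, a)| <= 2 * B by rewrite normrM ler_pM// GB.1.
have H3 : `|- grow G x a1| <= 2 * B.
  rewrite normrN normrM a11; apply: ler_pM => //; last exact: GB.1.
  by rewrite ger0_norm; lra.
have H4 : `|- (`|z| * (g (x, a) - G (x, a)))| <= e * `|z|.
  by rewrite normrN normrM normr_id mulrC ler_wpM2r.
apply: (le_trans (ler_normD _ _)); apply: lerD => //.
apply: (le_trans (ler_normD _ _)).
apply: (le_trans (lerD (ler_normD _ _) (lexx _))).
by lra.
Qed.

End integrands.

(** * Integration against atomic measures *)

Section atomic_integral.
Context dd (T : measurableType dd) (R : realType) (n : nat).
Variables (c : 'I_n -> {i01 R}) (a : 'I_n -> T).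
Local Open Scope ereal_scope.

Let c_ge0 i : (0 <= (c i)%:num)%R. Proof. by []. Qed.

Lemma ge0_integral_atomic (D : set T) (h : T -> \bar R) : measurable D ->
  measurable_fun D h -> (forall z, D z -> 0 <= h z) -> (forall i, D (a i)) ->
  \int[atomic c a]_(z in D) h z = \sum_(i < n) (c i)%:num%:E * h (a i).
Proof.
move=> mD mh h0 Da.
pose m k : {measure set T -> \bar R} := if insub k is Some i
  then mscale (NngNum (c_ge0 i)) \d_(a i) else mzero.
have -> : atomic c a = msum m n.
  apply/funext => S; rewrite /msum /atomic; apply: eq_bigr => i _.
  by rewrite /m valK.
rewrite ge0_integral_measure_sum//; apply: eq_bigr => i _.
rewrite /m valK ge0_integral_mscale//.
rewrite (integral_dirac (a i) mD mh).
by rewrite diracE mem_set// mul1e.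
Qed.

Lemma integral_atomic (D : set T) (h : T -> R) : measurable D ->
  measurable_fun D h -> (forall i, D (a i)) ->
  \int[atomic c a]_(z in D) (h z)%:E = (\sum_(i < n) (c i)%:num * h (a i))%:E.
Proof.
move=> mD mh Da; have mEh : measurable_fun D (EFin \o h) by exact/measurable_EFinP.
rewrite integralE !ge0_integral_atomic//.
- rewrite (eq_bigr (fun i => ((c i)%:num * Num.max (h (a i)) 0)%:E)); last first.
    by move=> i _; rewrite funeposE -EFin_max.
  rewrite [X in _ - X](eq_bigr (fun i => ((c i)%:num * Num.max (- h (a i)) 0)%:E)); last first.
    by move=> i _; rewrite funenegE -EFin_max.
  rewrite !sumEFin -EFinB -sumrB; congr EFin; apply: eq_bigr => i _.
  rewrite -mulrBr; congr (_ * _)%R.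
  by case: (leP 0%R (h (a i))) => h0; rewrite ?(max_l h0) ?(max_r (ltW h0));
    [rewrite max_r ?oppr_le0// subr0|rewrite max_l ?oppr_ge0 ?(ltW h0)// sub0r opprK].
- exact: measurable_funeneg.
- exact: measurable_funepos.
Qed.

End atomic_integral.

Section constants.
Context (R : realType) (d : nat) (W : euclideanType R).
Variables (K : 'rV[R]_d -> {vspace W}) (Om : set 'rV[R]_d).
Hypothesis KZ : forall c xi (w : W), c != 0 -> w \in K xi -> w \in K (c *: xi).
Hypothesis Om_bounded : bounded_set Om.

(* Since the constant field need not be a [cone_field], it is approximated by
   waves of very small frequency. *)
Lemma cone_field_cst w e : lin_span (cone K) w -> 0 < e ->
  exists2 u, cone_field K u & forall x, Om x -> `|u x - w| <= e.
Proof.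
move=> [s sK ws] e0; pose t := in_tuple s.
have -> : w = \sum_i coord t i w *: t`_i by exact: coord_span.
clear ws; elim: (index_enum _) e e0 => [|i r IH] e e0.
  exists (fun=> 0); first exact: cone_field0.
  by move=> x _; rewrite big_nil subrr normr0 ltW.
have e20 : 0 < e / 2 by rewrite divr_gt0.
have [u2 u2K u2P] := IH _ e20.
have [xi xi0 tK] := sK t`_i (mem_nth 0 (ltn_ord i)).
set z := coord t i w *: t`_i.
have zK : z \in K xi by rewrite memvZ.
have [M [_ MP]] := Om_bounded.
pose S := \sum_j `|xi ord0 j|; have S0 : 0 <= S by exact: sumr_ge0.
pose b := S * (`|M| + 1) * `|z| + 1.
have b0 : 0 < b by rewrite ltr_wpDl// !mulr_ge0// addr_ge0.
pose del := e / 2 / b; have del0 : 0 < del by rewrite divr_gt0.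
exists (fun x => cos (dotv (del *: xi) x + 0) *: z + u2 x).
  apply: cone_fieldD => //; apply: cone_field_term; last by apply: KZ; rewrite ?gt_eqF.
  by rewrite scaler_eq0 negb_or gt_eqF.
move=> x Omx; rewrite big_cons -/z opprD addrACA [e]splitr.
apply: (le_trans (ler_normD _ _)); apply: lerD; last exact: u2P.
rewrite -[X in _ - X]scale1r -scalerBl normrZ addr0 -[X in _ - X]cos0.
apply: (@le_trans _ _ (del * (S * (`|M| + 1)) * `|z|)).
  rewrite ler_wpM2r//; apply: (le_trans (cos_lipschitz _ _)).
  rewrite subr0 dotvZl normrM gtr0_norm// ler_wpM2l ?(ltW del0)//.
  apply: (le_trans (dotv_le _ _)); rewrite ler_wpM2l//.
  by apply: (MP (`|M| + 1)) => //; rewrite (le_lt_trans (ler_norm _))// ltrDl.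
rewrite -mulrA /del mulrAC ler_pdivrMr// ler_wpM2l ?(ltW e20)//.
by rewrite /b lerDl.
Qed.

End constants.

(** * Generation of the Young measure *)

Section limit_weights.
Context (R : realType) (W : euclideanType R) (n : nat) (a : 'I_n.+1 -> W).
Variable D : set W.
Hypotheses (D0 : D 0) (DZ : forall c m, D m -> D (c *: m)).
Hypotheses (a1 : forall i, `|a i| = 1) (aD : forall i, lin_span D (a i)).
Hypothesis a0 : conv_hull (range a) 0.

Definition ray_weight (t : splitting W) i : R :=
  avg (fun y => (nearest_ray a y == i)%:R * `|y|) t 0.

Lemma sum_ray_weight (V : lmodType R) (h : 'I_n.+1 -> V) t :
  \sum_i ray_weight t i *: h i =
  \sum_(q <- law t 0) (q.1 * `|q.2|) *: h (nearest_ray a q.2).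
Proof.
rewrite /ray_weight /avg; under eq_bigr do rewrite scaler_suml.
rewrite exchange_big /=; apply: eq_bigr => q _.
rewrite (bigD1 (nearest_ray a q.2))//= eqxx mul1r big1 ?addr0// => i.
by rewrite eq_sym => /negbTE ->; rewrite mul0r mulr0 scale0r.
Qed.

Lemma le_invn_eq0 (V : normedModType R) (v : V) C :
  (forall j : nat, `|v| <= C * j.+1%:R^-1) -> v = 0.
Proof.
move=> H; apply/eqP; rewrite -normr_le0; apply/ler_addgt0Pl => e e0; rewrite addr0.
have C10 : 0 < `|C| + 1 by rewrite ltr_wpDl.
have ec : 0 < e / (`|C| + 1) by rewrite divr_gt0.
have [k _ /(_ k (leqnn k)) kP] := near_infty_natSinv_lt (PosNum ec).
apply: (le_trans (H k)); apply: (@le_trans _ _ ((`|C| + 1) * k.+1%:R^-1)).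
  by rewrite ler_wpM2r ?invr_ge0// (le_trans (ler_norm _))// lerDl.
by rewrite mulrC -ler_pdivlMr// ltW.
Qed.

(** The vectors of ray weights lie in a cube, hence have a cluster point [c]; a selection with
    [k j >= j] keeps the errors below [1 / (j + 1)]. The relation for the [a i] holds because each
    laminate has mean 0 and moving its atoms [y] to [|y| a i] on the nearest ray costs the average
    of [ray_dist]. *)
Lemma exists_limit_weights : exists (c : 'I_n.+1 -> {i01 R}) (t : nat -> splitting W),
  [/\ \sum_i (c i)%:num = 1, \sum_i (c i)%:num *: a i = 0 &
    forall j, let e := j.+1%:R^-1 in [/\ splits_along D (t j),
      avg (fun y => `|y|) (t j) 0 = 1, avg (ray_dist a) (t j) 0 <= e,
      forall q, q \in law (t j) 0 -> q.2 != 0 -> 1 <= e * `|q.2| &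
      forall i, `|ray_weight (t j) i - (c i)%:num| <= e]].
Proof.
have e0 (j : nat) : 0 < j.+1%:R^-1 :> R by rewrite invr_gt0.
have /choice[s sP] : forall j : nat, exists t, [/\ splits_along D t,
    avg (fun y => `|y|) t 0 = 1, avg (ray_dist a) t 0 <= j.+1%:R^-1 &
    forall q, q \in law t 0 -> q.2 != 0 -> 1 <= j.+1%:R^-1 * `|q.2|].
  move=> j; have [t [t1 t2 t3 t4]] := @exists_concentrating_splitting R W n a a1 D
    D0 DZ aD a0 _ j.+1%:R (e0 j) ltac:(by rewrite ltr0n).
  exists t; split=> // q ql q0; rewrite mulrC ler_pdivlMr ?mul1r ?ltr0n//.
  exact: t4.
have w_sum t : \sum_i ray_weight t i = avg (fun y => `|y|) t 0.
  have := sum_ray_weight (fun=> 1 : R^o) t.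
  rewrite /avg => H; transitivity (\sum_i ray_weight t i *: (1 : R^o)).
    by apply: eq_bigr => i _; rewrite -[RHS]/(_ * 1) mulr1.
  by rewrite H; apply: eq_bigr => q _; rewrite -[LHS]/(_ * 1) mulr1.
have w_ge0 t i : 0 <= ray_weight t i.
  by rewrite -(avg_cst (0 : R) t 0); apply: le_avg => y; rewrite mulr_ge0.
pose m j : 'rV[R]_n.+1 := \row_i ray_weight (s j) i.
pose S := [set v : 'rV[R]_n.+1 | forall i, `[0, 1]%classic (v ord0 i)].
have cS : compact S.
  exact: (@rV_compact R n.+1 (fun=> `[0, 1]%classic) (fun=> @segment_compact R 0 1)).
have mS j : S (m j).
  move=> i; rewrite /= in_itv /= mxE w_ge0/=.
  have [_ <- _ _] := sP j; rewrite -w_sum (bigD1 i)//= lerDl.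
  by apply: sumr_ge0 => k _; exact: w_ge0.
have [v [Sv clv]] := cS (m @ \oo) _ (filterE _ mS).
have /choice[k kP] : forall j : nat, exists k : nat, (j <= k)%N /\ `|m k - v| < j.+1%:R^-1.
  move=> j; have [w [[k jk <-] vw]] := clv (m @` [set k | (j <= k)%N]) (ball v j.+1%:R^-1)
    ltac:(by exists j => // k /= jk; exists k) (nbhsx_ballx v _ (e0 j)).
  by exists k; split=> //; rewrite distrC; move: vw; rewrite -ball_normE.
have v01 i : 0 <= v ord0 i <= 1 by have := Sv i; rewrite /= in_itv.
have /choice[c cP] : forall i, exists c : {i01 R}, c%:num = v ord0 i.
  by move=> i; have /andP[v0 v1] := v01 i; exists (Itv01 v0 v1).
have wc j i : `|ray_weight (s (k j)) i - (c i)%:num| <= j.+1%:R^-1.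
  rewrite cP; apply: le_trans (ltW (kP j).2).
  by apply: le_trans (coord_le_norm _ i); rewrite !mxE.
have kj j : (k j).+1%:R^-1 <= j.+1%:R^-1 :> R.
  by rewrite lef_pV2 ?posrE ?ltr0n// ler_nat ltnS (kP j).1.
exists c, (s \o k); split.
- apply/eqP; rewrite -subr_eq0; apply/eqP.
  apply: (@le_invn_eq0 R^o _ n.+1%:R) => j.
  have wk1 : \sum_i ray_weight (s (k j)) i = 1 by rewrite w_sum; have [] := sP (k j).
  rewrite -[X in `|_ - X|]wk1 -sumrB.
  apply: (le_trans (ler_norm_sum _ _ _)).
  apply: (@le_trans _ _ (\sum_(i < n.+1) j.+1%:R^-1)).
    by apply: ler_sum => i _; rewrite distrC.
  by rewrite sumr_const card_ord mulr_natl.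
- apply: (@le_invn_eq0 W _ (n.+1%:R + 1)) => j.
  have [_ _ sd _] := sP (k j).
  have -> : \sum_i (c i)%:num *: a i =
      \sum_i ((c i)%:num - ray_weight (s (k j)) i) *: a i +
      \sum_i ray_weight (s (k j)) i *: a i.
    by rewrite -big_split; apply: eq_bigr => i _; rewrite /= -scalerDl subrK.
  apply: (le_trans (ler_normD _ _)); rewrite mulrDl mul1r; apply: lerD.
    apply: (le_trans (ler_norm_sum _ _ _)).
    apply: (@le_trans _ _ (\sum_(i < n.+1) j.+1%:R^-1)).
      by apply: ler_sum => i _; rewrite normrZ a1 mulr1 distrC.
    by rewrite sumr_const card_ord mulr_natl.
  rewrite sum_ray_weight -[X in `|X|]subr0 -[X in `|_ - X|](law_mean (s (k j)) 0) -sumrB.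
  apply: (le_trans (ler_norm_sum _ _ _)); apply: le_trans (kj j); apply: le_trans sd.
  rewrite /avg big_seq [leRHS]big_seq; apply: ler_sum => q /law_ge0 q0.
  by rewrite -scalerA -scalerBr normrZ ger0_norm// distrC.
- move=> j; have [t1 t2 t3 t4] := sP (k j); split=> //.
  + exact: le_trans t3 (kj j).
  + move=> q ql q0; apply: (le_trans (t4 q ql q0)).
    by apply: ler_wpM2r => //; exact: kj.
  + exact: wc.
Qed.

End limit_weights.

Section generation.
Context (R : realType) (d : nat) (W : euclideanType R).
Variables (Om : set 'rV[R]_d).
Hypotheses (Om_open : open Om) (Om_bounded : bounded_set Om).
Local Notation mu := (@lebesgue_rV R d).
Local Notation mOm := (open_borel Om_open).
Local Notation vol := (fine (mu Om)).
Local Notation I h := (\int[mu]_(x in Om) (h : 'rV[R]_d -> R) x).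
Local Notation "'integrable_on' h" := (mu.-integrable Om (EFin \o h)) (at level 10).

Lemma Rintegral_dist_le (h k b : 'rV[R]_d -> R) : integrable_on h ->
  integrable_on k -> integrable_on b -> (forall x, Om x -> `|h x - k x| <= b x) ->
  `|I h - I k| <= I b.
Proof.
move=> ih ik ib hkb.
have ihk : integrable_on (fun x => h x - k x) by apply: (integrableB mOm ih ik).
rewrite -RintegralB//; last exact: mOm.
apply: (le_trans (le_normr_Rintegral mOm ihk)).
apply: le_Rintegral => //; first exact: mOm.
exact: (integrable_norm ihk).
Qed.

Lemma bounded_lipschitz_cst (U V : normedModType R) (w : V) :
  bounded_lipschitz `|w| (fun _ : U => w).
Proof. by split=> // x y; rewrite subrr normr0 mulr_ge0. Qed.

Lemma integrable_cst (c : R) : integrable_on (fun=> c).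
Proof.
apply: (bl_integrable Om_open Om_bounded (B := `|c|)).
by split=> // x y; rewrite subrr normr0 mulr_ge0.
Qed.

Lemma norm_test : test_fun (fun (x : 'rV[R]_d) (z : W) => `|z|).
Proof.
split => [x z|x y z w]; first by rewrite normr_id lerDr.
by apply: (le_trans (ler_dist_dist _ _)); rewrite lerDr mulr_ge0// addr_ge0.
Qed.

Lemma bl_grow B (G : 'rV[R]_d * W -> R) C (u : 'rV[R]_d -> W) :
  bounded_lipschitz B G -> bounded_lipschitz C u -> BL (fun x => grow G x (u x)).
Proof.
move=> GB uC; have L0 : 3 * B + 1 != 0.
  by rewrite gt_eqF// ltr_wpDl// mulr_ge0// (bounded_lipschitz_ge0 GB).
rewrite (_ : (fun x => _) =
    (fun x => (3 * B + 1) * ((3 * B + 1)^-1 * grow G x (u x)))).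
  apply: BLZ; exists (1 + C + C).
  exact: (test_fun_BL (grow_test GB) uC).
by apply/funext => x; rewrite mulrA mulfV// mul1r.
Qed.

Section integrand_integrals.
Variables (f : 'rV[R]_d -> W -> R) (g : 'rV[R]_d * W -> R).
Hypothesis gc : {within closure (Om `*` unit_ball W), continuous g}.
Hypothesis gf : forall x z, Om x -> unit_ball W z -> g (x, z) = ball_transform f x z.

Let ccl := compact_closure_ball (W := W) Om_bounded.

Lemma continuous_pair C (u : 'rV[R]_d -> W) :
  (forall x y, `|u x - u y| <= C * `|x - y|) -> continuous (fun x => (x, u x)).
Proof.
move=> uC; apply: (@lipschitz_continuous _ _ _ _ (1 + C)) => x y.
by apply: le_trans (pair_norm_le (x - y) (u x - u y)) _; rewrite mulrDl mul1r lerD2l.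
Qed.

Lemma integrand_slice_integrable z : `|z| <= 1 -> integrable_on (fun x => g (x, z)).
Proof.
move=> z1; have [M MP] := within_compact_bounded ccl gc.
apply: measurable_bounded_integrable; first exact: mOm.
- exact: lebesgue_rV_bounded.
- apply: (within_compact_measurable ccl gc (phi := fun x => (x, z)) mOm).
    by apply: (@continuous_pair 0) => x y; rewrite subrr normr0 mul0r.
  by move=> x Omx; exact: mem_closure_ball.
- exists M; split; first exact: num_real.
  move=> b Mb x Omx; apply: le_trans (ltW Mb).
  by apply: MP; exact: mem_closure_ball.
Qed.

Lemma integrand_integrable B (u : 'rV[R]_d -> W) : bounded_lipschitz B u ->
  integrable_on (fun x => f x (u x)).
Proof.
move=> uB; have B0 := bounded_lipschitz_ge0 uB.
have uc : continuous u by exact: lipschitz_continuous uB.2.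
have [M MP] := within_compact_bounded ccl gc.
have clu x : Om x -> closure (Om `*` unit_ball W) (x, shrink (u x)).
  by move=> Omx; apply: mem_closure_ball => //; exact/ltW/shrink_lt1.
have shL x y : `|shrink (u x) - shrink (u y)| <= 2 * B * `|x - y|.
  apply: (@le_trans _ _ (2 * `|u x - u y|)).
    by apply: le_trans (shrink_lipschitz _ _); rewrite mulrDl mul1r lerDl mulr_ge0.
  by rewrite -mulrA ler_wpM2l// uB.2.
apply: (eq_integrable mOm (EFin \o (fun x => (1 + `|u x|) * g (x, shrink (u x))))).
  by move=> x; rewrite inE => Omx /=; rewrite (integrandE gf).
apply: measurable_bounded_integrable; first exact: mOm.
- exact: lebesgue_rV_bounded.
- apply: measurable_funM.
    apply: measurable_funTS; apply: continuous_measurable_real.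
    apply: (@lipschitz_continuous _ _ _ _ B) => x y.
    rewrite opprD addrACA subrr add0r; apply: le_trans (ler_dist_dist _ _) _.
    exact: uB.2.
  apply: (within_compact_measurable ccl gc (phi := fun x => (x, shrink (u x))) mOm) => //.
  exact: continuous_pair shL.
- exists ((1 + B) * M); split; first exact: num_real.
  move=> b Mb x Omx; apply: le_trans (ltW Mb).
  rewrite /= normrM ger0_norm ?addr_ge0// ler_pM ?addr_ge0//.
    by rewrite lerD2l uB.1.
  by apply: MP; exact: clu.
Qed.

Lemma integrand_slices_integrable n (c : 'I_n -> R) (a : 'I_n -> W) :
  (forall i, `|a i| = 1) -> integrable_on (fun x => \sum_i c i * g (x, a i)).
Proof.
move=> a1.
apply: (eq_integrable mOm (fun x => \sum_(i < n) (c i)%:E * (g (x, a i))%:E)%E).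
  by move=> x _; rewrite /= -sumEFin; apply: eq_bigr => i _; rewrite EFinM.
apply: integrable_sum; first exact: mOm.
move=> i _; apply: integrableZl; first exact: mOm.
by apply: integrand_slice_integrable; rewrite a1.
Qed.

(** On [Om] times the sphere the recession function is [g], so the inner integral is a finite sum of
    slices of [g]. *)
Lemma integral_recession n (c : 'I_n -> {i01 R}) (a : 'I_n -> W) :
  (forall i, `|a i| = 1) ->
  (\int[mrestr mu mOm]_(x in Om)
    \int[atomic c (a : 'I_n -> borel W)]_(z in unit_sphere W) (recession Om f x z)%:E)%E =
  (I (fun x => \sum_i (c i)%:num * g (x, a i)))%:E.
Proof.
move=> a1; have mS : measurable (unit_sphere W : set (borel W)).
  rewrite -[unit_sphere W]setCK; apply: measurableC; apply: open_borel.
  apply: closed_openC; apply: (@closed_comp _ _ (fun z : W => `|z|) [set 1]) => [z _|].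
    exact: norm_continuous.
  exact: closed_eq.
rewrite (eq_measure_integral mu); last first.
  by move=> A mA AOm; rewrite -[LHS]/(mu (A `&` Om)) setIidl.
rewrite /Rintegral fineK; last first.
  exact: (integrable_fin_num mOm (integrand_slices_integrable (fun i => (c i)%:num) a1)).
apply: eq_integral => x; rewrite inE => Omx.
rewrite (eq_integral (fun z : borel W => (g (x : 'rV[R]_d, z : W))%:E)); last first.
  by move=> z; rewrite inE => z1; rewrite (recessionE Om_open Om_bounded gc gf).
rewrite integral_atomic//.
apply: (within_compact_measurable ccl gc (phi := fun z : W => (x : 'rV[R]_d, z)) mS).
  apply: (@lipschitz_continuous _ _ _ _ 1) => z w.
  by apply: le_trans (pair_norm_le (x - x) (z - w)) _; rewrite subrr normr0 add0r mul1r.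
by move=> z z1; apply: mem_closure_ball => //; rewrite z1.
Qed.

End integrand_integrals.

Variables (K : 'rV[R]_d -> {vspace W}) (d_gt0 : (0 < d)%N).
Hypothesis KZ : forall c xi (w : W), c != 0 -> w \in K xi -> w \in K (c *: xi).
Hypothesis K_lsc : forall xi (w : W) e, xi != 0 -> w \in K xi -> 0 < e ->
  exists2 del, 0 < del & forall eta, `|eta - xi| < del ->
    exists2 w', w' \in K eta & `|w' - w| <= e.

Lemma cone0 : cone K 0.
Proof.
exists (const_mx 1); last exact: mem0v.
apply/eqP => /rowP/(_ (Ordinal d_gt0)); rewrite !mxE => /eqP.
by rewrite oner_eq0.
Qed.

Lemma coneZ c w : cone K w -> cone K (c *: w).
Proof. by move=> [xi xi0 wK]; exists xi => //; exact: memvZ. Qed.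

(** The laminate runs on top of an admissible substitute [u] for the constant [a1]. The substitution
    costs [vol e], the realization [e]. *)
Lemma realize_splitting_at (a1 : W) (t : splitting W) e :
  lin_span (cone K) a1 -> splits_along (cone K) t -> 0 < e ->
  exists2 w, cone_field K w & forall F, test_fun F ->
    `|I (fun x => F x (w x)) - avg (fun y => I (fun x => F x (a1 + y))) t 0| <=
    (1 + vol) * e.
Proof.
move=> a1K tD e0.
have [u uK uP] := cone_field_cst KZ Om_bounded a1K e0.
have [B B0 uB] := cone_field_BL uK.
have [Y YK YP] := realize_splitting Om_open Om_bounded KZ K_lsc tD B
  (trig_poly_cst d (1 : R)) e0.
exists (fun x => u x + Y x) => [|F Ft]; first exact: cone_fieldD.
apply: (le_trans (ler_distD (avg (fun y => I (fun x => F x (u x + 1 *: y))) t 0) _ _)).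
rewrite mulrDl mul1r; apply: lerD; first exact: YP.
apply: avg_close => q ql; rewrite mulrC.
have b1 := bounded_lipschitzD uB (bounded_lipschitz_cst 'rV[R]_d (1 *: q.2)).
have b2 := bounded_lipschitz_cst 'rV[R]_d (a1 + q.2).
apply: (Rintegral_close Om_open Om_bounded (test_fun_BL Ft b1) (test_fun_BL Ft b2)).
move=> x Omx; apply: (le_trans (Ft.2 _ _ _ _)).
by rewrite subrr normr0 mulr0 add0r scale1r opprD addrACA subrr addr0 uP.
Qed.


Section estimate.
Variables (n : nat) (a : 'I_n.+1 -> W) (c : 'I_n.+1 -> {i01 R}).
Variables (t : splitting W) (e : R) (w : 'rV[R]_d -> W).
Hypothesis a1 : forall i, `|a i| = 1.
Hypotheses (tN : avg (fun y => `|y|) t 0 = 1) (tR : avg (ray_dist a) t 0 <= e).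
Hypotheses (tL : forall q, q \in law t 0 -> q.2 != 0 -> 1 <= e * `|q.2|).
Hypotheses (tw : forall i, `|ray_weight a t i - (c i)%:num| <= e).
Hypotheses (wK : cone_field K w) (wt : forall F, test_fun F ->
    `|I (fun x => F x (w x)) - avg (fun y => I (fun x => F x (a ord0 + y))) t 0| <=
    (1 + vol) * e).
Variables (f : 'rV[R]_d -> W -> R) (g : 'rV[R]_d * W -> R).
Hypothesis gc : {within closure (Om `*` unit_ball W), continuous g}.
Hypothesis gf : forall x z, Om x -> unit_ball W z -> g (x, z) = ball_transform f x z.
Variables (eta B M : R) (G : 'rV[R]_d * W -> R).
Hypotheses (GB : bounded_lipschitz B G) (eta0 : 0 < eta).
Hypothesis fG : forall x z, Om x -> `|f x z - grow G x z| <= eta * (1 + `|z|).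
Hypothesis gG : forall x z, Om x -> `|z| <= 1 -> `|g (x, z) - G (x, z)| <= eta.
Hypothesis gM : forall x i, Om x -> `|g (x, a i)| <= M.

Let B0 := bounded_lipschitz_ge0 GB.
Let v0 := vol_ge0 Om.

Lemma pointwise_estimate x : Om x ->
  `|avg (fun y => grow G x (a ord0 + y)) t 0 -
    (f x (a ord0) + \sum_i (c i)%:num * g (x, a i))| <=
  3 * eta + e * (8 * B + n.+1%:R * M).
Proof.
move=> Omx; pose r y := nearest_ray a y.
(* The expected contribution of a leaf: the value at the base point plus the recession part in the
   nearest direction. It is exact at the atom 0; at the others [1 <= e |y|] absorbs the constant
   [7 B] of [leaf_estimate]. *)
pose H y := grow G x (a ord0) + `|y| * g (x, a (r y)).
have H1 : `|avg (fun y => grow G x (a ord0 + y)) t 0 - avg H t 0| <=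
    (7 * B * e + eta) + B * e.
  apply: (@le_trans _ _ (avg (fun y => (7 * B * e + eta) * `|y| + B * ray_dist a y) t 0)).
    rewrite /avg -sumrB; apply: (le_trans (ler_norm_sum _ _ _)).
    rewrite big_seq [leRHS]big_seq; apply: ler_sum => q ql.
    rewrite -mulrBr normrM ger0_norm ?(law_ge0 ql)// ler_wpM2l ?(law_ge0 ql)//.
    rewrite /H opprD addrA; have [->|q0] := eqVneq q.2 0.
      rewrite addr0 subrr normr0 mulr0 mul0r subrr normr0 add0r mulr_ge0//.
      exact: normr_ge0.
    apply: le_trans (leaf_estimate q.2 GB (gG Omx _) (a1 _) (a1 (r q.2))) _.
      by rewrite a1.
    have B70 : 0 <= 7 * B by rewrite mulr_ge0.
    have := ler_wpM2l B70 (tL ql q0); rewrite /ray_dist -/(r q.2).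
    by lra.
  by rewrite avgD !avgZ tN mulr1 lerD2l ler_wpM2l.
have H2 : `|grow G x (a ord0) - f x (a ord0)| <= 2 * eta.
  by rewrite distrC; apply: (le_trans (fG _ Omx)); rewrite a1; lra.
have H3 : `|\sum_i ray_weight a t i * g (x, a i) - \sum_i (c i)%:num * g (x, a i)| <=
    n.+1%:R * (e * M).
  rewrite -sumrB; apply: (le_trans (ler_norm_sum _ _ _)).
  apply: (@le_trans _ _ (\sum_(i < n.+1) e * M)); last first.
    by rewrite sumr_const card_ord mulr_natl.
  by apply: ler_sum => i _; rewrite -mulrBl normrM ler_pM ?gM.
have HE : avg H t 0 = grow G x (a ord0) + \sum_i ray_weight a t i * g (x, a i).
  rewrite avgD avg_cst; congr (_ + _).
  have := sum_ray_weight (V := R^o) a (fun i => g (x, a i)) t.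
  move=> E; transitivity (\sum_(q <- law t 0) (q.1 * `|q.2|) * g (x, a (r q.2))).
    by apply: eq_bigr => q _; rewrite mulrA.
  by rewrite -[LHS]/(\sum_(q <- law t 0) (q.1 * `|q.2|) *: (g (x, a (r q.2)) : R^o)) -E.
rewrite HE in H1.
set A1 := avg _ t 0 in H1 *; set s1 := \sum_i _ in H1 H3; set s2 := \sum_i _ in H3 *.
have -> : A1 - (f x (a ord0) + s2) = (A1 - (grow G x (a ord0) + s1)) +
    ((grow G x (a ord0) - f x (a ord0)) + (s1 - s2)) by ring.
apply: (le_trans (ler_normD _ _)); apply: (le_trans (lerD H1 (ler_normD _ _))).
apply: (le_trans (lerD (lexx _) (lerD H2 H3))).
by rewrite le_eqVlt; apply/orP; left; apply/eqP; ring.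
Qed.

Lemma integral_estimate :
  `|I (fun x => f x (w x)) -
    (I (fun x => f x (a ord0)) + I (fun x => \sum_i (c i)%:num * g (x, a i)))| <=
  eta * (7 * vol + 1 + e * (1 + vol)) +
  e * ((3 * B + 1) * (1 + vol) + (8 * B + n.+1%:R * M) * vol).
Proof.
have [Bw Bw0 wB] := cone_field_BL wK.
have aB y := bounded_lipschitz_cst 'rV[R]_d (a ord0 + y).
have I1 r : I (fun=> r) = r * vol by rewrite Rintegral_cst//; exact: mOm.
have nw_bl : BL (fun x => `|w x|) by exists (1 + Bw + Bw); exact: test_fun_BL norm_test wB.
(* The norm is itself a test function, so the first moment of [w] is controlled by that of the
   laminate. This pays for exchanging [f] with [grow G]. *)
have Iw : I (fun x => `|w x|) <= 2 * vol + (1 + vol) * e.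
  have := wt norm_test; rewrite ler_norml lerBlDl => /andP[_] /le_trans; apply.
  rewrite lerD2r; apply: (@le_trans _ _ (avg (fun y => vol + vol * `|y|) t 0)).
    apply: le_avg => y; rewrite I1 mulrC -{2}[vol]mulr1 -mulrDr ler_wpM2l//.
    by apply: (le_trans (ler_normD _ _)); rewrite a1.
  by rewrite avgD avg_cst avgZ tN; lra.
have T1 : `|I (fun x => f x (w x)) - I (fun x => grow G x (w x))| <=
    eta * (vol + (2 * vol + (1 + vol) * e)).
  have one_bl : BL (fun _ : 'rV[R]_d => 1 : R).
    by exists 1; split => *; rewrite ?subrr ?normr0 ?normr1 ?mul1r.
  apply: (le_trans (Rintegral_dist_le (b := fun x => eta * (1 + `|w x|)) _ _ _ _)).
  - exact: integrand_integrable gc gf _ _ wB.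
  - exact: (BL_integrable Om_open Om_bounded (bl_grow GB wB)).
  - by apply: (BL_integrable Om_open Om_bounded); apply: BLZ; exact: BLD.
  - by move=> x Omx; exact: fG.
  rewrite RintegralZ_BL//; last exact: BLD.
  by rewrite RintegralD_BL// I1 mul1r ler_wpM2l ?(ltW eta0)// lerD2l.
have L0 : 0 < 3 * B + 1 by rewrite ltr_wpDl// mulr_ge0.
have T2 : `|I (fun x => grow G x (w x)) -
    avg (fun y => I (fun x => grow G x (a ord0 + y))) t 0| <=
    (3 * B + 1) * ((1 + vol) * e).
  rewrite -ler_pdivrMl// -[X in X * _]gtr0_norm ?invr_gt0// -normrM mulrBr -avgZ.
  rewrite -RintegralZ_BL//; last exact: bl_grow GB wB.
  rewrite (_ : avg _ t 0 =
    avg (fun y => I (fun x => (3 * B + 1)^-1 * grow G x (a ord0 + y))) t 0).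
    exact: (wt (grow_test GB)).
  apply: eq_avg => y; rewrite [RHS]RintegralZ_BL//.
  exact: bl_grow GB (aB y).
have avg_bl : BL (fun x => avg (fun y => grow G x (a ord0 + y)) t 0).
  by apply: BL_sum => q; apply: BLZ; exact: bl_grow GB (aB q.2).
have T3 : `|avg (fun y => I (fun x => grow G x (a ord0 + y))) t 0 -
    (I (fun x => f x (a ord0)) + I (fun x => \sum_i (c i)%:num * g (x, a i)))| <=
    (3 * eta + e * (8 * B + n.+1%:R * M)) * vol.
  have -> : avg (fun y => I (fun x => grow G x (a ord0 + y))) t 0 =
      I (fun x => avg (fun y => grow G x (a ord0 + y)) t 0).
    rewrite /avg Rintegral_sum_BL//; last first.
      by move=> q; apply: BLZ; exact: bl_grow GB (aB q.2).
    apply: eq_bigr => q _; rewrite RintegralZ_BL//.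
    exact: bl_grow GB (aB q.2).
  have if0 := integrand_integrable gc gf (bounded_lipschitz_cst 'rV[R]_d (a ord0)).
  have ig := integrand_slices_integrable gc (fun i => (c i)%:num) a1.
  rewrite -RintegralD//; last exact: mOm.
  rewrite -I1; apply: Rintegral_dist_le.
  - exact: BL_integrable.
  - exact: (integrableD mOm if0 ig).
  - exact: integrable_cst.
  - exact: pointwise_estimate.
apply: (le_trans (ler_distD (I (fun x => grow G x (w x))) _ _)).
apply: (le_trans (lerD T1 (ler_distD
  (avg (fun y => I (fun x => grow G x (a ord0 + y))) t 0) _ _))).
apply: (le_trans (lerD (lexx _) (lerD T2 T3))).
have : 0 <= eta * vol by rewrite mulr_ge0// ltW.
by have := ltW eta0; lra.
Qed.
End estimate.

Theorem cone_field_generates n (a : 'I_n.+1 -> W) :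
  (forall i, `|a i| = 1) -> (forall i, lin_span (cone K) (a i)) ->
  conv_hull (range a) 0 ->
  exists (c : 'I_n.+1 -> {i01 R}) (w : nat -> 'rV[R]_d -> W),
    [/\ \sum_i (c i)%:num = 1, \sum_i (c i)%:num *: a i = 0,
      forall j, cone_field K (w j) &
      generates Om w (a ord0) (mrestr mu mOm) (atomic c (a : 'I_n.+1 -> borel W))].
Proof.
move=> a1 aK a0.
have [c [t [c1 ca tP]]] := exists_limit_weights cone0 coneZ a1 aK a0.
have e0 (j : nat) : 0 < j.+1%:R^-1 :> R by rewrite invr_gt0.
have /choice[w wP] : forall j, exists w, cone_field K w /\ forall F, test_fun F ->
    `|I (fun x => F x (w x)) - avg (fun y => I (fun x => F x (a ord0 + y))) (t j) 0| <=
    (1 + vol) * j.+1%:R^-1.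
  move=> j; have [tD _ _ _ _] := tP j.
  by have [w wK wt] := realize_splitting_at (aK ord0) tD (e0 j); exists w.
exists c, w; split => //; first by move=> j; have [] := wP j.
have wB j := cone_field_BL (wP j).1.
split.
- move=> j; have [B B0 wjB] := wB j; split.
    apply: measurable_funTS; apply: continuous_measurable_fun.
    exact: lipschitz_continuous wjB.2.
  have : integrable_on (fun x => `|w j x|).
    apply: (BL_integrable Om_open Om_bounded).
    by exists (1 + B + B); exact: test_fun_BL norm_test wjB.
  move=> /integrableP[_]; under eq_integral do rewrite /= normr_id.
  by [].
- rewrite -[X in (X < _)%E]/(mu (Om `&` Om)) setIid; exact: lebesgue_rV_bounded.
- rewrite -[LHS]/(atomic c (a : _ -> borel W) (unit_sphere W)) /atomic.
  rewrite -[RHS]/(1%:E) -c1 -sumEFin; apply: eq_bigr => i _.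
  by rewrite diracE mem_set ?mule1//; exact: a1.
move=> f [fc [g gc gf]].
have [M MP] := within_compact_bounded (compact_closure_ball (W := W) Om_bounded) gc.
have gM x i : Om x -> `|g (x, a i)| <= M.
  by move=> Omx; apply: MP; apply: mem_closure_ball => //; rewrite a1.
rewrite (integral_recession gc gf c a1).
have fE u C : bounded_lipschitz C u ->
    (\int[mu]_(x in Om) (f x (u x))%:E)%E = (I (fun x => f x (u x)))%:E.
  move=> uC; rewrite /Rintegral fineK//; apply: (integrable_fin_num mOm).
  exact: integrand_integrable gc gf _ _ uC.
rewrite (fE _ _ (bounded_lipschitz_cst 'rV[R]_d (a ord0))) -EFinD.
rewrite (_ : (fun j => _) = EFin \o (fun j => I (fun x => f x (w j x)))); last first.
  by apply/funext => j; have [B _ wjB] := wB j; rewrite (fE _ _ wjB).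
apply: cvg_EFin; first by apply: nearW => j.
apply/cvgrPdist_le => r r0.
(* The error is at most [eta k1 + e k2] with [e = 1 / (j + 1)]. First [eta] is fixed from [k1]; it
   determines [G] and [B], hence [k2], and only then is [j] taken large. *)
have v0 := vol_ge0 Om; pose k1 := 7 * vol + 1 + (1 + vol).
have k10 : 0 < k1 by rewrite /k1; lra.
have eta0 : 0 < r / 2 / k1 by rewrite !divr_gt0.
have [B [G [GB fG gG]]] := integrand_approx Om_bounded gc gf eta0.
pose k2 := (3 * B + 1) * (1 + vol) + (8 * B + n.+1%:R * M) * vol.
have k20 : 0 < `|k2| + 1 by rewrite ltr_wpDl.
have r2 : 0 < r / 2 / (`|k2| + 1) by rewrite !divr_gt0.
have [N _ NP] := near_infty_natSinv_lt (PosNum r2).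
exists N => // j /= Nj; have := NP j Nj => /= ej.
have [tD tN tR tL tw] := tP j; have [wK wt] := wP j.
rewrite distrC; apply: le_trans (integral_estimate a1 tN tR tL tw wK wt
  gc gf GB eta0 fG gG gM) _.
apply: (@le_trans _ _ (r / 2 + r / 2)); last by rewrite -splitr.
apply: lerD.
  apply: (@le_trans _ _ (r / 2 / k1 * k1)); last by rewrite divfK// gt_eqF.
  apply: ler_wpM2l; first exact: ltW.
  rewrite /k1 lerD2l ler_piMl ?addr_ge0//.
  by rewrite invf_le1 ?ltr0n// ler1n.
apply: (@le_trans _ _ (j.+1%:R^-1 * (`|k2| + 1))).
  by rewrite ler_wpM2l ?(ltW (e0 j))// (le_trans (ler_norm _))// lerDl.
by rewrite -ler_pdivlMr// ltW.
Qed.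

End generation.

(** * Cone fields of kernels and of images *)

Section cone_fields_of_operators.
Context (R : realType) (d : nat).

Lemma lin_span_subset (V : vectType R) (S T : set V) : S `<=` T ->
  lin_span S `<=` lin_span T.
Proof. by move=> ST v [s sS vs]; exists s => // u /sS /ST. Qed.

Lemma kernel_cone_field (W X : euclideanType R) k (A : mindex d k -> 'Hom(W, X))
    (w : 'rV[R]_d -> W) : cone_field (fun xi => lker (symbol A xi)) w ->
  forall x, diff_op A w x = 0.
Proof.
move=> [L LK ->] x; rewrite diff_op_wave_sum /wave_sum /map_waves big_map.
rewrite big_seq big1// => q /LK[_]; rewrite memv_ker => /eqP /= ->.
by rewrite scaler0.
Qed.

(** Amplitudes are lifted by a partial inverse of the symbol, and phases are moved back by
    [k pi / 2] to undo the shift produced by the operator. *)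
Lemma image_cone_field (V W : euclideanType R) k (B : mindex d k -> 'Hom(V, W))
    (w : 'rV[R]_d -> W) : cone_field (fun xi => limg (symbol B xi)) w ->
  exists L : seq ('rV[R]_d * R * V), diff_op B (wave_sum L) = w.
Proof.
move=> [L LK ->].
exists (map_waves (- (k%:R * (pi / 2))) (fun xi => (symbol B xi)^-1%VF) L).
apply/funext => x; rewrite diff_op_wave_sum /wave_sum /map_waves !big_map.
rewrite big_seq [RHS]big_seq; apply: eq_bigr => q /LK[_ qK] /=.
by rewrite limg_lfunVK// subrK.
Qed.

(** At the frequency 0 the symbol is [0^k] times the symbol at any [eta], so its image is contained
    in one at a nonzero frequency. *)
Lemma image_cone_sub (V W : euclideanType R) k (B : mindex d k -> 'Hom(V, W)) :
  (0 < d)%N -> image_cone B `<=` cone (fun xi => limg (symbol B xi)).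
Proof.
move=> d0 w [xi wxi]; have [xi0|] := eqVneq xi 0; last by exists xi.
pose eta : 'rV[R]_d := const_mx 1; exists eta.
  apply/eqP => /rowP/(_ (Ordinal d0)); rewrite !mxE => /eqP.
  by rewrite oner_eq0.
move: wxi; rewrite xi0 -(scale0r eta) symbolZ => /memv_imgP[v _ ->].
by rewrite scale_lfunE memvZ// memv_img ?memvf.
Qed.

Lemma symbol_kernelZ (W X : euclideanType R) k (A : mindex d k -> 'Hom(W, X))
    c xi (w : W) : c != 0 ->
  w \in lker (symbol A xi) -> w \in lker (symbol A (c *: xi)).
Proof.
by rewrite !memv_ker symbolZ scale_lfunE => _ /eqP ->; rewrite scaler0.
Qed.

Lemma symbol_imageZ (V W : euclideanType R) k (B : mindex d k -> 'Hom(V, W))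
    c xi (w : W) : c != 0 ->
  w \in limg (symbol B xi) -> w \in limg (symbol B (c *: xi)).
Proof.
move=> c0 /memv_imgP[v _ ->]; have ck0 : c ^+ k != 0 by rewrite expf_neq0.
rewrite -[X in X \in _]scale1r -(mulVf ck0) -scalerA -scale_lfunE -symbolZ.
by rewrite memvZ// memv_img ?memvf.
Qed.

End cone_fields_of_operators.

Unset Implicit Arguments.

Local Open Scope ring_scope.

Theorem proposition3p1 (R : realType) (d : nat) (d_gt0 : (0 < d)%N)
    (V W X : euclideanType R) (Om : set 'rV[R]_d) (Om_open : open Om)
    (Om_bounded : bounded_set Om)
    (Om_bd0 : lebesgue_rV (closure Om `\` interior Om : set (borel 'rV[R]_d)) = 0%E) :
  (forall (k : nat) (A : mindex d k -> 'Hom(W, X)) (n : nat) (a : 'I_n.+1 -> W),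
    constant_rank A ->
    (forall i, lin_span (wave_cone A) (a i) /\ unit_sphere W (a i)) ->
    conv_hull (range a) 0 ->
    exists (c : 'I_n.+1 -> {i01 R}) (w : nat -> 'rV[R]_d -> W),
      [/\ \sum_(i < n.+1) (c i)%:num = 1,
          \sum_(i < n.+1) (c i)%:num *: a i = 0,
          forall j, smooth_on Om (w j),
          forall j x, Om x -> diff_op A (w j) x = 0 &
          generates Om w (a ord0)
            (mrestr (@lebesgue_rV R d) (open_borel Om_open))
            (atomic c (a : 'I_n.+1 -> borel W))]) /\
  (forall (k : nat) (B : mindex d k -> 'Hom(V, W)) (n : nat) (a : 'I_n.+1 -> W),
    constant_rank B ->
    (forall i, unit_sphere W (a i) /\ lin_span (image_cone B) (a i)) ->
    conv_hull (range a) 0 ->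
    exists (c : 'I_n.+1 -> {i01 R}) (u : nat -> 'rV[R]_d -> V),
      [/\ \sum_(i < n.+1) (c i)%:num = 1,
          \sum_(i < n.+1) (c i)%:num *: a i = 0,
          forall j, smooth_on Om (u j) &
          generates Om (fun j => diff_op B (u j)) (a ord0)
            (mrestr (@lebesgue_rV R d) (open_borel Om_open))
            (atomic c (a : 'I_n.+1 -> borel W))]).
Proof.
split=> k.
  move=> A n a Ark aA a0.
  have aS i : `|a i| = 1 by exact: (aA i).2.
  have [c [w [c1 ca wK wG]]] := cone_field_generates Om_open Om_bounded d_gt0
    (@symbol_kernelZ R d W X k A) (fun xi w e => @kernel_lsc R d W X k A xi w e Ark)
    aS (fun i => (aA i).1) a0.
  exists c, w; split => // [j|j x _]; last exact: kernel_cone_field.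
  by have [L _ ->] := wK j; exact: smooth_wave_sum.
move=> B n a _ aB a0.
have aS i : `|a i| = 1 by exact: (aB i).1.
have [c [w [c1 ca wK wG]]] := cone_field_generates Om_open Om_bounded d_gt0
  (@symbol_imageZ R d V W k B) (fun xi w e _ => @image_lsc R d V W k B xi w e)
  aS (fun i => lin_span_subset (@image_cone_sub R d V W k B d_gt0) (aB i).2) a0.
have /choice[L LP] : forall j, exists L : seq ('rV[R]_d * R * V),
    diff_op B (wave_sum L) = w j.
  by move=> j; exact: image_cone_field (wK j).
exists c, (fun j => wave_sum (L j)); split => //.
  by move=> j; exact: smooth_wave_sum.
by rewrite (_ : (fun j => _) = w)//; apply/funext => j; exact: LP.
Qed.
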